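(* Let $I=[a,b]\subset\mathbb{R}$ with $a<b$, and let $n\ge0$ be an integer. Then, for $x\in\mathbb{R}$, $$\mathbf{S}^I_n(x)=\mathbf{S}^{I,*}_n(x)\,\mathsf{E}_n,\qquad \mathcal{H}[\mathbf{S}^I_n](x)=\mathbf{S}^{I,*}_n(x)\,\mathsf{H}_n,$$ and, for $x\in\mathbb{R}\setminus\{a,b\}$, $$\frac{\mathrm{d}}{\mathrm{d}x}[\mathbf{S}^I_n](x)=\mathbf{S}^{I,*}_n(x)\,\mathsf{D}^I_n,\qquad (-\Delta)^{1/2}[\mathbf{S}^I_n](x)=\mathbf{S}^{I,*}_n(x)\,\mathsf{A}^I_n,$$ where the operators act column by column and the matrices $\mathsf{E}_n,\mathsf{H}_n,\mathsf{D}^I_n,\mathsf{A}^I_n\in\mathbb{R}^{(2n+7)\times(2n+3)}$ are as follows. Partition the rows into a first row followed by $n+3$ blocks of size $2$ (block rows $0,\dots,n+2$) and the columns into a first column followed by $n+1$ blocks of size $2$ (block columns $0,\dots,n$). Let $\mathsf{N}=\begin{pmatrix}-1&0\\0&1\end{pmatrix}$, $\mathsf{M}=\begin{pmatrix}0&1\\1&0\end{pmatrix}$. All entries are zero except: - $\mathsf{E}_n$: the first column has $-1$ in the first row and the vector $(0,1)^\top$ in block row $1$; for $k=0,\dots,n$, block column $k$ has $-\mathsf{N}/2$ in block row $k$ and $\mathsf{N}/2$ in block row $k+2$. - $\mathsf{H}_n$: the first column is zero; for $k=0,\dots,n$, block column $k$ has $-\mathsf{M}/2$ in block row $k$ and $\mathsf{M}/2$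 in block row $k+2$. - $\mathsf{D}^I_n$: the first column is zero; for $k=0,\dots,n$, block column $k$ has $\frac{2(k+1)}{b-a}\mathsf{N}$ in block row $k+1$. - $\mathsf{A}^I_n$: the first column is zero; for $k=0,\dots,n$, block column $k$ has $\frac{2(k+1)}{b-a}\mathsf{M}$ in block row $k+1$.
   Context: $T_n,U_n$ are Chebyshev polynomials of the first and second kind, and $(1-x^2)_+^{\pm1/2}=0$ for $|x|\ge1$. $W_n(x)=(1-x^2)_+^{1/2}U_n(x)$ and $V_n(x)=(1-x^2)_+^{-1/2}T_n(x)$. $\tilde{T}_n(x)=T_n(x)$ for $|x|\le1$ and $\tilde{T}_n(x)=(x-\mathrm{sgn}(x)\sqrt{x^2-1})^n$ for $|x|>1$ (so $\tilde{T}_0\equiv1$). $\tilde{U}_{-2}(x)=\tilde{U}_{-1}(x)=0$ for $|x|\le1$; for $|x|>1$, $\tilde{U}_{-2}(x)=-\frac{|x|}{\sqrt{x^2-1}}$ and $\tilde{U}_{-1}(x)=-\frac{\mathrm{sgn}(x)}{\sqrt{x^2-1}}$. $\tilde{U}_0=\tilde{T}_0+\tilde{U}_{-2}$, and $\tilde{U}_n=2\tilde{T}_n+\tilde{U}_{n-2}$ for $n\ge1$. For $I=[a,b]$ and $y=\frac{2}{b-a}\left(x-\frac{a+b}{2}\right)$, set $\tilde{T}^I_n(x)=\tilde{T}_n(y)$, $\tilde{U}^I_n(x)=\tilde{U}_n(y)$, $W^I_n(x)=W_n(y)$, $V^I_n(x)=V_n(y)$. Quasimatrices (rows of functions): $\mathbf{S}^I_n=(\tilde{T}_0\,|\,W^I_0,\tilde{T}^I_1\,|\,\cdots\,|\,W^I_n,\tilde{T}^I_{n+1})$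 with $2n+3$ columns, and $\mathbf{S}^{I,*}_n=(\tilde{U}^I_{-2}\,|\,V^I_0,\tilde{U}^I_{-1}\,|\,\cdots\,|\,V^I_{n+2},\tilde{U}^I_{n+1})$ with $2n+7$ columns. $\mathcal{H}[u](x)=\frac1\pi\,\mathrm{p.v.}\!\int_{\mathbb{R}}\frac{u(y)}{x-y}\,\mathrm{d}y$, with $\mathcal{H}[\tilde{T}_0]=0$. For Schwartz $\phi$, $(-\Delta)^{1/2}\phi(x)=\frac1\pi\,\mathrm{p.v.}\!\int_{\mathbb{R}}\frac{\phi(x)-\phi(y)}{|x-y|^2}\,\mathrm{d}y$; for $u\in L^2(\mathbb{R})$, $(-\Delta)^{1/2}u$ is the distribution $\langle(-\Delta)^{1/2}u,\phi\rangle=\int_{\mathbb{R}} u\,(-\Delta)^{1/2}\phi\,\mathrm{d}x$, identified with a function when given by one; $(-\Delta)^{1/2}\tilde{T}_0=0$. *)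

(* Defs.v *)
From HB Require Import structures.
From mathcomp Require Import all_boot all_order all_algebra.
From mathcomp Require Import all_classical all_reals all_analysis.
Set Implicit Arguments.
Unset Strict Implicit.
Unset Printing Implicit Defensive.
Import Order.TTheory GRing.Theory Num.Theory.
Import numFieldNormedType.Exports.

Local Open Scope classical_set_scope.
Local Open Scope ring_scope.

Section Chebyshev.
Variable R : realType.
Implicit Types (x y a b : R) (n k : nat).

Fixpoint chebT n : {poly R} :=
  match n with
  | 0 => 1
  | k.+1 => match k with
            | 0 => 'X
            | l.+1 => 2 *: 'X * chebT k - chebT l
            end
  end.

Fixpoint chebU n : {poly R} :=
  match n with
  | 0 => 1
  | k.+1 => match k with
            | 0 => 2 *: 'X
            | l.+1 => 2 *: 'X * chebU k - chebU l
            end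
  end.

Definition W n x : R :=
  if `|x| < 1 then Num.sqrt (1 - x ^+ 2) * (chebU n).[x] else 0.

Definition V n x : R :=
  if `|x| < 1 then (Num.sqrt (1 - x ^+ 2))^-1 * (chebT n).[x] else 0.

Definition Ttilde n x : R :=
  if `|x| <= 1 then (chebT n).[x]
  else (x - Num.sg x * Num.sqrt (x ^+ 2 - 1)) ^+ n.

(* The index is shifted by two, since the family starts at index -2:
   [Utilde2 m] is the extended second-kind function of index m - 2. *)
Fixpoint Utilde2 (m : nat) x : R :=
  match m with
  | 0 => if `|x| <= 1 then 0 else - (`|x| / Num.sqrt (x ^+ 2 - 1))
  | 1 => if `|x| <= 1 then 0 else - (Num.sg x / Num.sqrt (x ^+ 2 - 1))
  | k.+2 => if k == 0%N then Ttilde 0 x + Utilde2 k x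
            else 2 * Ttilde k x + Utilde2 k x
  end.

Definition rescale a b x : R := 2 / (b - a) * (x - (a + b) / 2).

End Chebyshev.

Section Partition.
Variable R : realType.

(* Indices 0, 1, 2, 3, 4, ... are partitioned as 0 | 1, 2 | 3, 4 | ...: an
   index i > 0 lies in block [blk i] at position [loc i] inside that block. *)
Definition blk (i : nat) : nat := (i.-1 %/ 2)%N.
Definition loc (i : nat) : 'I_2 := inord (i.-1 %% 2).

Definition Srow (a b : R) (n : nat) (x : R) : 'rV[R]_(2 * n + 3) :=
  \row_j (if j == 0%N :> nat then Ttilde 0 x
          else if loc j == 0 then W (blk j) (rescale a b x)
          else Ttilde (blk j).+1 (rescale a b x)).

(* Block k holds V_k and the extended second-kind function of index k - 1. *)
Definition Sstar (a b : R) (n : nat) (x : R) : 'rV[R]_(2 * n + 7) :=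
  \row_i (if i == 0%N :> nat then Utilde2 0 (rescale a b x)
          else if loc i == 0 then V (blk i) (rescale a b x)
          else Utilde2 (blk i).+1 (rescale a b x)).

(* [c0] is the top left entry, [c r] the part of the first column lying in
   block row r and [B r k] the block in block row r and block column k; the
   remaining entries of the first row are zero. *)
Definition assemble (n : nat) (c0 : R) (c : nat -> 'cV[R]_2)
    (B : nat -> nat -> 'M[R]_2) : 'M[R]_(2 * n + 7, 2 * n + 3) :=
  \matrix_(i, j)
    if j == 0%N :> nat then
      if i == 0%N :> nat then c0 else c (blk i) (loc i) 0
    else
      if i == 0%N :> nat then 0 else B (blk i) (blk j) (loc i) (loc j).

Definition mx2 (p q r s : R) : 'M[R]_2 :=
  block_mx p%:M q%:M r%:M s%:M : 'M[R]_(1 + 1).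

Definition Nmx : 'M[R]_2 := mx2 (-1) 0 0 1.
Definition Mmx : 'M[R]_2 := mx2 0 1 1 0.

Definition Emx (n : nat) : 'M[R]_(2 * n + 7, 2 * n + 3) :=
  assemble n (-1)
    (fun r => if r == 1%N then delta_mx 1 0 else 0)
    (fun r k => if r == k then - (2^-1 *: Nmx)
                else if r == k.+2 then 2^-1 *: Nmx else 0).

Definition Hmx (n : nat) : 'M[R]_(2 * n + 7, 2 * n + 3) :=
  assemble n 0 (fun=> 0)
    (fun r k => if r == k then - (2^-1 *: Mmx)
                else if r == k.+2 then 2^-1 *: Mmx else 0).

Definition Dmx (a b : R) (n : nat) : 'M[R]_(2 * n + 7, 2 * n + 3) :=
  assemble n 0 (fun=> 0)
    (fun r k => if r == k.+1 then (2 * k.+1%:R / (b - a)) *: Nmx else 0).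

Definition Amx (a b : R) (n : nat) : 'M[R]_(2 * n + 7, 2 * n + 3) :=
  assemble n 0 (fun=> 0)
    (fun r k => if r == k.+1 then (2 * k.+1%:R / (b - a)) *: Mmx else 0).

End Partition.

Section Operators.
Variable R : realType.
Local Notation mu := (@lebesgue_measure R).

Definition away (x e : R) : set R := [set y | e < `|x - y|].

Definition truncated_integral (f : R -> R) (x e : R) : R :=
  \int[mu]_(y in away x e) f y.

Definition is_pv (f : R -> R) (x l : R) : Prop :=
  (forall e, 0 < e -> mu.-integrable (away x e) (EFin \o f)) /\
  truncated_integral f x e @[e --> 0^'+] --> l.

(* [hilbert_at u x v]: the Hilbert transform of [u] exists at [x] and has
   value [v]; the constant function is sent to 0 by convention. *)
Definition hilbert_at (u : R -> R) (x v : R) : Prop :=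
  (u = Ttilde 0 /\ v = 0) \/
  (exists2 l, is_pv (fun y => u y / (x - y)) x l & v = pi^-1 * l).

Definition schwartz (phi : R -> R) : Prop :=
  (forall k x, derivable (derive1n k phi) x 1) /\
  (forall m k : nat, exists C : R,
     forall x, `|x| ^+ m * `|derive1n k phi x| <= C).

Definition half_laplacian_schwartz (phi : R -> R) (x : R) : R :=
  pi^-1 * lim (truncated_integral
    (fun y => (phi x - phi y) / `|x - y| ^+ 2) x e @[e --> 0^'+]).

(* [half_laplacian u g]: the distribution obtained by applying the half
   Laplacian to the square-integrable function [u] is given by the function
   [g]; the constant function is sent to 0 by convention. *)
Definition half_laplacian (u g : R -> R) : Prop :=
  (u = Ttilde 0 /\ g = cst 0) \/
  (u \in Lfun mu 2%:E /\
   forall phi, schwartz phi ->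
     mu.-integrable setT (fun x => (g x * phi x)%:E) /\
     \int[mu]_x (u x * half_laplacian_schwartz phi x) =
     \int[mu]_x (g x * phi x)).

End Operators.

(* Main.v *)
Require Import Defs.
From mathcomp Require Import all_boot all_order all_algebra.
From mathcomp Require Import all_classical all_reals all_analysis.
From mathcomp Require Import measurable_realfun zify ring lra.
Import Order.TTheory GRing.Theory Num.Theory.
Import numFieldNormedType.Exports.
Local Open Scope classical_set_scope.
Local Open Scope ring_scope.
Set Implicit Arguments.
Unset Strict Implicit.
Unset Printing Implicit Defensive.

(** The function [rho = z - sqrt (z ^ 2 - 1)] is holomorphic on the upper half
    plane, continuous up to the real line, bounded by 1 and [O(1 / |z|)], and the
    boundary values of [rho ^ (k+1)] are [Ttilde_(k+1) - i W_k].  Integrating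
    [F = rho ^ (k+1)] over the half circle of centre [x] and radius [r], the
    Cauchy-Riemann equations in polar coordinates give
      [(d/dr) \int_0^pi F (x + r e^(i t)) dt = (F (x - r) - F (x + r)) / (i r)],
    so that the truncated Hilbert transform of [F] at [x] is [- i / pi] times the
    integral of [F] over a half circle.  This yields [H F = - i F] at every real
    [x], the end points included, together with a uniform bound on the
    truncations.

    The half Laplacian of a Schwartz function is the Hilbert transform of its
    derivative.  Since the truncated Hilbert transform is antisymmetric (Fubini)
    and its truncations on [u] are uniformly bounded, dominated convergence gives
    [<u, (-Delta)^(1/2) phi> = - <H u, phi'>], and an integration by parts on the
    three intervals cut out by [a] and [b] identifies the result with
    [<(H u)', phi>]. *)

(** * Chebyshev polynomials *)

(** Integrating the radial derivative from e to infinity leaves only the arc of radius e, because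
    the decay of F kills the large arc; as e tends to 0 the small arc integral tends to pi F(x). The
    obstacle is that F is not differentiable at 1 and -1 and its derivative is unbounded near them.
    The Cauchy-Riemann step is therefore made on arcs whose centre is raised to a height y > 0. The
    integrated identity involves only F itself, which is continuous up to the line, so it survives y
    -> 0 at every real centre. Only one real component is tracked at a time: for a holomorphic f + i
    g the truncated transform of f is the arc integral of g, hence at most pi in modulus, and the
    pairs rho^(k+1) and i rho^(k+1) give the two kinds of columns. On the distributional side, u
    decays only like 1/|x|, so the truncated transforms of phi' must be shown to decay at that rate
    as well. The derivative of H u has inverse square root singularities at a and b; its
    integrability comes from bounded primitives and not from estimates near the singularities. *)

Section ChebyshevPolynomials.
Variable R : realType.
Implicit Types (x : R) (n k : nat).

Lemma chebTSS n : chebT R n.+2 = 2 * 'X * chebT R n.+1 - chebT R n.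
Proof. by rewrite -[LHS]/(2 *: 'X * chebT R n.+1 - chebT R n) -mul_polyC rmorph_nat. Qed.

Lemma chebUSS n : chebU R n.+2 = 2 * 'X * chebU R n.+1 - chebU R n.
Proof. by rewrite -[LHS]/(2 *: 'X * chebU R n.+1 - chebU R n) -mul_polyC rmorph_nat. Qed.

Lemma chebU1 : chebU R 1 = 2 * 'X.
Proof. by rewrite [chebU R 1]/= -mul_polyC rmorph_nat. Qed.

(** With X = cos t this is the addition formula for cos ((n+1) t + t); [chebU_first_order] is the
    one for sin. The defining recurrence has order two, so the induction carries two consecutive
    indices. *)
Lemma chebT_first_order n :
  chebT R n.+2 = 'X * chebT R n.+1 - (1 - 'X ^+ 2) * chebU R n.
Proof.
suff : chebT R n.+2 = 'X * chebT R n.+1 - (1 - 'X ^+ 2) * chebU R n /\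
  chebT R n.+3 = 'X * chebT R n.+2 - (1 - 'X ^+ 2) * chebU R n.+1.
  by case.
elim: n => [|n [IH0 IH1]].
  by rewrite !chebTSS chebU1 /=; split; ring.
split => //.
transitivity (2 * 'X * ('X * chebT R n.+2 - (1 - 'X ^+ 2) * chebU R n.+1) -
    ('X * chebT R n.+1 - (1 - 'X ^+ 2) * chebU R n)).
  by rewrite -IH1 -IH0 chebTSS.
by rewrite chebUSS (chebTSS n.+1); ring.
Qed.

Lemma chebU_first_order n : chebU R n.+1 = 'X * chebU R n + chebT R n.+1.
Proof.
suff : chebU R n.+1 = 'X * chebU R n + chebT R n.+1 /\
  chebU R n.+2 = 'X * chebU R n.+1 + chebT R n.+2.
  by case.
elim: n => [|n [IH0 IH1]].
  by rewrite chebUSS !chebTSS chebU1 /=; split; ring.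
split => //.
transitivity (2 * 'X * ('X * chebU R n.+1 + chebT R n.+2) -
    ('X * chebU R n + chebT R n.+1)).
  by rewrite -IH1 -IH0 chebUSS.
by rewrite (chebTSS n.+1) (chebUSS n); ring.
Qed.

Lemma chebT_diff n :
  chebT R n - chebT R n.+2 = 2 * ((1 - 'X ^+ 2) * chebU R n).
Proof.
have := chebT_first_order n; have -> : chebT R n = 2 * 'X * chebT R n.+1 - chebT R n.+2.
  by rewrite chebTSS; ring.
by move=> ->; ring.
Qed.

Lemma chebU_diff n : chebU R n.+2 = 2 * chebT R n.+2 + chebU R n.
Proof.
have -> : chebU R n = 2 * 'X * chebU R n.+1 - chebU R n.+2.
  by rewrite chebUSS; ring.
by rewrite (chebU_first_order n.+1); ring.
Qed.

(** Differentiating the two first-order relations makes T' depend on U' and U' on T', so both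
    formulas go through one induction. The second is kept multiplied by 1 - X^2 to stay among
    polynomials. *)
Lemma deriv_cheb n : (chebT R n.+1)^`() = n.+1%:R * chebU R n /\
  (1 - 'X ^+ 2) * (chebU R n)^`() = 'X * chebU R n - n.+1%:R * chebT R n.+1.
Proof.
elim: n => [|n [IHT IHU]]; first by rewrite /= derivX derivC; split; ring.
rewrite chebT_first_order chebU_first_order !poly.derivE IHT; split.
  transitivity (chebT R n.+1 + 'X * (n.+1%:R * chebU R n) + 2 * 'X * chebU R n -
    (1 - 'X ^+ 2) * (chebU R n)^`()); first by ring.
  by rewrite IHU; ring.
transitivity ((1 - 'X ^+ 2) * chebU R n + 'X * ((1 - 'X ^+ 2) * (chebU R n)^`()) +
    n.+1%:R * ((1 - 'X ^+ 2) * chebU R n)); first by ring.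
by rewrite IHU; ring.
Qed.

Lemma Tn_recr n x :
  (chebT R n.+2).[x] = x * (chebT R n.+1).[x] - (1 - x ^+ 2) * (chebU R n).[x].
Proof. by rewrite chebT_first_order !hornerE. Qed.

Lemma Un_recr n x :
  (chebU R n.+1).[x] = x * (chebU R n).[x] + (chebT R n.+1).[x].
Proof. by rewrite chebU_first_order !hornerE. Qed.

Lemma W_V n x : W n x = (V n x - V n.+2 x) / 2.
Proof.
rewrite /W /V; case: ifPn => [x1|_]; last by rewrite subrr mul0r.
have s0 : 0 < 1 - x ^+ 2 by rewrite subr_gt0 -real_normK ?num_real// expr_lt1.
have : (chebT R n).[x] - (chebT R n.+2).[x] = 2 * ((1 - x ^+ 2) * (chebU R n).[x]).
  by rewrite -hornerN -hornerD chebT_diff !hornerE.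
have : 0 < Num.sqrt (1 - x ^+ 2) by rewrite sqrtr_gt0.
have := sqr_sqrtr (ltW s0); set s := Num.sqrt _ => <- sn0 e.
by rewrite -mulrBr e; field; exact: lt0r_neq0.
Qed.

Lemma Ttilde_Utilde0 x : Ttilde 0 x = Utilde2 2 x - Utilde2 0 x.
Proof. by rewrite [Utilde2 2 x]/= addrK. Qed.

Lemma Ttilde_Utilde k x :
  Ttilde k.+1 x = (Utilde2 k.+3 x - Utilde2 k.+1 x) / 2.
Proof. by rewrite [Utilde2 k.+3 x]/= addrK mulrC mulKf. Qed.

Lemma Utilde_in k x : `|x| <= 1 -> Utilde2 k.+2 x = (chebU R k).[x].
Proof.
move=> x1; suff : Utilde2 k.+2 x = (chebU R k).[x] /\
  Utilde2 k.+3 x = (chebU R k.+1).[x] by case.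
elim: k => [|k [IH0 IH1]].
  rewrite /= /Ttilde x1 !addr0; split => //=.
  by rewrite !hornerE.
split=> //; rewrite -[LHS]/(2 * Ttilde k.+2 x + Utilde2 k.+2 x) IH0.
by rewrite /Ttilde x1 chebU_diff !hornerE.
Qed.

Lemma sqrt_sqr_sub1 x : 1 < `|x| ->
  0 < Num.sqrt (x ^+ 2 - 1) /\ Num.sqrt (x ^+ 2 - 1) ^+ 2 = x ^+ 2 - 1.
Proof.
move=> x1; have s0 : 0 < x ^+ 2 - 1.
  by rewrite subr_gt0 -real_normK ?num_real// expr_gt1.
by rewrite sqrtr_gt0 sqr_sqrtr ?ltW.
Qed.

(** With s = sqrt (x^2 - 1) and r = x - sg(x) s one has r^(k+3) - r^(k+1) = - 2 sg(x) s r^(k+2),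
    which is the defining recurrence. The closed form fails at index -2, since index 0 adds
    [Ttilde 0] once and not twice, so the induction starts from indices 0 and 1. *)
Lemma Utilde_out k x : 1 < `|x| ->
  Utilde2 k.+2 x = - (Num.sg x * (x - Num.sg x * Num.sqrt (x ^+ 2 - 1)) ^+ k.+1
    / Num.sqrt (x ^+ 2 - 1)).
Proof.
move=> x1; have [] := sqrt_sqr_sub1 x1.
set s := Num.sqrt _ => s0 s2; pose r := x - Num.sg x * s.
have x0 : x != 0 by rewrite -normr_gt0 (lt_trans _ x1).
have g2 : Num.sg x ^+ 2 = 1 by rewrite sqr_sg x0.
suff : Utilde2 k.+2 x = - (Num.sg x * r ^+ k.+1 / s) /\
  Utilde2 k.+3 x = - (Num.sg x * r ^+ k.+2 / s) by case.
have sn0 : s != 0 by rewrite lt0r_neq0.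
have r2 : r ^+ 2 = 2 * x * r - 1.
  rewrite /r; transitivity (x ^+ 2 - 2 * Num.sg x * x * s + Num.sg x ^+ 2 * s ^+ 2); first by ring.
  by rewrite s2 g2; ring: s2 g2.
elim: k => [|k [IH0 IH1]].
  have T1 : Ttilde 1 x = r by rewrite /Ttilde leNgt x1.
  have T0 : Ttilde 0 x = 1 by rewrite /Ttilde leNgt x1.
  rewrite [LHS]/= [Utilde2 3 x]/= T1 T0 leNgt x1 /= -/s expr1; split.
    apply: (mulIf sn0); rewrite mulrDl !mulNr !mulfVK// normrEsg /r.
    by ring: g2.
  apply: (mulIf sn0); rewrite mulrDl !mulNr !mulfVK// r2 /r.
  by ring: g2 s2.
split=> //; rewrite -[LHS]/(2 * Ttilde k.+2 x + Utilde2 k.+2 x) IH0.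
have -> : Ttilde k.+2 x = r ^+ k.+2 by rewrite /Ttilde leNgt x1.
suff : 2 * r ^+ 2 * s - Num.sg x * r = - (Num.sg x * r * r ^+ 2).
  move=> h; apply: (mulIf sn0).
  rewrite mulrDl !mulNr !mulfVK//.
  transitivity (r ^+ k * (2 * r ^+ 2 * s - Num.sg x * r)); first by rewrite !exprS; ring.
  by rewrite h !exprS; ring.
by rewrite r2 /r; ring: g2 s2.
Qed.

End ChebyshevPolynomials.

#[local] Arguments Utilde2 : simpl never.
#[local] Arguments chebT : simpl never.
#[local] Arguments chebU : simpl never.

(** * Columns of the block matrices *)

Section BlockColumns.
Variable R : realType.
Implicit Types (a b x : R) (n : nat).

Lemma sum_blocks m (F : nat -> R) :
  \sum_(i < 2 * m + 1) F i = F 0%N + \sum_(r < m) (F (2 * r).+1 + F (2 * r).+2).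
Proof.
elim: m => [|m IH]; first by rewrite big_ord0 muln0 add0n big_ord1 addr0.
have -> : (2 * m.+1 + 1 = (2 * m + 1).+2)%N by lia.
by rewrite !big_ord_recr /= IH -!addrA addn1.
Qed.

Lemma blk_odd r : blk (2 * r).+1 = r.
Proof. by rewrite /blk /= mulKn. Qed.

Lemma blk_even r : blk (2 * r).+2 = r.
Proof. by rewrite /blk /=; lia. Qed.

Lemma loc_odd r : loc (2 * r).+1 = 0.
Proof. by apply/val_inj; rewrite /loc /= inordK ?ltn_pmod//; lia. Qed.

Lemma loc_even r : loc (2 * r).+2 = 1.
Proof. by apply/val_inj; rewrite /loc /= inordK ?ltn_pmod//; lia. Qed.

Lemma mul_assemble a b x n c0 (c : nat -> 'cV[R]_2) B (j : 'I_(2 * n + 3)) :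
  (Sstar a b n x *m assemble n c0 c B) 0 j =
  let y := rescale a b x in
  if j == 0%N :> nat then
    Utilde2 0 y * c0 +
      \sum_(r < n.+3) (V r y * c r 0 0 + Utilde2 r.+1 y * c r 1 0)
  else \sum_(r < n.+3) (V r y * B r (blk j) 0 (loc j) +
                        Utilde2 r.+1 y * B r (blk j) 1 (loc j)).
Proof.
rewrite mxE; cbv zeta; pose F (i : nat) : R := (if i == 0%N then Utilde2 0 (rescale a b x)
  else if loc i == 0 then V (blk i) (rescale a b x)
  else Utilde2 (blk i).+1 (rescale a b x)) *
  (if j == 0%N :> nat then if i == 0%N then c0 else c (blk i) (loc i) 0
   else if i == 0%N then 0 else B (blk i) (blk j) (loc i) (loc j)).
transitivity (\sum_(i < 2 * n + 7) F i).
  by apply: eq_bigr => i _; rewrite !mxE.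
have -> : (2 * n + 7 = 2 * n.+3 + 1)%N by lia.
rewrite sum_blocks /F /=; case: ifPn => j0.
    congr (_ + _); apply: eq_bigr => r _.
  by rewrite !blk_odd !blk_even !loc_odd !loc_even.
rewrite mulr0 add0r; apply: eq_bigr => r _.
by rewrite !blk_odd !blk_even !loc_odd !loc_even.
Qed.

Lemma blk_le n (j : 'I_(2 * n + 3)) : (blk j <= n)%N.
Proof. by case: j => j /= h; rewrite /blk; lia. Qed.

Lemma sum_block_at m r0 (F : nat -> R) : (r0 < m)%N ->
  (forall r, r != r0 -> F r = 0) -> \sum_(r < m) F r = F r0.
Proof.
move=> h F0; rewrite (bigD1 (Ordinal h))//= big1 ?addr0// => i ir.
by apply: F0; apply: contra ir => /eqP e; apply/eqP/val_inj.
Qed.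

Lemma mx2E (p q r s : R) : [/\ mx2 p q r s 0 0 = p, mx2 p q r s 0 1 = q,
  mx2 p q r s 1 0 = r & mx2 p q r s 1 1 = s].
Proof.
rewrite /mx2.
have e0 : (0 : 'I_(1 + 1)) = lshift 1 ord0 by apply/val_inj.
have e1 : (1 : 'I_(1 + 1)) = rshift 1 ord0 by apply/val_inj.
rewrite e0 e1; split.
- by apply: etrans (block_mxEul _ _ _ _ _ _) _; rewrite mxE eqxx mulr1n.
- by apply: etrans (block_mxEur _ _ _ _ _ _) _; rewrite mxE eqxx mulr1n.
- by apply: etrans (block_mxEdl _ _ _ _ _ _) _; rewrite mxE eqxx mulr1n.
- by apply: etrans (block_mxEdr _ _ _ _ _ _) _; rewrite mxE eqxx mulr1n.
Qed.

Lemma Nmx00 : Nmx R 0 0 = -1. Proof. by case: (mx2E (-1) 0 0 1). Qed.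
Lemma Nmx01 : Nmx R 0 1 = 0. Proof. by case: (mx2E (-1) 0 0 1). Qed.
Lemma Nmx10 : Nmx R 1 0 = 0. Proof. by case: (mx2E (-1) 0 0 1). Qed.
Lemma Nmx11 : Nmx R 1 1 = 1. Proof. by case: (mx2E (-1) 0 0 1). Qed.
Lemma Mmx00 : Mmx R 0 0 = 0. Proof. by case: (mx2E 0 1 1 0). Qed.
Lemma Mmx01 : Mmx R 0 1 = 1. Proof. by case: (mx2E 0 1 1 0). Qed.
Lemma Mmx10 : Mmx R 1 0 = 1. Proof. by case: (mx2E 0 1 1 0). Qed.
Lemma Mmx11 : Mmx R 1 1 = 0. Proof. by case: (mx2E 0 1 1 0). Qed.
Definition NMmxE := (Nmx00, Nmx01, Nmx10, Nmx11, Mmx00, Mmx01, Mmx10, Mmx11).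

Lemma sum_band_shift n k (c : R) (N : 'M[R]_2) (l : 'I_2) (v u : nat -> R) :
  (k <= n)%N ->
  \sum_(r < n.+3) (v r * (if r == k.+1 :> nat then c *: N else 0) 0 l +
                   u r * (if r == k.+1 :> nat then c *: N else 0) 1 l) =
  c * (v k.+1 * N 0 l + u k.+1 * N 1 l).
Proof.
move=> kn; pose M (r : nat) : 'M[R]_2 := if r == k.+1 then c *: N else 0.
rewrite (@sum_block_at _ k.+1 (fun r => v r * M r 0 l + u r * M r 1 l)).
- by rewrite /M eqxx !mxE; ring.
- by lia.
- by move=> r /negPf rk; rewrite /M rk !mxE; ring.
Qed.

Lemma sum_band_diff n k (c : R) (N : 'M[R]_2) (l : 'I_2) (v u : nat -> R) :
  (k <= n)%N ->
  \sum_(r < n.+3) (v r * (if r == k :> nat then - (c *: N)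
                          else if r == k.+2 :> nat then c *: N else 0) 0 l +
                   u r * (if r == k :> nat then - (c *: N)
                          else if r == k.+2 :> nat then c *: N else 0) 1 l) =
  c * ((v k.+2 - v k) * N 0 l + (u k.+2 - u k) * N 1 l).
Proof.
move=> kn; pose M (j r : nat) : 'M[R]_2 := if r == j then c *: N else 0.
(* The block rows k and k+2 are distinct, so the nested conditional is a difference of two bands
   with one nonzero row each. *)
rewrite (eq_bigr (fun r : 'I_n.+3 => (v r * M k.+2 r 0 l + u r * M k.+2 r 1 l) -
    (v r * M k r 0 l + u r * M k r 1 l))); last first.
  move=> r _; rewrite /M; case: eqP => [->|_]; last by rewrite !mxE; ring.
  have kk : (k == k.+2) = false by lia.
  by rewrite kk !mxE; ring.
rewrite sumrB (@sum_block_at _ k.+2 (fun r => v r * M k.+2 r 0 l + u r * M k.+2 r 1 l)); last 2 first.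
- by lia.
- by move=> r /negPf rk; rewrite /M rk !mxE; ring.
rewrite (@sum_block_at _ k (fun r => v r * M k r 0 l + u r * M k r 1 l)); last 2 first.
- by lia.
- by move=> r /negPf rk; rewrite /M rk !mxE; ring.
by rewrite /M !eqxx !mxE; ring.
Qed.

Lemma SrowE a b n x (j : 'I_(2 * n + 3)) :
  Srow a b n x 0 j = if j == 0%N :> nat then Ttilde 0 x
          else if loc j == 0 then W (blk j) (rescale a b x)
          else Ttilde (blk j).+1 (rescale a b x).
Proof. by rewrite mxE. Qed.

Lemma loc_cases (i : nat) : loc i = 0 \/ loc i = 1.
Proof.
case: (loc i) => -[|[|//]] h; [left|right]; exact/val_inj.
Qed.

Lemma Ttilde0 x : Ttilde 0 x = 1.
Proof. by rewrite /Ttilde; case: ifP => // _; rewrite /= hornerC. Qed.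

Lemma SstarE_col a b n x (j : 'I_(2 * n + 3)) :
  (Sstar a b n x *m Emx R n) 0 j = Srow a b n x 0 j.
Proof.
rewrite mul_assemble SrowE /=; set y := rescale a b x.
case: ifPn => j0.
  pose c (r : nat) : 'cV[R]_2 := if r == 1%N then delta_mx 1 0 else 0.
  rewrite (@sum_block_at _ 1%N (fun r => V r y * c r 0 0 + Utilde2 r.+1 y * c r 1 0))//.
    by have := Ttilde_Utilde0 y; rewrite /c /= !mxE /= !Ttilde0; lra.
  by move=> r /negPf r1; rewrite /c r1 !mxE; ring.
rewrite (sum_band_diff _ _ _ (fun r => V r y) (fun r => Utilde2 r.+1 y)) ?blk_le//.
case: (loc_cases j) => -> /=; rewrite !NMmxE ?eqxx.
  by rewrite W_V; ring.
by rewrite Ttilde_Utilde; ring.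
Qed.

Lemma SstarH_col a b n x (j : 'I_(2 * n + 3)) :
  (Sstar a b n x *m Hmx R n) 0 j = if j == 0%N :> nat then 0
    else if loc j == 0 then Ttilde (blk j).+1 (rescale a b x)
    else - W (blk j) (rescale a b x).
Proof.
rewrite mul_assemble /=; set y := rescale a b x.
case: ifPn => j0.
  by rewrite mulr0 add0r big1// => r _; rewrite !mxE; ring.
rewrite (sum_band_diff _ _ _ (fun r => V r y) (fun r => Utilde2 r.+1 y)) ?blk_le//.
case: (loc_cases j) => -> /=; rewrite !NMmxE ?eqxx.
  by rewrite Ttilde_Utilde; ring.
by rewrite W_V; ring.
Qed.

Lemma SstarD_col a b n x (j : 'I_(2 * n + 3)) :
  (Sstar a b n x *m Dmx a b n) 0 j = if j == 0%N :> nat then 0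
    else 2 * (blk j).+1%:R / (b - a) *
      (if loc j == 0 then - V (blk j).+1 (rescale a b x)
       else Utilde2 (blk j).+2 (rescale a b x)).
Proof.
rewrite mul_assemble /=; set y := rescale a b x.
case: ifPn => j0.
  by rewrite mulr0 add0r big1// => r _; rewrite !mxE; ring.
rewrite (sum_band_shift _ _ _ (fun r => V r y) (fun r => Utilde2 r.+1 y)) ?blk_le//.
case: (loc_cases j) => -> /=; rewrite !NMmxE ?eqxx; first by ring.
by congr (_ * _); ring.
Qed.

Lemma SstarA_col a b n x (j : 'I_(2 * n + 3)) :
  (Sstar a b n x *m Amx a b n) 0 j = if j == 0%N :> nat then 0
    else 2 * (blk j).+1%:R / (b - a) *
      (if loc j == 0 then Utilde2 (blk j).+2 (rescale a b x)
       else V (blk j).+1 (rescale a b x)).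
Proof.
rewrite mul_assemble /=; set y := rescale a b x.
case: ifPn => j0.
  by rewrite mulr0 add0r big1// => r _; rewrite !mxE; ring.
rewrite (sum_band_shift _ _ _ (fun r => V r y) (fun r => Utilde2 r.+1 y)) ?blk_le//.
case: (loc_cases j) => -> /=; rewrite !NMmxE ?eqxx; first by congr (_ * _); ring.
by congr (_ * _); ring.
Qed.

End BlockColumns.

(** * Derivatives of the columns *)

Section PointwiseDerivatives.
Variable R : realType.
Implicit Types (f g : R -> R) (t a b c : R).

Lemma is_derive1_ext f g t a b : is_derive t 1 f a -> f =1 g -> a = b ->
  is_derive t 1 g b.
Proof. by move=> df /funext <- <-. Qed.

Lemma is_derive1D f g t a b : is_derive t 1 f a -> is_derive t 1 g b ->
  is_derive t 1 (fun s => f s + g s) (a + b).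
Proof. by move=> df dg; exact: is_deriveD. Qed.

Lemma is_derive1B f g t a b : is_derive t 1 f a -> is_derive t 1 g b ->
  is_derive t 1 (fun s => f s - g s) (a - b).
Proof. by move=> df dg; exact: is_deriveB. Qed.

Lemma is_derive1N f t a : is_derive t 1 f a -> is_derive t 1 (fun s => - f s) (- a).
Proof. by move=> df; exact: is_deriveN. Qed.

Lemma is_derive1M f g t a b : is_derive t 1 f a -> is_derive t 1 g b ->
  is_derive t 1 (fun s => f s * g s) (a * g t + f t * b).
Proof.
move=> df dg; apply: (is_derive1_ext (is_deriveM df dg)) => //.
by rewrite /GRing.scale /= addrC (mulrC a).
Qed.

Lemma is_derive1_comp_fun f g t a b : is_derive (g t) 1 f a -> is_derive t 1 g b ->
  is_derive t 1 (fun s => f (g s)) (a * b).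
Proof. by move=> df dg; exact: is_derive1_comp. Qed.

Lemma is_derive1_cst c t : is_derive t 1 (fun=> c) 0.
Proof. exact: is_derive_cst. Qed.

Lemma is_derive1_id t : is_derive t 1 (fun s : R => s) 1.
Proof. exact: is_derive_id. Qed.

Lemma is_derive1Zl c f t a : is_derive t 1 f a -> is_derive t 1 (fun s => c * f s) (c * a).
Proof.
move=> df; apply: is_derive1_ext (is_derive1M (is_derive1_cst c t) df) _ _ => //.
by rewrite mul0r add0r.
Qed.

Lemma is_derive1X f n t a : is_derive t 1 f a ->
  is_derive t 1 (fun s => f s ^+ n) (n%:R * f t ^+ n.-1 * a).
Proof.
move=> df; apply: is_derive1_ext (is_deriveX n df) _ _ => // s.
by rewrite fctE.
Qed.

Lemma is_derive1V f t a : is_derive t 1 f a -> f t != 0 ->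
  is_derive t 1 (fun s => (f s)^-1) (- a / f t ^+ 2).
Proof.
move=> df f0; apply: is_derive1_ext (is_deriveV f0 df) _ _ => //.
by rewrite /GRing.scale /= !mulNr mulrC.
Qed.

Lemma is_derive1_sqrtf f t a : is_derive t 1 f a -> 0 < f t ->
  is_derive t 1 (fun s => Num.sqrt (f s)) (a / (2 * Num.sqrt (f t))).
Proof.
move=> df f0; apply: is_derive1_ext (is_derive1_comp_fun (is_derive1_sqrt f0) df) _ _ => //.
by rewrite mulrC.
Qed.

Lemma is_derive1_continuous f t a : is_derive t 1 f a -> {for t, continuous f}.
Proof. by move=> [/derivable1_diffP/differentiable_continuous]. Qed.

Lemma is_derive1_unique f t a b : is_derive t 1 f a -> is_derive t 1 f b -> a = b.
Proof. by move=> [_ <-] [_ <-]. Qed.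

Lemma near_is_derive1 f g t a : (\near t, f t = g t) -> is_derive t 1 f a ->
  is_derive t 1 g a.
Proof. exact: near_eq_is_derive. Qed.

End PointwiseDerivatives.


Section ChebyshevDerivatives.
Variable R : realType.
Implicit Types (x : R) (k : nat).

Lemma deriv_Tn k x : (chebT R k.+1)^`().[x] = k.+1%:R * (chebU R k).[x].
Proof.
have [-> _] := deriv_cheb R k.
by rewrite hornerM -polyC_natr hornerC.
Qed.

Lemma deriv_Un k x : (1 - x ^+ 2) * (chebU R k)^`().[x] =
  x * (chebU R k).[x] - k.+1%:R * (chebT R k.+1).[x].
Proof.
have [_] := deriv_cheb R k => /(congr1 (horner^~ x)).
by rewrite -polyC_natr !hornerE.
Qed.

Lemma near_norm_lt1 x : `|x| < 1 -> \near x, `|x| < 1.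
Proof.
move=> x1; near=> y.
have : `|x - y| < 1 - `|x| by near: y; apply: nbhsx_ballx; rewrite subr_gt0.
have := lerB_dist y x; rewrite distrC; lra.
Unshelve. all: by end_near. Qed.

Lemma near_norm_gt1 x : 1 < `|x| -> \near x, 1 < `|x|.
Proof.
move=> x1; near=> y.
have : `|x - y| < `|x| - 1 by near: y; apply: nbhsx_ballx; rewrite subr_gt0.
have := lerB_dist x y; lra.
Unshelve. all: by end_near. Qed.

Lemma near_sg x : x != 0 -> \forall y \near x, Num.sg y = Num.sg x.
Proof.
move=> x0; near=> y.
have : `|x - y| < `|x| by near: y; apply: nbhsx_ballx; rewrite normr_gt0.
have [xn|xp|x00] := ltgtP x 0; last by move: (x0); rewrite x00 eqxx.
  rewrite (ltr0_norm xn) => xy; rewrite !ltr0_sg//.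
  by move: xy; have := ler_norm (y - x); rewrite distrC; lra.
rewrite (gtr0_norm xp) => xy; rewrite !gtr0_sg//.
by move: xy; have := ler_norm (x - y); lra.
Unshelve. all: by end_near. Qed.

Lemma norm_eq1 x : x != 1 -> x != -1 -> `|x| != 1.
Proof. by move=> x1 xN1; rewrite eqr_norml ler01 andbT negb_or x1. Qed.

Lemma is_derive_W k x : x != 1 -> x != -1 ->
  is_derive x 1 (W k) (- (k.+1%:R * V k.+1 x)).
Proof.
move=> x1 xN1; have := norm_eq1 x1 xN1; rewrite neq_lt => /orP[xl|xg].
  have s0 : 0 < 1 - x ^+ 2 by rewrite subr_gt0 -real_normK ?num_real// expr_lt1.
  apply: (@near_is_derive1 _ (fun y => Num.sqrt (1 - y ^+ 2) * (chebU R k).[y])).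
    near=> y; rewrite /W ifT//; near: y; exact: near_norm_lt1.
  have dU : is_derive x 1 (fun y => (chebU R k).[y]) (chebU R k)^`().[x].
    exact: is_derive_poly.
  have ds := is_derive1_sqrtf (is_derive1B (is_derive1_cst 1 x)
    (is_derive1X 2 (is_derive1_id x))) s0.
  apply: is_derive1_ext (is_derive1M ds dU) _ _ => //.
  rewrite /V xl; have : 0 < Num.sqrt (1 - x ^+ 2) by rewrite sqrtr_gt0.
  have := sqr_sqrtr (ltW s0); set s := Num.sqrt _ => s2 /lt0r_neq0 sn0.
  (* After multiplication by s the derivative of U appears as s^2 U', that is (1 - x^2) U', the form
     that [deriv_Un] evaluates. *)
  apply: (mulIf sn0); have := deriv_Un k x; rewrite -s2 => e.
  transitivity (s ^+ 2 * (chebU R k)^`().[x] - x * (chebU R k).[x]); first by field.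
  by rewrite e; field.
apply: (@near_is_derive1 _ (fun=> 0)).
  near=> y; rewrite /W ltNge ifF//; apply/negbF/ltW; near: y; exact: near_norm_gt1.
by rewrite /V ltNge (ltW xg) mulr0 oppr0; exact: is_derive1_cst.
Unshelve. all: by end_near. Qed.

Lemma is_derive_Ttilde k x : x != 1 -> x != -1 ->
  is_derive x 1 (Ttilde k.+1) (k.+1%:R * Utilde2 k.+2 x).
Proof.
move=> x1 xN1; have := norm_eq1 x1 xN1; rewrite neq_lt => /orP[xl|xg].
  apply: (@near_is_derive1 _ (fun y => (chebT R k.+1).[y])).
    near=> y; rewrite /Ttilde ifT//; apply/ltW; near: y; exact: near_norm_lt1.
  rewrite Utilde_in ?ltW// -deriv_Tn; exact: is_derive_poly.
(* The sign is locally constant away from 0. Freezing it at x leaves a differentiable expression,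
   and the derivative of y - g sqrt (y^2 - 1) at x is - g / s times its value. *)
pose g := Num.sg x.
apply: (@near_is_derive1 _ (fun y => (y - g * Num.sqrt (y ^+ 2 - 1)) ^+ k.+1)).
  near=> y; have y1 : 1 < `|y| by near: y; exact: near_norm_gt1.
  rewrite /Ttilde leNgt y1/=; congr ((_ - _ * _) ^+ _).
  by rewrite /g; apply/esym; near: y; apply: near_sg; rewrite -normr_gt0 (lt_trans _ xg).
have [s0 s2] := sqrt_sqr_sub1 xg.
have s0' : 0 < x ^+ 2 - 1 by rewrite -sqrtr_gt0.
have ds := is_derive1_sqrtf (is_derive1B (is_derive1X 2 (is_derive1_id x))
    (is_derive1_cst 1 x)) s0'.
apply: is_derive1_ext (is_derive1X k.+1 (is_derive1B (is_derive1_id x)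
  (is_derive1Zl g ds))) _ _ => //.
have gg : g ^+ 2 = 1 by rewrite sqr_sg -normr_gt0 (lt_trans _ xg).
rewrite Utilde_out// -/g /= -mulrA; congr (_ * _).
move: s0 {s2 ds}; set s := Num.sqrt _ => /lt0r_neq0 s0.
rewrite (exprSr _ k); set P := (x - g * s) ^+ k; apply: (mulIf s0).
rewrite mulNr mulfVK//; transitivity (P * (s - g * x)); first by field.
by ring: gg.
Unshelve. all: by end_near. Qed.

Lemma is_derive_rescale a b x : is_derive x 1 (@rescale R a b) (2 / (b - a)).
Proof.
apply: is_derive1_ext (is_derive1Zl (2 / (b - a)) (is_derive1B (is_derive1_id x)
  (is_derive1_cst ((a + b) / 2) x))) _ _ => //.
by rewrite subr0 mulr1.
Qed.

Lemma rescale_neq a b x : a < b -> x != a -> x != b ->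
  rescale a b x != 1 /\ rescale a b x != -1.
Proof.
move=> ab xa xb; have d0 : b - a != 0 by rewrite subr_eq0 gt_eqF.
have e : rescale a b x = (2 * x - (a + b)) / (b - a) by rewrite /rescale; field.
split; rewrite e; [apply: contra xb|apply: contra xa] => /eqP h; apply/eqP;
  move: h => /(congr1 (fun y => y * (b - a))); rewrite mulfVK//; lra.
Qed.

Lemma is_derive_Srow a b n (j : 'I_(2 * n + 3)) x : a < b -> x != a -> x != b ->
  is_derive x 1 (fun t => Srow a b n t 0 j) ((Sstar a b n x *m Dmx a b n) 0 j).
Proof.
move=> ab xa xb; have [y1 yN1] := rescale_neq ab xa xb.
have dr := is_derive_rescale a b x.
rewrite SstarD_col; apply: is_derive1_ext (_ : is_derive x 1
  (fun t => if j == 0%N :> nat then Ttilde 0 x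
          else if loc j == 0 then W (blk j) (rescale a b t)
          else Ttilde (blk j).+1 (rescale a b t)) _) _ erefl; last first.
  by move=> t; rewrite SrowE; case: ifP => // _; rewrite !Ttilde0.
case: ifP => _; first exact: is_derive1_cst.
case: ifP => _.
  apply: is_derive1_ext (is_derive1_comp_fun (is_derive_W (blk j) y1 yN1) dr) _ _ => //.
  by ring.
apply: is_derive1_ext (is_derive1_comp_fun (is_derive_Ttilde (blk j) y1 yN1) dr) _ _ => //.
by ring.
Qed.

End ChebyshevDerivatives.

(** * The inverse Joukowsky map on the upper half plane *)

Section PointwiseContinuity.
Variable R : realType.
Implicit Types (f g : R -> R) (t c : R).

Lemma continuous1_cst c t : {for t, continuous (fun=> c : R)}.
Proof. exact: cvg_cst. Qed.

Lemma continuous1_id t : {for t, continuous (fun s : R => s)}.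
Proof. exact: cvg_id. Qed.

Lemma continuous1D f g t : {for t, continuous f} -> {for t, continuous g} ->
  {for t, continuous (fun s => f s + g s)}.
Proof. by move=> cf cg; apply: cvgD. Qed.

Lemma continuous1B f g t : {for t, continuous f} -> {for t, continuous g} ->
  {for t, continuous (fun s => f s - g s)}.
Proof. by move=> cf cg; apply: cvgB. Qed.

Lemma continuous1N f t : {for t, continuous f} -> {for t, continuous (fun s => - f s)}.
Proof. by move=> cf; apply: cvgN. Qed.

Lemma continuous1M f g t : {for t, continuous f} -> {for t, continuous g} ->
  {for t, continuous (fun s => f s * g s)}.
Proof. by move=> cf cg; apply: cvgM. Qed.

Lemma continuous1X f n t : {for t, continuous f} -> {for t, continuous (fun s => f s ^+ n)}.
Proof.
move=> cf; elim: n => [|n IH].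
  have -> : (fun s => f s ^+ 0) = fun=> 1 by apply/funext => s; rewrite expr0.
  exact: continuous1_cst.
have -> : (fun s => f s ^+ n.+1) = fun s => f s * f s ^+ n.
  by apply/funext => s; rewrite exprS.
exact: continuous1M.
Qed.

Lemma continuous1V f t : f t != 0 -> {for t, continuous f} ->
  {for t, continuous (fun s => (f s)^-1)}.
Proof. by move=> f0 cf; apply: cvgV. Qed.

Lemma continuous1_comp f g t : {for g t, continuous f} -> {for t, continuous g} ->
  {for t, continuous (fun s => f (g s))}.
Proof. by move=> cf cg; exact: continuous_comp. Qed.

Lemma continuous1_sqrt f t : {for t, continuous f} ->
  {for t, continuous (fun s => Num.sqrt (f s))}.
Proof. by move=> cf; apply: continuous1_comp cf; exact: sqrt_continuous. Qed.

End PointwiseContinuity.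

Section Joukowsky.
Variable R : realType.
Implicit Types (X Y : R).

(* Elliptic coordinates: for [z = X + i Y = cosh (s + i t)] with foci -1 and 1,
   [ell_cosh], [ell_sinh], [ell_cos], [ell_sin] are [cosh s], [sinh s], [cos t],
   [sin t], and [jou_re + i jou_im] is [rho = exp (- s - i t)].  These formulas are
   continuous on the whole plane, without any choice of branch. *)
Definition focal1 X Y : R := Num.sqrt ((X + 1) ^+ 2 + Y ^+ 2).
Definition focal2 X Y : R := Num.sqrt ((X - 1) ^+ 2 + Y ^+ 2).
Definition ell_cosh X Y : R := (focal1 X Y + focal2 X Y) / 2.
Definition ell_cos X Y : R := (focal1 X Y - focal2 X Y) / 2.
Definition ell_sinh X Y : R := Num.sqrt (ell_cosh X Y ^+ 2 - 1).
Definition ell_sin X Y : R := Num.sqrt (1 - ell_cos X Y ^+ 2).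

Definition jou_re X Y : R := (ell_cosh X Y - ell_sinh X Y) * ell_cos X Y.
Definition jou_im X Y : R := - ((ell_cosh X Y - ell_sinh X Y) * ell_sin X Y).

Lemma focal_facts X Y : [/\ 0 <= focal1 X Y, 0 <= focal2 X Y,
  focal1 X Y ^+ 2 = (X + 1) ^+ 2 + Y ^+ 2 & focal2 X Y ^+ 2 = (X - 1) ^+ 2 + Y ^+ 2].
Proof. by rewrite !sqrtr_ge0 !sqr_sqrtr ?addr_ge0 ?sqr_ge0. Qed.

Lemma le_sqrt_sum_sqr (x y : R) : `|x| <= Num.sqrt (x ^+ 2 + y ^+ 2).
Proof. by rewrite -sqrtr_sqr ler_sqrt ?addr_ge0 ?sqr_ge0// lerDl sqr_ge0. Qed.

Lemma ell_cosh_ge1 X Y : 1 <= ell_cosh X Y.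
Proof.
have := le_sqrt_sum_sqr (X + 1) Y; have := le_sqrt_sum_sqr (X - 1) Y.
rewrite /ell_cosh /focal1 /focal2; have := ler_norm (X + 1); have := ler_norm (1 - X).
rewrite (distrC 1); lra.
Qed.

Lemma ell_mul X Y : ell_cosh X Y * ell_cos X Y = X.
Proof.
have [_ _ h1 h2] := focal_facts X Y; rewrite /ell_cosh /ell_cos.
transitivity ((focal1 X Y ^+ 2 - focal2 X Y ^+ 2) / 4); first by field.
by rewrite h1 h2; field.
Qed.

Lemma ell_mul2 X Y : (ell_cosh X Y ^+ 2 - 1) * (1 - ell_cos X Y ^+ 2) = Y ^+ 2.
Proof.
have [_ _ h1 h2] := focal_facts X Y.
transitivity (ell_cosh X Y ^+ 2 + ell_cos X Y ^+ 2 - 1 - (ell_cosh X Y * ell_cos X Y) ^+ 2).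
  by ring.
rewrite ell_mul /ell_cosh /ell_cos.
transitivity ((focal1 X Y ^+ 2 + focal2 X Y ^+ 2) / 2 - 1 - X ^+ 2); first by field.
by rewrite h1 h2; field.
Qed.

(** The distances to the two foci differ by at most 2, the distance between the foci; this triangle
    inequality is proved by squaring. *)
Lemma ell_cos2_le1 X Y : ell_cos X Y ^+ 2 <= 1.
Proof.
have [a0 b0 h1 h2] := focal_facts X Y.
have hX : `|X - 1| <= focal2 X Y by exact: le_sqrt_sum_sqr.
have hX1 : `|X + 1| <= focal1 X Y by exact: le_sqrt_sum_sqr.
have h : `|ell_cos X Y| <= 1.
  rewrite /ell_cos ler_norml; apply/andP; split.
    suff : focal2 X Y <= focal1 X Y + 2 by lra.
    rewrite -(@ler_pXn2r _ 2)// ?nnegrE; last by lra.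
    rewrite sqrrD h1 h2; have := ler_norm (- (X + 1)); rewrite normrN; lra.
  suff : focal1 X Y <= focal2 X Y + 2 by lra.
  rewrite -(@ler_pXn2r _ 2)// ?nnegrE; last by lra.
  rewrite sqrrD h1 h2; have := ler_norm (X - 1); lra.
by rewrite -real_normK ?num_real// expr_le1.
Qed.

Lemma ell_sinhE X Y : 0 <= ell_sinh X Y /\ ell_sinh X Y ^+ 2 = ell_cosh X Y ^+ 2 - 1.
Proof.
split; first exact: sqrtr_ge0.
by rewrite sqr_sqrtr// subr_ge0 expr_ge1// ?ell_cosh_ge1// (le_trans _ (ell_cosh_ge1 X Y)).
Qed.

Lemma ell_sinE X Y : 0 <= ell_sin X Y /\ ell_sin X Y ^+ 2 = 1 - ell_cos X Y ^+ 2.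
Proof. by split; [exact: sqrtr_ge0|rewrite sqr_sqrtr// subr_ge0 ell_cos2_le1]. Qed.

(** Both factors are nonnegative square roots, so the coordinates describe the closed upper half
    plane only; this is where the sign of Y enters. *)
Lemma ell_sinh_sin X Y : 0 <= Y -> ell_sinh X Y * ell_sin X Y = Y.
Proof.
move=> Y0; rewrite /ell_sinh /ell_sin -sqrtrM.
  by rewrite ell_mul2 sqrtr_sqr ger0_norm.
by have [_ <-] := ell_sinhE X Y; rewrite sqr_ge0.
Qed.

Lemma jou_mod X Y : jou_re X Y ^+ 2 + jou_im X Y ^+ 2 =
  (ell_cosh X Y - ell_sinh X Y) ^+ 2.
Proof.
have [_ s2] := ell_sinE X Y; rewrite /jou_re /jou_im; move: s2.
move: (ell_cosh X Y) (ell_sinh X Y) (ell_cos X Y) (ell_sin X Y) => m s c t t2.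
by ring: t2.
Qed.

(** Here e = exp (- s), because e (cosh s + sinh s) = 1. The last bound, combined with
    [ell_cosh_ge], yields the decay of rho at infinity. *)
Lemma jou_mod_bound X Y :
  let e := ell_cosh X Y - ell_sinh X Y in
  [/\ 0 <= e, e <= 1 & e * ell_cosh X Y <= 1].
Proof.
have [s0 s2] := ell_sinhE X Y; have c1 := ell_cosh_ge1 X Y; rewrite /=.
have e0 : 0 <= ell_cosh X Y - ell_sinh X Y.
  rewrite subr_ge0 -(@ler_pXn2r _ 2)// ?nnegrE ?s2//; lra.
have e2 : (ell_cosh X Y - ell_sinh X Y) * (ell_cosh X Y + ell_sinh X Y) = 1.
  by rewrite -subr_sqr s2; ring.
have e3 : (ell_cosh X Y - ell_sinh X Y) * ell_cosh X Y <= 1.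
  by rewrite -[leRHS]e2 ler_wpM2l// lerDl.
split=> //; apply: le_trans e3; rewrite -[leLHS]mulr1 ler_wpM2l//.
Qed.

Lemma ell_cosh_ge X Y : 0 <= Y -> `|X| + `|Y| <= 2 * ell_cosh X Y.
Proof.
move=> Y0; have [s0 s2] := ell_sinhE X Y; have [t0 t2] := ell_sinE X Y.
have c1 := ell_cosh_ge1 X Y; have c0 : 0 <= ell_cosh X Y by lra.
have hX : `|X| <= ell_cosh X Y.
  rewrite -[X in `|X|](ell_mul X Y) normrM ger0_norm// -[leRHS]mulr1 ler_wpM2l//.
  by rewrite -(@ler_pXn2r _ 2)// ?nnegrE// expr1n real_normK ?num_real// ell_cos2_le1.
have hY : `|Y| <= ell_cosh X Y.
  rewrite -[X in `|X|](ell_sinh_sin X Y0) normrM !ger0_norm// -[leRHS]mulr1 ler_pM//.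
    by rewrite -(@ler_pXn2r _ 2)// ?nnegrE// s2; lra.
  rewrite -(@ler_pXn2r _ 2)// ?nnegrE// t2 expr1n; have := sqr_ge0 (ell_cos X Y); lra.
lra.
Qed.

(** The real part and half the imaginary part of rho^2 - 2 z rho + 1 = 0, from which rho' is
    obtained without differentiating the nested roots explicitly. *)
Lemma jou_quadratic X Y : 0 <= Y ->
  jou_re X Y ^+ 2 - jou_im X Y ^+ 2 - 2 * (X * jou_re X Y - Y * jou_im X Y) + 1 = 0 /\
  jou_re X Y * jou_im X Y - (X * jou_im X Y + Y * jou_re X Y) = 0.
Proof.
move=> Y0; have [s0 s2] := ell_sinhE X Y; have [t0 t2] := ell_sinE X Y.
have hX := ell_mul X Y; have hY := ell_sinh_sin X Y0.
rewrite /jou_re /jou_im; move: s2 t2 hX hY.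
move: (ell_cosh X Y) (ell_sinh X Y) (ell_cos X Y) (ell_sin X Y) {s0 t0 Y0} => m s c t.
by move=> s2 t2 <- <-; split; ring: s2 t2.
Qed.

(** Off the real axis no radicand in the elliptic coordinates vanishes: the last two are squares
    with product Y^2. Hence all the nested square roots are differentiable there. *)
Lemma ell_interior X Y : 0 < Y ->
  [/\ 0 < focal1 X Y ^+ 2, 0 < focal2 X Y ^+ 2, 0 < ell_cosh X Y ^+ 2 - 1 &
      0 < 1 - ell_cos X Y ^+ 2].
Proof.
move=> Y0; have [_ _ h1 h2] := focal_facts X Y.
have Y2 : 0 < Y ^+ 2 by rewrite exprn_gt0.
have := ell_mul2 X Y; have [_ <-] := ell_sinhE X Y; have [_ <-] := ell_sinE X Y.
move=> h; split.
- by rewrite h1 ltr_wpDl ?sqr_ge0.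
- by rewrite h2 ltr_wpDl ?sqr_ge0.
- rewrite lt_neqAle sqr_ge0 andbT; apply/eqP => e; move: Y2; rewrite -h -e mul0r ltxx//.
- rewrite lt_neqAle sqr_ge0 andbT; apply/eqP => e; move: Y2; rewrite -h -e mulr0 ltxx//.
Qed.

End Joukowsky.

#[local] Arguments chebT : simpl never.
#[local] Arguments chebU : simpl never.

(** * Powers of the inverse Joukowsky map as holomorphic pairs *)

Section HalfPlaneHolomorphic.
Variable R : realType.
Implicit Types (f g p q : R -> R -> R) (X Y : R -> R) (t : R).

(** Testing continuity along curves reduces it to one variable on the lines and arcs used later. [U]
    constrains the height at the point itself: [setT] expresses continuity up to the real line,
    positivity is used for derivatives. *)
Definition curve_continuous (f : R -> R -> R) (U : R -> Prop) := forall X Y t,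
  {for t, continuous X} -> {for t, continuous Y} -> U (Y t) ->
  {for t, continuous (fun s => f (X s) (Y s))}.

(* [f + i g] is holomorphic on the upper half plane with derivative [p + i q];
   differentiability is phrased along curves, which is all that is needed and
   avoids two-variable calculus. *)
Definition holo_deriv f g p q := forall X Y t (X' Y' : R),
  is_derive t 1 X X' -> is_derive t 1 Y Y' -> 0 < Y t ->
  is_derive t 1 (fun s => f (X s) (Y s)) (p (X t) (Y t) * X' - q (X t) (Y t) * Y') /\
  is_derive t 1 (fun s => g (X s) (Y s)) (p (X t) (Y t) * Y' + q (X t) (Y t) * X').

(** The bound depends on [y0] because the derivative of rho blows up at 1 and -1: it is bounded on
    each half plane of positive height but not up to the real line. *)
Definition bounded_above f := forall y0 : R, 0 < y0 ->
  exists C : R, forall x y, y0 <= y -> `|f x y| <= C.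

(** The functions f + i g that are holomorphic in the open half plane, continuous up to the line and
    bounded. Decay is asked of g alone because only arc integrals of g are sent to infinity; its
    constant 2 comes from [ell_cosh_ge]. *)
Definition cauchy_pair f g :=
  [/\ curve_continuous f setT /\ curve_continuous g setT,
      (forall x y, `|f x y| <= 1) /\ (forall x y, `|g x y| <= 1),
      (forall x y, 0 <= y -> (`|x| + `|y|) * `|g x y| <= 2) &
      exists p q, [/\ holo_deriv f g p q,
        curve_continuous p (fun y => 0 < y) /\ curve_continuous q (fun y => 0 < y) &
        bounded_above p /\ bounded_above q]].

Lemma jou_curve_continuous :
  curve_continuous (@jou_re R) setT /\ curve_continuous (@jou_im R) setT.
Proof.
have cA : curve_continuous (@focal1 R) setT.
  move=> X Y t cX cY _; apply: continuous1_sqrt; apply: continuous1D; apply: continuous1X => //.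
  by apply: continuous1D => //; exact: continuous1_cst.
have cB : curve_continuous (@focal2 R) setT.
  move=> X Y t cX cY _; apply: continuous1_sqrt; apply: continuous1D; apply: continuous1X => //.
  by apply: continuous1B => //; exact: continuous1_cst.
have cm : curve_continuous (@ell_cosh R) setT.
  move=> X Y t cX cY _; apply: continuous1M; last exact: continuous1_cst.
  by apply: continuous1D; [exact: cA|exact: cB].
have cn : curve_continuous (@ell_cos R) setT.
  move=> X Y t cX cY _; apply: continuous1M; last exact: continuous1_cst.
  by apply: continuous1B; [exact: cA|exact: cB].
have cs : curve_continuous (@ell_sinh R) setT.
  move=> X Y t cX cY _; apply: continuous1_sqrt; apply: continuous1B; last exact: continuous1_cst.
  by apply: continuous1X; exact: cm.
have ct : curve_continuous (@ell_sin R) setT.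
  move=> X Y t cX cY _; apply: continuous1_sqrt; apply: continuous1B; first exact: continuous1_cst.
  by apply: continuous1X; exact: cn.
split=> X Y t cX cY _; last apply: continuous1N;
  (apply: continuous1M; [apply: continuous1B; [exact: cm|exact: cs]|]).
  exact: cn.
exact: ct.
Qed.

Definition jou_den (x y : R) := (jou_re x y - x) ^+ 2 + (jou_im x y - y) ^+ 2.

Definition jou_re' (x y : R) :=
  (jou_re x y * (jou_re x y - x) + jou_im x y * (jou_im x y - y)) / jou_den x y.
Definition jou_im' (x y : R) :=
  (jou_im x y * (jou_re x y - x) - jou_re x y * (jou_im x y - y)) / jou_den x y.

Lemma jou_im_le0 (x y : R) : jou_im x y <= 0.
Proof.
rewrite oppr_le0 mulr_ge0//; last by case: (ell_sinE x y).
by case: (jou_mod_bound x y).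
Qed.

Lemma jou_le1 (x y : R) : `|jou_re x y| <= 1 /\ `|jou_im x y| <= 1.
Proof.
have [e0 e1 _] := jou_mod_bound x y; have h := jou_mod x y.
have h1 : (ell_cosh x y - ell_sinh x y) ^+ 2 <= 1 by rewrite expr_le1.
have := sqr_ge0 (jou_re x y); have := sqr_ge0 (jou_im x y) => i2 r2.
by split; rewrite -(@expr_le1 _ 2)// real_normK ?num_real//; lra.
Qed.

(** Since rho lies in the closed lower half plane, rho - z has imaginary part at most - y. This
    keeps rho / (rho - z) bounded above every positive height. *)
Lemma jou_den_ge (x y y0 : R) : 0 < y0 -> y0 <= y -> y0 ^+ 2 <= (jou_im x y - y) ^+ 2.
Proof.
move=> y00 yy; rewrite -[leRHS]sqrrN ler_pXn2r// ?nnegrE; have := jou_im_le0 x y; lra.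
Qed.

Lemma jou_den_gt0 (x y : R) : 0 < y -> 0 < jou_den x y.
Proof.
move=> y0; apply: lt_le_trans (_ : y ^+ 2 <= _); first by rewrite exprn_gt0.
by rewrite (le_trans (jou_den_ge x y0 (lexx y)))// /jou_den lerDr sqr_ge0.
Qed.

(** The explicit formulas serve only for the existence of the derivatives; the unwieldy values they
    produce are discarded, and [jou_holo] recovers them from the quadratic equation. *)
Lemma jou_derivable X Y t (X' Y' : R) :
  is_derive t 1 X X' -> is_derive t 1 Y Y' -> 0 < Y t ->
  exists a' b' : R, is_derive t 1 (fun s => jou_re (X s) (Y s)) a' /\
    is_derive t 1 (fun s => jou_im (X s) (Y s)) b'.
Proof.
move=> dX dY Y0; have [A0 B0 m0 n0] := ell_interior (X t) Y0.
have [_ _ eA eB] := focal_facts (X t) (Y t).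
have dA := is_derive1_sqrtf (is_derive1D (is_derive1X 2 (is_derive1D dX (is_derive1_cst 1 t)))
  (is_derive1X 2 dY)) (_ : 0 < (X t + 1) ^+ 2 + Y t ^+ 2).
rewrite eA in A0; have {}dA := dA A0.
have dB := is_derive1_sqrtf (is_derive1D (is_derive1X 2 (is_derive1B dX (is_derive1_cst 1 t)))
  (is_derive1X 2 dY)) (_ : 0 < (X t - 1) ^+ 2 + Y t ^+ 2).
rewrite eB in B0; have {}dB := dB B0.
have [m' dm] : exists m', is_derive t 1 (fun s => ell_cosh (X s) (Y s)) m'.
  eexists; exact: is_derive1M (is_derive1D dA dB) (is_derive1_cst 2^-1 t).
have [n' dn] : exists n', is_derive t 1 (fun s => ell_cos (X s) (Y s)) n'.
  eexists; exact: is_derive1M (is_derive1B dA dB) (is_derive1_cst 2^-1 t).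
have ds := is_derive1_sqrtf (is_derive1B (is_derive1X 2 dm) (is_derive1_cst 1 t)) m0.
have dt := is_derive1_sqrtf (is_derive1B (is_derive1_cst 1 t) (is_derive1X 2 dn)) n0.
eexists; eexists; split; first exact: is_derive1M (is_derive1B dm ds) dn.
exact: is_derive1N (is_derive1M (is_derive1B dm ds) dt).
Qed.

(* Implicit differentiation of [rho^2 - 2 z rho + 1 = 0]:
   [rho' = rho / (rho - z)]. *)
Lemma jou_holo : holo_deriv (@jou_re R) (@jou_im R) jou_re' jou_im'.
Proof.
move=> X Y t X' Y' dX dY Y0; have [a' [b' [da db]]] := jou_derivable dX dY Y0.
have near0 : \near t, 0 < Y t.
  by have := is_derive1_continuous dY => /cvgr_gt; apply.
have D0 := lt0r_neq0 (jou_den_gt0 (X t) Y0).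
have e1 : 2 * jou_re (X t) (Y t) * a' - 2 * jou_im (X t) (Y t) * b' -
  2 * ((X' * jou_re (X t) (Y t) + X t * a') - (Y' * jou_im (X t) (Y t) + Y t * b')) = 0.
  have dQ := is_derive1D (is_derive1B (is_derive1B (is_derive1X 2 da) (is_derive1X 2 db))
    (is_derive1Zl 2 (is_derive1B (is_derive1M dX da) (is_derive1M dY db)))) (is_derive1_cst 1 t).
  have dQ0 : is_derive t 1 (fun s => jou_re (X s) (Y s) ^+ 2 - jou_im (X s) (Y s) ^+ 2 -
     2 * (X s * jou_re (X s) (Y s) - Y s * jou_im (X s) (Y s)) + 1) 0.
    apply: near_is_derive1 (is_derive1_cst 0 t); near=> s.
    have s0 : 0 <= Y s by apply/ltW; near: s.
    by have [->] := jou_quadratic (X s) s0.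
  by rewrite -(is_derive1_unique dQ dQ0) /= !expr1; ring.
have e2 : a' * jou_im (X t) (Y t) + jou_re (X t) (Y t) * b' -
  ((X' * jou_im (X t) (Y t) + X t * b') + (Y' * jou_re (X t) (Y t) + Y t * a')) = 0.
  have dQ := is_derive1B (is_derive1M da db)
    (is_derive1D (is_derive1M dX db) (is_derive1M dY da)).
  have dQ0 : is_derive t 1 (fun s => jou_re (X s) (Y s) * jou_im (X s) (Y s) -
     (X s * jou_im (X s) (Y s) + Y s * jou_re (X s) (Y s))) 0.
    apply: near_is_derive1 (is_derive1_cst 0 t); near=> s.
    have s0 : 0 <= Y s by apply/ltW; near: s.
    by have [_ ->] := jou_quadratic (X s) s0.
  exact: is_derive1_unique dQ dQ0.
suff [<- <-] : a' = jou_re' (X t) (Y t) * X' - jou_im' (X t) (Y t) * Y' /\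
    b' = jou_re' (X t) (Y t) * Y' + jou_im' (X t) (Y t) * X' by [].
rewrite /jou_re' /jou_im' /jou_den in D0 *.
set x := X t in e1 e2 D0 *; set y := Y t in e1 e2 D0 *.
set a := jou_re x y in e1 e2 D0 *; set b := jou_im x y in e1 e2 D0 *.
have e1' : (a - x) * a' - (b - y) * b' = X' * a - Y' * b.
  by lra.
have e2' : (b - y) * a' + (a - x) * b' = X' * b + Y' * a.
  by apply/eqP; rewrite -subr_eq0; apply/eqP; rewrite -[RHS]e2; ring.
(* The equation (rho - z) rho' = z' rho is solved by multiplying with the conjugate of rho - z,
   whose squared modulus is the denominator. *)
split; apply: (mulIf D0).
  transitivity ((a - x) * (X' * a - Y' * b) + (b - y) * (X' * b + Y' * a)); last by field.
  by rewrite -e1' -e2'; ring.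
transitivity ((a - x) * (X' * b + Y' * a) - (b - y) * (X' * a - Y' * b)); last by field.
by rewrite -e1' -e2'; ring.
Unshelve. all: by end_near. Qed.

Lemma holo_deriv_mul f g p q f2 g2 p2 q2 :
  holo_deriv f g p q -> holo_deriv f2 g2 p2 q2 ->
  holo_deriv (fun x y => f x y * f2 x y - g x y * g2 x y)
             (fun x y => f x y * g2 x y + g x y * f2 x y)
             (fun x y => p x y * f2 x y - q x y * g2 x y + (f x y * p2 x y - g x y * q2 x y))
             (fun x y => p x y * g2 x y + q x y * f2 x y + (f x y * q2 x y + g x y * p2 x y)).
Proof.
move=> h1 h2 X Y t X' Y' dX dY Y0.
have [df dg] := h1 _ _ _ _ _ dX dY Y0; have [df2 dg2] := h2 _ _ _ _ _ dX dY Y0.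
split.
  by apply: is_derive1_ext (is_derive1B (is_derive1M df df2) (is_derive1M dg dg2)) _ _ => //; ring.
by apply: is_derive1_ext (is_derive1D (is_derive1M df dg2) (is_derive1M dg df2)) _ _ => //; ring.
Qed.

Lemma jou_bounded_above : bounded_above jou_re' /\ bounded_above jou_im'.
Proof.
suff h y0 x y : 0 < y0 -> y0 <= y -> `|jou_re' x y| <= 2 / y0 /\ `|jou_im' x y| <= 2 / y0.
  by split=> y0 y00; exists (2 / y0) => x y yy; case: (h y0 x y y00 yy).
move=> y00 yy; have yp : 0 < y by exact: lt_le_trans yy.
have D0 := jou_den_gt0 x yp; have [ha hb] := jou_le1 x y.
have hy := jou_den_ge x y00 yy.
(* By the arithmetic-geometric mean inequality |z| y0 <= (z^2 + y0^2) / 2, and both squares are at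
   most [jou_den x y]. The two components of rho - z then add up to the constant 2 / y0. *)
have key z : z ^+ 2 <= jou_den x y -> `|z| * y0 <= jou_den x y.
  move=> hz; have : y0 ^+ 2 <= jou_den x y.
    by apply: le_trans hy _; rewrite /jou_den lerDr sqr_ge0.
  move=> h0; have := sqr_ge0 (`|z| - y0); rewrite sqrrB real_normK ?num_real//; lra.
have k1 : `|jou_re x y - x| * y0 <= jou_den x y by apply: key; rewrite lerDl sqr_ge0.
have k2 : `|jou_im x y - y| * y0 <= jou_den x y by apply: key; rewrite lerDr sqr_ge0.
have bnd (a b : R) : `|a| <= 1 -> `|b| <= 1 ->
    `|(a * (jou_re x y - x) + b * (jou_im x y - y)) / jou_den x y| <= 2 / y0.
  move=> a1 b1; rewrite normrM normfV (gtr0_norm D0) ler_pdivrMr// mulrAC ler_pdivlMr//.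
  apply: le_trans (_ : (`|jou_re x y - x| + `|jou_im x y - y|) * y0 <= _); last by lra.
  rewrite ler_pM2r//; apply: le_trans (ler_normD _ _) _; rewrite !normrM.
  by rewrite lerD// -[leRHS]mul1r ler_wpM2r.
split; first exact: bnd.
rewrite /jou_im' addrC -mulNr; apply: (le_trans _ (bnd (jou_im x y) (- jou_re x y) hb _)).
  by rewrite addrC.
by rewrite normrN.
Qed.

Lemma jou_deriv_curve_continuous : curve_continuous jou_re' (fun y => 0 < y) /\
  curve_continuous jou_im' (fun y => 0 < y).
Proof.
have [cr ci] := jou_curve_continuous.
split=> X Y t cX cY Y0; have {}cr := cr X Y t cX cY I; have {}ci := ci X Y t cX cY I;
  (have cD : {for t, continuous (fun s => jou_den (X s) (Y s))}
   by apply: continuous1D; apply: continuous1X; apply: continuous1B);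
  (apply: continuous1M; last by apply: continuous1V => //; exact: lt0r_neq0 (jou_den_gt0 _ _)).
  by apply: continuous1D; apply: continuous1M => //; apply: continuous1B.
by apply: continuous1B; apply: continuous1M => //; apply: continuous1B.
Qed.

Fixpoint jou_pow (m : nat) (x y : R) : R * R :=
  if m is k.+1 then
    let: (u, v) := jou_pow k x y in
    (u * jou_re x y - v * jou_im x y, u * jou_im x y + v * jou_re x y)
  else (1, 0).

Lemma jou_powS1 m x y : (jou_pow m.+1 x y).1 =
  (jou_pow m x y).1 * jou_re x y - (jou_pow m x y).2 * jou_im x y.
Proof. by rewrite /=; case: (jou_pow m x y). Qed.

Lemma jou_powS2 m x y : (jou_pow m.+1 x y).2 =
  (jou_pow m x y).1 * jou_im x y + (jou_pow m x y).2 * jou_re x y.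
Proof. by rewrite /=; case: (jou_pow m x y). Qed.

Lemma jou_pow_mod m x y : (jou_pow m x y).1 ^+ 2 + (jou_pow m x y).2 ^+ 2 =
  (ell_cosh x y - ell_sinh x y) ^+ (2 * m).
Proof.
elim: m => [|m IH]; first by rewrite muln0 expr0 /= expr1n expr0n addr0.
rewrite mulnS exprD -IH -jou_mod jou_powS1 jou_powS2; ring.
Qed.

Lemma jou_pow_bound m x y : 
  `|(jou_pow m x y).1| <= 1 /\ `|(jou_pow m x y).2| <= 1.
Proof.
have [e0 e1 _] := jou_mod_bound x y; have h := jou_pow_mod m x y.
have h1 : (ell_cosh x y - ell_sinh x y) ^+ (2 * m) <= 1 by rewrite exprn_ile1.
have := sqr_ge0 (jou_pow m x y).1; have := sqr_ge0 (jou_pow m x y).2 => i2 r2.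
by split; rewrite -(@expr_le1 _ 2)// real_normK ?num_real//; lra.
Qed.

(** A positive power of rho has modulus at most |rho| = e, while |x| + |y| <= 2 cosh s and e cosh s
    <= 1. *)
Lemma jou_pow_decay m x y : 0 <= y ->
  (`|x| + `|y|) * `|(jou_pow m.+1 x y).1| <= 2 /\
  (`|x| + `|y|) * `|(jou_pow m.+1 x y).2| <= 2.
Proof.
move=> y0; have [e0 e1 em] := jou_mod_bound x y; have h := jou_pow_mod m.+1 x y.
have h1 : (ell_cosh x y - ell_sinh x y) ^+ (2 * m.+1) <= (ell_cosh x y - ell_sinh x y) ^+ 2.
  by rewrite mulnS exprD -[leRHS]mulr1 ler_wpM2l ?sqr_ge0// exprn_ile1.
have hc := ell_cosh_ge x y0.
have := sqr_ge0 (jou_pow m.+1 x y).1; have := sqr_ge0 (jou_pow m.+1 x y).2 => i2 r2.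
have key z : z ^+ 2 <= (ell_cosh x y - ell_sinh x y) ^+ 2 -> (`|x| + `|y|) * `|z| <= 2.
  move=> hz; apply: le_trans (_ : 2 * ell_cosh x y * (ell_cosh x y - ell_sinh x y) <= _).
    apply: ler_pM => //.
    by rewrite -(@ler_pXn2r _ 2)// ?nnegrE// real_normK ?num_real.
  by rewrite -mulrA mulrC -[leRHS]mul1r ler_pM2r// mulrC.
by split; apply: key; lra.
Qed.

(** The clauses of [cauchy_pair] that pass through the product rule. Decay is left out because it
    fails for the power 0, where the induction starts. *)
Lemma jou_pow_cauchy_aux m :
  [/\ curve_continuous (fun x y => (jou_pow m x y).1) setT /\
      curve_continuous (fun x y => (jou_pow m x y).2) setT &
      exists p q, [/\ holo_deriv (fun x y => (jou_pow m x y).1)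
                                 (fun x y => (jou_pow m x y).2) p q,
        curve_continuous p (fun y => 0 < y) /\ curve_continuous q (fun y => 0 < y) &
        bounded_above p /\ bounded_above q]].
Proof.
have [cr ci] := jou_curve_continuous; have [cr' ci'] := jou_deriv_curve_continuous.
have [br bi] := jou_bounded_above.
elim: m => [|m [[c1 c2] [p [q [h [cp cq] [bp bq]]]]]].
  split; first by split=> X Y t _ _ _; exact: continuous1_cst.
  exists (fun _ _ => 0), (fun _ _ => 0); split.
  - move=> X Y t X' Y' _ _ _ /=; rewrite !mul0r subr0 addr0.
    by split; exact: is_derive1_cst.
  - by split=> X Y t _ _ _; exact: continuous1_cst.
  - by split=> y0 _; exists 0 => x y _; rewrite normr0.
have e1 : (fun x y => (jou_pow m.+1 x y).1) = (fun x y =>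
  (jou_pow m x y).1 * jou_re x y - (jou_pow m x y).2 * jou_im x y).
  by apply/funext => x; apply/funext => y; exact: jou_powS1.
have e2 : (fun x y => (jou_pow m.+1 x y).2) = (fun x y =>
  (jou_pow m x y).1 * jou_im x y + (jou_pow m x y).2 * jou_re x y).
  by apply/funext => x; apply/funext => y; exact: jou_powS2.
rewrite e1 e2; split.
  split=> X Y t cX cY _; have k1 := c1 X Y t cX cY I; have k2 := c2 X Y t cX cY I;
    have k3 := cr X Y t cX cY I; have k4 := ci X Y t cX cY I;
    [apply: continuous1B|apply: continuous1D]; apply: continuous1M; assumption.
have hh := holo_deriv_mul h jou_holo; eexists; eexists; split; first exact: hh.
  split=> X Y t cX cY Y0; have k1 := c1 X Y t cX cY I; have k2 := c2 X Y t cX cY I;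
    have k3 := cr X Y t cX cY I; have k4 := ci X Y t cX cY I;
    have k5 := cp X Y t cX cY Y0; have k6 := cq X Y t cX cY Y0;
    have k7 := cr' X Y t cX cY Y0; have k8 := ci' X Y t cX cY Y0;
    apply: continuous1D;
    [apply: continuous1B|apply: continuous1B|apply: continuous1D|apply: continuous1D];
    apply: continuous1M; assumption.
(* One estimate serves the real and the imaginary part of the product rule; the minus signs of the
   real part are absorbed by passing negated derivatives. *)
have bnd4 (p1 q1 p2 q2 f1 g1 f2 g2 : R -> R -> R) :
    bounded_above p1 -> bounded_above q1 -> bounded_above p2 -> bounded_above q2 ->
    (forall x y, [/\ `|f1 x y| <= 1, `|g1 x y| <= 1, `|f2 x y| <= 1 & `|g2 x y| <= 1]) ->
    bounded_above (fun x y => p1 x y * f1 x y + q1 x y * g1 x y +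
      (f2 x y * p2 x y + g2 x y * q2 x y)).
  move=> b1 b2 b3 b4 h1 y0 y00.
  have [C1 k1] := b1 _ y00; have [C2 k2] := b2 _ y00.
  have [C3 k3] := b3 _ y00; have [C4 k4] := b4 _ y00.
  exists (C1 + C2 + (C3 + C4)) => x y yy; have [l1 l2 l3 l4] := h1 x y.
  have mr a b C : `|a| <= C -> `|b| <= 1 -> `|a * b| <= C.
    by move=> aC b1'; rewrite normrM -[leRHS]mulr1 ler_pM.
  apply: le_trans (ler_normD _ _) _; apply: lerD; apply: le_trans (ler_normD _ _) _; apply: lerD.
  - by apply: mr => //; exact: k1.
  - by apply: mr => //; exact: k2.
  - by rewrite mulrC; apply: mr => //; exact: k3.
  - by rewrite mulrC; apply: mr => //; exact: k4.
have bN p0 : bounded_above p0 -> bounded_above (fun x y => - p0 x y).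
  by move=> b y0 /b[C k]; exists C => x y yy; rewrite normrN; exact: k.
have b1 x y := jou_pow_bound m x y; have b2 := jou_le1.
split.
  have := bnd4 _ _ _ _ (@jou_re R) (@jou_im R) (fun x y => (jou_pow m x y).1)
    (fun x y => (jou_pow m x y).2) bp (bN _ bq) br (bN _ bi).
  rewrite (_ : (fun x y => _) = (fun x y => p x y * jou_re x y - q x y * jou_im x y +
    ((jou_pow m x y).1 * jou_re' x y - (jou_pow m x y).2 * jou_im' x y))); last first.
    by apply/funext => x; apply/funext => y; ring.
  by apply => x y; have [? ?] := b1 x y; have [? ?] := b2 x y.
have := bnd4 _ _ _ _ (@jou_im R) (@jou_re R) (fun x y => (jou_pow m x y).1)
    (fun x y => (jou_pow m x y).2) bp bq bi br.
by apply => x y; have [? ?] := b1 x y; have [? ?] := b2 x y.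
Qed.

Lemma jou_pow_cauchy_pair m :
  cauchy_pair (fun x y => (jou_pow m.+1 x y).1) (fun x y => (jou_pow m.+1 x y).2).
Proof.
have [cc hh] := jou_pow_cauchy_aux m.+1; split => //.
  by split=> x y; case: (jou_pow_bound m.+1 x y).
by move=> x y y0; case: (jou_pow_decay m x y0).
Qed.

(* The pair [i rho ^ (m+1)]: it gives the Hilbert transform of [W m]. *)
Lemma jou_pow_cauchy_pairI m :
  cauchy_pair (fun x y => - (jou_pow m.+1 x y).2) (fun x y => (jou_pow m.+1 x y).1).
Proof.
have [[c1 c2] [p [q [h [cp cq] [bp bq]]]]] := jou_pow_cauchy_aux m.+1; split.
- by split=> // X Y t cX cY _; apply: continuous1N; exact: c2.
- by split=> x y; rewrite ?normrN; case: (jou_pow_bound m.+1 x y).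
- by move=> x y y0; case: (jou_pow_decay m x y0).
exists (fun x y => - q x y), p; split.
- move=> X Y t X' Y' dX dY Y0; have [d1 d2] := h _ _ _ _ _ dX dY Y0; split.
    by apply: is_derive1_ext (is_derive1N d2) _ _ => //; ring.
  by apply: is_derive1_ext d1 _ _ => //; ring.
- by split=> // X Y t cX cY Y0; apply: continuous1N; exact: cq.
- split=> // y0 /bq[C k]; exists C => x y yy; rewrite normrN; exact: k.
Qed.

Lemma jou_real_in (x : R) : `|x| <= 1 ->
  jou_re x 0 = x /\ jou_im x 0 = - Num.sqrt (1 - x ^+ 2).
Proof.
move=> x1; have /andP[l1 l2] : -1 <= x <= 1 by rewrite -ler_norml.
have f1 : focal1 x 0 = x + 1 by rewrite /focal1 expr0n addr0 sqrtr_sqr ger0_norm//; lra.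
have f2 : focal2 x 0 = 1 - x by rewrite /focal2 expr0n addr0 sqrtr_sqr ler0_norm; lra.
have m1 : ell_cosh x 0 = 1 by rewrite /ell_cosh f1 f2; field.
have n1 : ell_cos x 0 = x by rewrite /ell_cos f1 f2; field.
by rewrite /jou_re /jou_im /ell_sinh /ell_sin m1 n1 expr1n subrr sqrtr0 subr0 !mul1r.
Qed.

Lemma jou_real_out (x : R) : 1 < `|x| ->
  jou_re x 0 = x - Num.sg x * Num.sqrt (x ^+ 2 - 1) /\ jou_im x 0 = 0.
Proof.
move=> x1; have f1 : focal1 x 0 = `|x + 1| by rewrite /focal1 expr0n addr0 sqrtr_sqr.
have f2 : focal2 x 0 = `|x - 1| by rewrite /focal2 expr0n addr0 sqrtr_sqr.
have [m1 n1] : ell_cosh x 0 = `|x| /\ ell_cos x 0 = Num.sg x.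
  rewrite /ell_cosh /ell_cos f1 f2; have [x0|x0|x0] := ltgtP x 0.
  - move: x1; rewrite (ltr0_norm x0) ltr0_sg// => x1.
    by rewrite !ltr0_norm; [split; field|lra|lra].
  - move: x1; rewrite (gtr0_norm x0) gtr0_sg// => x1.
    by rewrite !gtr0_norm; [split; field|lra|lra].
  - by move: x1; rewrite x0 normr0 ltNge ler01.
have x0 : x != 0 by rewrite -normr_gt0 (lt_trans _ x1).
rewrite /jou_re /jou_im /ell_sinh /ell_sin m1 n1 real_normK ?num_real// sqr_sg x0 subrr sqrtr0.
by rewrite mulr0 oppr0; split=> //; rewrite mulrBl mulrC -numEsg mulrC.
Qed.

(** On [-1, 1] multiplication by rho = x - i sqrt (1 - x^2) is exactly the pair of recurrences
    [Tn_recr] and [Un_recr]. Outside, rho is real and its powers are [Ttilde] by definition. *)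
Lemma jou_pow_real m (x : R) :
  (jou_pow m.+1 x 0).1 = Ttilde m.+1 x /\ (jou_pow m.+1 x 0).2 = - W m x.
Proof.
have [x1|x1] := leP `|x| 1.
  have [r i] := jou_real_in x1.
  have s2 : Num.sqrt (1 - x ^+ 2) ^+ 2 = 1 - x ^+ 2.
    by rewrite sqr_sqrtr// subr_ge0 -real_normK ?num_real// expr_le1.
  have -> : W m x = Num.sqrt (1 - x ^+ 2) * (chebU R m).[x].
    (* At |x| = 1 the cut-off value 0 of [W] agrees with the formula because the root vanishes, so
       the formula holds on the closed interval. *)
    rewrite /W; case: ltP => // x1'; have -> : 1 - x ^+ 2 = 0; last by rewrite sqrtr0 mul0r.
    by rewrite -real_normK ?num_real// (_ : `|x| = 1) ?expr1n ?subrr//; apply/le_anti; rewrite x1.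
  rewrite /Ttilde x1; elim: m => [|m [IH1 IH2]].
    by rewrite jou_powS1 jou_powS2 r i /= hornerX hornerC; split; ring.
  rewrite (jou_powS1 m.+1) (jou_powS2 m.+1) IH1 IH2 r i Tn_recr Un_recr; split; last by ring.
  by ring: s2.
have [r i] := jou_real_out x1.
have -> : W m x = 0 by rewrite /W ltNge (ltW x1).
have -> : Ttilde m.+1 x = (x - Num.sg x * Num.sqrt (x ^+ 2 - 1)) ^+ m.+1.
  by rewrite /Ttilde leNgt x1.
elim: m => [|m [IH1 IH2]].
  by rewrite jou_powS1 jou_powS2 r i /= expr1; split; ring.
by rewrite (jou_powS1 m.+1) (jou_powS2 m.+1) IH1 IH2 r i (exprSr _ m.+1); split; ring.
Qed.
End HalfPlaneHolomorphic.

(** * Integrals over segments *)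

Section SegmentIntegrals.
Variable R : realType.
Local Notation mu := (@lebesgue_measure R).
Implicit Types (f F : R -> R) (c d x M : R).

Lemma within_segment_continuous f c d :
  (forall x, c <= x <= d -> {for x, continuous f}) -> {within `[c, d], continuous f}.
Proof.
move=> cf; apply: continuous_in_subspaceT => x; rewrite inE /= in_itv /=; exact: cf.
Qed.

Lemma integrable_segment f c d :
  (forall x, c <= x <= d -> {for x, continuous f}) -> mu.-integrable `[c, d] (EFin \o f).
Proof.
move=> cf; apply: continuous_compact_integrable; first exact: segment_compact.
exact: within_segment_continuous.
Qed.

Lemma Rintegral_FTC2 f F c d : c <= d ->
  (forall x, c <= x <= d -> {for x, continuous f}) ->
  (forall x, c <= x <= d -> is_derive x 1 F (f x)) ->
  \int[mu]_(x in `[c, d]) f x = F d - F c.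
Proof.
rewrite le_eqVlt => /predU1P[-> _ _|cd cf dF]; first by rewrite set_itv1 Rintegral_set1 subrr.
rewrite /Rintegral (@continuous_FTC2 _ f F c d)//.
- exact: within_segment_continuous.
- have cF x : c <= x <= d -> {for x, continuous F}.
    by move=> /dF; exact: is_derive1_continuous.
  split.
  + by move=> x /[!in_itv]/= /andP[/ltW cx /ltW xd]; have [] := dF x _; rewrite ?cx.
  + by apply: cvg_at_right_filter; apply: cF; rewrite lexx ltW.
  + by apply: cvg_at_left_filter; apply: cF; rewrite lexx ltW.
- move=> x /[!in_itv]/= /andP[/ltW cx /ltW xd]; rewrite derive1E.
  by have [] := dF x _; rewrite ?cx.
Qed.

Lemma Rintegral_segment_le f c d M : c <= d -> mu.-integrable `[c, d] (EFin \o f) ->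
  (forall x, c <= x <= d -> `|f x| <= M) ->
  `|\int[mu]_(x in `[c, d]) f x| <= M * (d - c).
Proof.
move=> cd fi fM; apply: le_trans (le_normr_Rintegral _ fi) _ => //.
apply: (@le_trans _ _ (\int[mu]_(x in `[c, d]) M)).
  apply: le_Rintegral => //.
  - exact: (integrable_norm fi).
  - apply: integrable_segment => x _; exact: continuous1_cst.
rewrite Rintegral_cst//= lebesgue_measure_itv/= lte_fin.
by case: ltP => // dc; rewrite (_ : d - c = 0)//; apply/eqP; rewrite subr_eq0 eq_le dc cd.
Qed.

Lemma derive1_addl x : derive1 (fun r : R => x + r) = cst 1.
Proof.
apply/funext => r; rewrite derive1E.
by have [_ ->] := is_derive1D (is_derive1_cst x r) (is_derive1_id r); rewrite add0r.
Qed.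

Lemma derive1_subl x : derive1 (fun r : R => x - r) = cst (-1).
Proof.
apply/funext => r; rewrite derive1E.
by have [_ ->] := is_derive1B (is_derive1_cst x r) (is_derive1_id r); rewrite sub0r.
Qed.

Lemma Rintegral_segment_addl f x c d : c <= d ->
  (forall y, x + c <= y <= x + d -> {for y, continuous f}) ->
  \int[mu]_(y in `[x + c, x + d]) f y = \int[mu]_(r in `[c, d]) f (x + r).
Proof.
move=> cd cf; rewrite /Rintegral.
rewrite (@integration_by_substitution_increasing _ (fun r => x + r) f c d cd).
- congr fine; apply: eq_integral => r _ /=.
  by rewrite derive1_addl /= mulr1.
- by move=> r s _ _; rewrite ltrD2l.
- by rewrite derive1_addl => r _; exact: cvg_cst.
- by rewrite derive1_addl; exact: is_cvg_cst.
- by rewrite derive1_addl; exact: is_cvg_cst.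
- have cF : continuous (fun r : R => x + r).
    by move=> r; exact: is_derive1_continuous (is_derive1D (is_derive1_cst x r) (is_derive1_id r)).
  split.
  + by move=> r _; have [] := is_derive1D (is_derive1_cst x r) (is_derive1_id r).
  + by apply: cvg_at_right_filter; exact: cF.
  + by apply: cvg_at_left_filter; exact: cF.
- exact: within_segment_continuous.
Qed.

Lemma Rintegral_segment_subl f x c d : c <= d ->
  (forall y, x - d <= y <= x - c -> {for y, continuous f}) ->
  \int[mu]_(y in `[x - d, x - c]) f y = \int[mu]_(r in `[c, d]) f (x - r).
Proof.
move=> cd cf; rewrite /Rintegral.
rewrite (@integration_by_substitution_decreasing _ (fun r => x - r) f c d cd).
- congr fine; apply: eq_integral => r _ /=.
  by rewrite fctE derive1_subl /= opprK mulr1.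
- by move=> r s _ _; rewrite ltrD2l ltrN2.
- by rewrite derive1_subl => r _; exact: cvg_cst.
- by rewrite derive1_subl; exact: is_cvg_cst.
- by rewrite derive1_subl; exact: is_cvg_cst.
- have cF : continuous (fun r : R => x - r).
    by move=> r; exact: is_derive1_continuous (is_derive1B (is_derive1_cst x r) (is_derive1_id r)).
  split.
  + by move=> r _; have [] := is_derive1B (is_derive1_cst x r) (is_derive1_id r).
  + by apply: cvg_at_right_filter; exact: cF.
  + by apply: cvg_at_left_filter; exact: cF.
- exact: within_segment_continuous.
Qed.

Lemma continuous_param_integral (k : R -> R -> R) (u v c d M l : R) :
  (forall l t, u < l < v -> c <= t <= d -> {for t, continuous (k l)}) ->
  (forall l t, u < l < v -> c <= t <= d -> {for l, continuous (k ^~ t)}) ->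
  (forall l t, u < l < v -> c <= t <= d -> `|k l t| <= M) ->
  u < l < v -> {for l, continuous (fun l => \int[mu]_(t in `[c, d]) k l t)}.
Proof.
move=> ck1 ck2 kM luv.
apply: (@continuity_under_integral _ _ _ mu k `[c, d]%classic _ u v _ _ (cst M)) => //.
- move=> l0; rewrite /= in_itv /= => l0uv.
  by apply: integrable_segment => t /(ck1 _ _ l0uv).
- by apply: aeW => t; rewrite /= in_itv /= => tcd l0; rewrite inE /= in_itv /= => h; exact: ck2.
- by apply: integrable_segment => t _; exact: continuous1_cst.
- move=> l0; rewrite /= in_itv /= => l0uv.
  by apply: aeW => t; rewrite /= in_itv /= => tcd; exact: kM.
- by rewrite inE /= in_itv.
Qed.

End SegmentIntegrals.

(** * The half-circle integral *)

Section SemicircleIntegral.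
Variable R : realType.
Local Notation mu := (@lebesgue_measure R).
Variables (f g : R -> R -> R) (x0 al : R).
Hypotheses (fg : cauchy_pair f g) (al0 : 0 < al).
Implicit Types (x y r s t e N : R).

Let px r t : R := x0 + al * r * cos t.
Let py y r t : R := y + al * r * sin t.

(** The arc has centre x0 + i y and radius al r. The factor al becomes the slope of [rescale], so r
    is a radius in the original variable; a height y > 0 keeps the whole arc inside the domain of
    holomorphy. *)
Definition semicircle y r := \int[mu]_(t in `[0, pi]) g (px r t) (py y r t).

Let is_derive_px_t r t : is_derive t 1 (px r) (- (al * r * sin t)).
Proof.
apply: is_derive1_ext (is_derive1D (is_derive1_cst x0 t)
  (is_derive1Zl (al * r) (is_derive_cos t))) _ _ => //; ring.
Qed.

Let is_derive_py_t y r t : is_derive t 1 (py y r) (al * r * cos t).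
Proof.
apply: is_derive1_ext (is_derive1D (is_derive1_cst y t)
  (is_derive1Zl (al * r) (is_derive_sin t))) _ _ => //; ring.
Qed.

Let is_derive_px_r r t : is_derive r 1 (px ^~ t) (al * cos t).
Proof.
apply: is_derive1_ext (is_derive1D (is_derive1_cst x0 r)
  (is_derive1Zl (al * cos t) (is_derive1_id r))) _ _ => //.
  by move=> s; rewrite /px /=; ring.
by ring.
Qed.

Let is_derive_py_r y r t : is_derive r 1 (fun s => py y s t) (al * sin t).
Proof.
apply: is_derive1_ext (is_derive1D (is_derive1_cst y r)
  (is_derive1Zl (al * sin t) (is_derive1_id r))) _ _ => //.
  by move=> s; rewrite /py /=; ring.
by ring.
Qed.

Let py_ge y r t : 0 <= r -> 0 <= t <= pi -> y <= py y r t.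
Proof.
by move=> r0 t0; rewrite lerDl mulr_ge0// ?sin_ge0_pi// mulr_ge0// ltW.
Qed.

Let g_le1 x y : `|g x y| <= 1. Proof. by case: fg => _ [_ ?]. Qed.
Let f_le1 x y : `|f x y| <= 1. Proof. by case: fg => _ [? _]. Qed.
Let cg : curve_continuous g setT. Proof. by case: fg => -[]. Qed.
Let cf : curve_continuous f setT. Proof. by case: fg => -[]. Qed.

Let continuous_g_t y r t : {for t, continuous (fun t => g (px r t) (py y r t))}.
Proof.
by apply: cg => //; [exact: is_derive1_continuous (is_derive_px_t r t)
                    |exact: is_derive1_continuous (is_derive_py_t y r t)].
Qed.

Let continuous_g_r y r t : {for r, continuous (fun r => g (px r t) (py y r t))}.
Proof.
by apply: cg => //; [exact: is_derive1_continuous (is_derive_px_r r t)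
                    |exact: is_derive1_continuous (is_derive_py_r y r t)].
Qed.

(* The Cauchy-Riemann equation in polar coordinates turns the radial derivative
   of [g] into [- r^-1] times the angular derivative of [f]. *)
Lemma is_derive_semicircle y r : 0 < y -> 0 < r ->
  is_derive r 1 (semicircle y) ((f (x0 + al * r) y - f (x0 - al * r) y) / r).
Proof.
move=> y0 r0; have [_ _ _ [p [q [h [cp cq] [bp bq]]]]] := fg.
(* Arcs of every radius stay at height at least y, so these two constants dominate the radial
   derivative and allow differentiation under the integral. *)
have [Cp hp] := bp _ y0; have [Cq hq] := bq _ y0.
have py0 s t : 0 < s -> 0 <= t <= pi -> 0 < py y s t.
  by move=> s0 tp; apply: lt_le_trans y0 _; apply: py_ge => //; exact: ltW.
pose k (s t : R) := g (px s t) (py y s t).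
have dk s t : 0 < s -> 0 <= t <= pi -> is_derive s 1 (k ^~ t)
    (p (px s t) (py y s t) * (al * sin t) + q (px s t) (py y s t) * (al * cos t)).
  move=> s0 tp.
  by case: (h _ _ _ _ _ (is_derive_px_r s t) (is_derive_py_r y s t) (py0 s t s0 tp)).
have d1k s t : 0 < s -> 0 <= t <= pi -> partial1of2 k s t =
    p (px s t) (py y s t) * (al * sin t) + q (px s t) (py y s t) * (al * cos t).
  by move=> s0 tp; rewrite partial1of2E; case: (dk s t s0 tp).
have Ir : `]0, r + 1[%classic r by rewrite /= in_itv /= r0 ltrDl ltr01.
have intk s : `]0, r + 1[%classic s -> mu.-integrable `[0, pi] (EFin \o k s).
  by move=> _; apply: integrable_segment => t _; exact: continuous_g_t.
have derk s t : `]0, r + 1[%classic s -> `[0, pi]%classic t -> derivable (k ^~ t) s 1.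
  rewrite /= !in_itv /= => /andP[s0 _] tp.
  by case: (dk s t s0 tp).
have C0 : 0 <= Cp + Cq.
  have := hp 0 y (lexx _); have := hq 0 y (lexx _).
  have := normr_ge0 (p 0 y); have := normr_ge0 (q 0 y); lra.
have intG : mu.-integrable `[0, pi] (EFin \o (fun _ : R => (Cp + Cq) * al)).
  by apply: integrable_segment => t _; exact: continuous1_cst.
have G0 (t : R) : 0 <= (Cp + Cq) * al by rewrite mulr_ge0// ltW.
have Gub s t : `]0, r + 1[%classic s -> `[0, pi]%classic t ->
    `|partial1of2 k s t| <= (Cp + Cq) * al.
  rewrite /= !in_itv /= => /andP[s0 _] tp; rewrite d1k//.
  have yy : y <= py y s t by apply: py_ge => //; exact: ltW.
  apply: le_trans (ler_normD _ _) _; rewrite !normrM (gtr0_norm al0) mulrDl.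
  have key (z c C : R) : `|z| <= C -> `|c| <= 1 -> `|z| * (al * `|c|) <= C * al.
    move=> zC c1; rewrite mulrA -[leRHS]mulr1; apply: ler_pM => //.
      by rewrite mulr_ge0// ltW.
    by rewrite ler_pM2r.
  apply: lerD; apply: key.
  - exact: hp.
  - by rewrite ler_norml sin_le1 sin_geN1.
  - exact: hq.
  - by rewrite ler_norml cos_le1 cos_geN1.
apply: DeriveDef.
  by apply: (@derivable_under_integral R _ _ mu k `[0, pi]%classic _ r 0 (r + 1)
    Ir intk derk _ G0 intG Gub).
rewrite -derive1E (@differentiation_under_integral R _ _ mu k `[0, pi]%classic _ r 0 (r + 1)
  Ir intk derk _ G0 intG Gub)//.
pose F (t : R) := f (px r t) (py y r t).
pose F' (t : R) := p (px r t) (py y r t) * (- (al * r * sin t)) - q (px r t) (py y r t) * (al * r * cos t).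
have dF t : 0 <= t <= pi -> is_derive t 1 F (F' t).
  move=> tp.
  by case: (h _ _ _ _ _ (is_derive_px_t r t) (is_derive_py_t y r t) (py0 r t r0 tp)).
have cF' t : 0 <= t <= pi -> {for t, continuous F'}.
  move=> tp; have cx := is_derive1_continuous (is_derive_px_t r t).
  have cy := is_derive1_continuous (is_derive_py_t y r t).
  apply: continuous1B; apply: continuous1M.
  - by apply: (cp (px r) (py y r)) => //; exact: py0.
  - apply: continuous1N; apply: continuous1M; first exact: continuous1_cst.
    exact: is_derive1_continuous (is_derive_sin t).
  - by apply: (cq (px r) (py y r)) => //; exact: py0.
  - apply: continuous1M; first exact: continuous1_cst.
    exact: is_derive1_continuous (is_derive_cos t).
transitivity (\int[mu]_(t in `[0, pi]) (- r^-1 * F' t)).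
  apply: eq_Rintegral => t; rewrite inE /= in_itv /= => tp.
  by rewrite -[LHS]/(partial1of2 k r t) d1k// /F'; field; exact: lt0r_neq0.
rewrite RintegralZl//; last by apply: integrable_segment.
rewrite (Rintegral_FTC2 (pi_ge0 R) cF' dF) /F /px /py cospi sinpi cos0 sin0.
rewrite !mulr0 !addr0 !mulr1 mulrN1.
by ring.
Qed.

Lemma continuous_semicircle y r : {for r, continuous (semicircle y)}.
Proof.
apply: (@continuous_param_integral R (fun r t => g (px r t) (py y r t)) (r - 1) (r + 1) 0 pi 1).
- by move=> l t _ _; exact: continuous_g_t.
- by move=> l t _ _; exact: continuous_g_r.
- by move=> l t _ _; exact: g_le1.
- lra.
Qed.

Lemma continuous_semicircle_height y r : {for y, continuous (semicircle ^~ r)}.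
Proof.
apply: (@continuous_param_integral R (fun y t => g (px r t) (py y r t)) (y - 1) (y + 1) 0 pi 1).
- by move=> l t _ _; exact: continuous_g_t.
- move=> l t _ _; apply: cg => //; first exact: continuous1_cst.
  by apply: continuous1D; [exact: continuous1_id|exact: continuous1_cst].
- by move=> l t _ _; exact: g_le1.
- lra.
Qed.

Let fdiff y r := (f (x0 + al * r) y - f (x0 - al * r) y) / r.

Let continuous_fdiff y r : 0 < r -> {for r, continuous (fdiff y)}.
Proof.
move=> r0; have caff c : {for r, continuous (fun r => x0 + c * r)}.
  apply: continuous1D; first exact: continuous1_cst.
  by apply: continuous1M; [exact: continuous1_cst|exact: continuous1_id].
apply: continuous1M; last first.
  by apply: continuous1V; [exact: lt0r_neq0|exact: continuous1_id].
apply: continuous1B.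
  by apply: (cf (caff al)) => //; exact: continuous1_cst.
have := caff (- al); under [X in {for r, continuous X}]eq_fun do rewrite mulNr.
by move=> c; apply: (cf c) => //; exact: continuous1_cst.
Qed.

Lemma semicircle_diff_pos y e N : 0 < y -> 0 < e -> e <= N ->
  \int[mu]_(r in `[e, N]) fdiff y r = semicircle y N - semicircle y e.
Proof.
move=> y0 e0 eN; apply: Rintegral_FTC2 => // r /andP[er _].
  by apply: continuous_fdiff; exact: lt_le_trans er.
by apply: is_derive_semicircle => //; exact: lt_le_trans er.
Qed.

(** The passage to the real line. At height y > 0 the identity is the fundamental theorem of
    calculus; no derivative of f or g occurs in it, and both sides are continuous in y down to y =
    0. *)
Lemma semicircle_diff e N : 0 < e -> e <= N ->
  \int[mu]_(r in `[e, N]) ((f (x0 + al * r) 0 - f (x0 - al * r) 0) / r) =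
  semicircle 0 N - semicircle 0 e.
Proof.
move=> e0 eN.
have c1 : {for 0, continuous (fun y => \int[mu]_(r in `[e, N]) fdiff y r)}.
  (* The dominating constant 2 / e comes from two values of f of modulus at most 1 and from r >=
     e. *)
  apply: (@continuous_param_integral R fdiff (-1) 1 e N (2 / e)).
  - by move=> y r _ /andP[er _]; apply: continuous_fdiff; exact: lt_le_trans er.
  - move=> y r _ _; apply: continuous1M; last exact: continuous1_cst.
    by apply: continuous1B; apply: cf => //; (exact: continuous1_cst || exact: continuous1_id).
  - move=> y r _ /andP[er _]; have r0 : 0 < r by exact: lt_le_trans er.
    rewrite /fdiff normrM normfV (gtr0_norm r0) ler_pM//.
    + by rewrite invr_ge0 ltW.
    + apply: le_trans (ler_normB _ _) _.
      by have := f_le1 (x0 + al * r) y; have := f_le1 (x0 - al * r) y; lra.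
    + by rewrite lef_pV2.
  - lra.
have c2 : {for 0, continuous (fun y => semicircle y N - semicircle y e)}.
  by apply: continuous1B; exact: continuous_semicircle_height.
have h1 := cvg_at_right_filter c1; have h2 := cvg_at_right_filter c2.
rewrite -[LHS](cvg_lim _ h1)//; apply/cvg_lim => //.
apply: cvg_trans h2; apply: near_eq_cvg; near=> y.
by rewrite semicircle_diff_pos//; near: y; exact: nbhs_right_gt.
Unshelve. all: by end_near. Qed.

Lemma semicircle_le r : `|semicircle 0 r| <= pi.
Proof.
rewrite -[leRHS]mul1r -[X in 1 * X]subr0; apply: Rintegral_segment_le; first exact: pi_ge0.
  by apply: integrable_segment => t _; exact: continuous_g_t.
by move=> t _; exact: g_le1.
Qed.

Lemma cvg_semicircle_0 : semicircle 0 r @[r --> 0^'+] --> pi * g x0 0.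
Proof.
have -> : pi * g x0 0 = semicircle 0 0.
  rewrite /semicircle /px /py.
  under eq_Rintegral do rewrite mulr0 !mul0r !addr0.
  rewrite Rintegral_cst//= lebesgue_measure_itv/= lte_fin pi_gt0 /= subr0; exact: mulrC.
by apply: cvg_at_right_filter; exact: continuous_semicircle.
Qed.

(** Since |cos t| + |sin t| >= 1, a point of the arc satisfies |X| + |Y| >= al r - |x0|, and the
    decay clause bounds g by 2 / (al r - |x0|) along an arc of fixed angle pi. Integer radii match
    the exhaustion of the truncated integral. *)
Lemma cvg_semicircle_y : semicircle 0 n%:R @[n --> \oo] --> 0.
Proof.
have [_ _ dec _] := fg.
have bnd r : `|x0| < al * r -> `|semicircle 0 r| <= (2 * pi) / (al * r - `|x0|).
  move=> xr; have d0 : 0 < al * r - `|x0| by rewrite subr_gt0.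
  have r0 : 0 < r by have := le_lt_trans (normr_ge0 x0) xr; rewrite pmulr_rgt0.
  rewrite mulrAC -[X in _ <= _ * X]subr0; apply: Rintegral_segment_le; first exact: pi_ge0.
    by apply: integrable_segment => t _; exact: continuous_g_t.
  move=> t tp; rewrite ler_pdivlMr//.
  have pyt : 0 <= py 0 r t by apply: py_ge => //; exact: ltW.
  apply: le_trans (dec (px r t) (py 0 r t) pyt); rewrite mulrC ler_wpM2r//.
  have ar : 0 < al * r by rewrite mulr_gt0.
  have h1 : al * r <= al * r * `|cos t| + al * r * `|sin t|.
    rewrite -mulrDr -[leLHS]mulr1 ler_pM2l// -(@ler_pXn2r _ 2)// ?nnegrE ?addr_ge0//.
    rewrite expr1n -(cos2Dsin2 t) sqrrD !real_normK ?num_real//.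
    have : 0 <= `|cos t| * `|sin t| by rewrite mulr_ge0.
    lra.
  have h2 : al * r * `|cos t| - `|x0| <= `|px r t|.
    have := lerB_normD (al * r * cos t) x0; rewrite normrM (gtr0_norm ar).
    by rewrite /px [x0 + _]addrC.
  have h3 : al * r * `|sin t| <= `|py 0 r t|.
    by rewrite /py add0r normrM (gtr0_norm ar).
  lra.
apply/cvgr0Pnorm_le => e e0; near=> n.
have hn : (`|x0| + 2 * pi / e) / al < n%:R by near: n; exact: nbhs_infty_gtr.
have hp : 0 < 2 * pi / e by rewrite divr_gt0// mulr_gt0// pi_gt0.
move: hn; rewrite ltr_pdivrMr// mulrC => hn.
apply: le_trans (bnd _ _) _; first by lra.
rewrite ler_pdivrMr; last by lra.
have : 2 * pi / e < al * n%:R - `|x0| by lra.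
by rewrite ltr_pdivrMr// => /ltW; rewrite [_ * e]mulrC.
Unshelve. all: by end_near. Qed.

End SemicircleIntegral.

(** * Exhaustion of unbounded intervals *)

Section Exhaustion.
Variable R : realType.
Local Notation mu := (@lebesgue_measure R).
Implicit Types (f F G : R -> R) (c d : nat -> R) (x M : R).

Lemma Rintegral_dominated_cvg (D : set R) (fn : nat -> R -> R) f (g : R -> R) :
  measurable D -> (forall n, measurable_fun D (fn n)) ->
  (forall x, D x -> fn n x @[n --> \oo] --> f x) ->
  mu.-integrable D (EFin \o g) ->
  (forall n x, D x -> `|fn n x| <= g x) ->
  mu.-integrable D (EFin \o f) /\
  \int[mu]_(x in D) fn n x @[n --> \oo] --> \int[mu]_(x in D) f x.
Proof.
move=> mD mfn cfn ig fng.
have cfn' x : D x -> (fn n x)%:E @[n --> \oo] --> (f x)%:E.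
  by move=> Dx; apply: cvg_EFin; [exact: nearW|exact: cfn].
have mfn' n : measurable_fun D (EFin \o fn n) by apply/measurable_EFinP.
have mf : measurable_fun D (EFin \o f).
  exact: (@emeasurable_fun_cvg _ _ R D (fun n x => (fn n x)%:E)).
have aec : {ae mu, forall x, D x -> (fn n x)%:E @[n --> \oo] --> (EFin \o f) x}.
  exact: aeW.
have aeb : {ae mu, forall x n, D x -> (`|(fn n x)%:E| <= (EFin \o g) x)%E}.
  by apply: aeW => x n Dx; rewrite /= lee_fin fng.
have [fi _ fc] := @dominated_convergence _ _ _ mu D mD (fun n x => (fn n x)%:E)
  (EFin \o f) (EFin \o g) mfn' mf aec ig aeb.
split=> //; apply: fine_cvg; rewrite /Rintegral fineK; first exact: fc.
exact: integrable_fin_num.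
Qed.

Lemma cvg_Rintegral_bigcup (F : nat -> set R) f :
  (forall n, measurable (F n)) -> nondecreasing_seq F ->
  mu.-integrable (\bigcup_n F n) (EFin \o f) ->
  \int[mu]_(x in F n) f x @[n --> \oo] --> \int[mu]_(x in \bigcup_n F n) f x.
Proof.
move=> mF ndF fi; pose D := \bigcup_n F n.
have mD : measurable D by exact: bigcupT_measurable.
have mf : measurable_fun D f by apply/measurable_EFinP; exact: measurable_int fi.
have e n : \int[mu]_(x in F n) f x = \int[mu]_(x in D) (f \_ (F n)) x.
  rewrite -Rintegral_mkcondr; congr (\int[mu]_(x in _) _).
  by apply/seteqP; split=> x; [split=> //; exists n|case].
under eq_fun do rewrite e.
apply: (proj2 (@Rintegral_dominated_cvg D (fun n => f \_ (F n)) f (fun x => `|f x|) mD _ _ _ _)).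
- by move=> n; apply/measurable_restrict => //; apply: measurable_funS mf => // x [].
- move=> x [N _ FN]; apply: cvg_near_cst; near=> n.
  rewrite patchE mem_set//; have /subsetPset : (F N <= F n)%O; last by apply.
  by apply: ndF; near: n; exact: nbhs_infty_ge.
- exact: integrable_norm fi.
- by move=> n x Dx; rewrite patchE; case: ifP => //; rewrite normr0.
Unshelve. all: by end_near. Qed.

Lemma measurable_segment (u v : R) : measurable (`[u, v]%classic : set (measurableTypeR R)).
Proof. by []. Qed.

Definition exhausting c d :=
  [/\ {homo c : m n / (m <= n)%N >-> n <= m},
      {homo d : m n / (m <= n)%N >-> m <= n} & forall n, c n <= d n].

Lemma exhausting_nondecreasing c d : exhausting c d ->
  nondecreasing_seq (fun n => `[c n, d n]%classic).
Proof.
move=> [hc hd _] m n mn; apply/subsetPset => x /=; rewrite !in_itv /= => /andP[cx xd].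
by rewrite (le_trans (hc _ _ mn) cx) (le_trans xd (hd _ _ mn)).
Qed.

Lemma Rintegral_FTC2_exhaustion c d f F (l L : R) : exhausting c d ->
  let D := \bigcup_n `[c n, d n]%classic in
  (forall x, D x -> {for x, continuous f}) ->
  (forall x, D x -> is_derive x 1 F (f x)) ->
  mu.-integrable D (EFin \o f) ->
  F (c n) @[n --> \oo] --> l -> F (d n) @[n --> \oo] --> L ->
  \int[mu]_(x in D) f x = L - l.
Proof.
move=> ex D cf dF fi Fl FL; have [_ _ cd] := ex.
have h1 := @cvg_Rintegral_bigcup (fun n => `[c n, d n]%classic) f
  (fun n => measurable_segment (c n) (d n)) (exhausting_nondecreasing ex) fi.
apply: (cvg_unique _ h1); first exact: norm_hausdorff.
apply: cvg_trans (cvgB FL Fl); apply: near_eq_cvg; near=> n.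
have inD x : c n <= x <= d n -> D x by move=> h; exists n => //=; rewrite in_itv.
by rewrite (Rintegral_FTC2 (cd n) (fun x h => cf x (inD x h)) (fun x h => dF x (inD x h))).
Unshelve. all: by end_near. Qed.

(** On each segment the integral of |f| is at most F(d n) - F(c n) <= 2 M, and monotone convergence
    concludes. The same argument covers infinite ends and singular end points. *)
Lemma integrable_bounded_primitive c d f G F M : exhausting c d ->
  let D := \bigcup_n `[c n, d n]%classic in
  measurable_fun D f ->
  (forall x, D x -> {for x, continuous G}) ->
  (forall x, D x -> is_derive x 1 F (G x)) ->
  (forall x, D x -> `|f x| <= G x) ->
  (forall x, D x -> `|F x| <= M) ->
  mu.-integrable D (EFin \o f).
Proof.
move=> ex D mf cG dF fG FM; have [_ _ cd] := ex.
have mD : measurable D by apply: bigcupT_measurable => n; exact: measurable_segment.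
have inD n x : c n <= x <= d n -> D x by move=> h; exists n => //=; rewrite in_itv.
have Di n : `[c n, d n]%classic `<=` D.
  by move=> x /=; rewrite in_itv /=; exact: inD.
apply/integrableP; split; first exact/measurable_EFinP.
apply: (@le_lt_trans _ _ (2 * M)%:E); last exact: ltry.
have mabs : measurable_fun D (abse \o (EFin \o f)).
  by apply: measurableT_comp => //; exact/measurable_EFinP.
have h : (\int[mu]_(x in `[c n, d n]) `|(f x)%:E| @[n --> \oo] --> \int[mu]_(x in D) `|(f x)%:E|)%E.
  apply: ge0_nondecreasing_set_cvg_integral => //; first exact: exhausting_nondecreasing.
  by move=> n; exact: measurable_funS mD (@Di n) mabs.
apply: cvge_le h; apply: nearW => n.
have Gi : mu.-integrable `[c n, d n] (EFin \o G).
  by apply: integrable_segment => x /inD; exact: cG.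
apply: (@le_trans _ _ (\int[mu]_(x in `[c n, d n]) (G x)%:E)%E).
  apply: ge0_le_integral => //.
  - exact: measurable_funS mD (@Di n) mabs.
  - exact: measurable_int Gi.
  - by move=> x Dx; rewrite /= lee_fin; exact: fG (Di n x Dx).
have /fineK <- := integrable_fin_num (measurable_segment _ _) Gi.
rewrite lee_fin -[X in X <= _]/(\int[mu]_(x in `[c n, d n]) G x).
rewrite (Rintegral_FTC2 (cd n) (fun x h => cG x (inD n x h)) (fun x h => dF x (inD n x h))).
have Fc : `|F (c n)| <= M by apply: FM; apply: (inD n); rewrite lexx cd.
have Fd : `|F (d n)| <= M by apply: FM; apply: (inD n); rewrite lexx cd.
have := ler_norm (F (d n) - F (c n)); have := ler_normB (F (d n)) (F (c n)); lra.

Qed.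

Lemma cvg_harmonic_scale (k : R) : k / n.+1%:R @[n --> \oo] --> 0.
Proof. by rewrite -[X in _ --> X](mulr0 k); apply: cvgM; [exact: cvg_cst|exact: cvg_harmonic]. Qed.

Lemma lt_harmonic_scale (k e : R) : 0 < e -> \forall n \near \oo, k / n.+1%:R < e.
Proof. by move=> e0; have := cvg_harmonic_scale k => /cvgr_lt; apply. Qed.

Lemma exhausting_lty (a : R) :
  exhausting (fun n => a - n.+2%:R) (fun n => a - n.+1%:R^-1) /\
  \bigcup_n `[a - n.+2%:R, a - n.+1%:R^-1]%classic = [set x | x < a].
Proof.
split.
  split.
  - by move=> m n mn; rewrite lerD2l lerN2 ler_nat.
  - by move=> m n mn; rewrite lerD2l lerN2 lef_pV2 ?posrE// ler_nat.
  - move=> n; rewrite lerD2l lerN2 (@le_trans _ _ 1)// ?invf_le1 ?ler1n//.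
apply/seteqP; split=> x /=.
  move=> [n _]; rewrite /= in_itv /= => /andP[_ xa].
  by apply: le_lt_trans xa _; rewrite gtrBl invr_gt0.
move=> xa; suff [n h] : exists n, a - n.+2%:R <= x <= a - n.+1%:R^-1.
  by exists n => //=; rewrite in_itv.
apply: (@filter_ex _ \oo); near=> n; apply/andP; split.
  have : a - x < n%:R by near: n; exact: nbhs_infty_gtr.
  by rewrite -natr1 -natr1; lra.
have : 1 / n.+1%:R < a - x by near: n; apply: lt_harmonic_scale; rewrite subr_gt0.
by rewrite div1r; move: (n.+1%:R^-1) => h; lra.
Unshelve. all: by end_near. Qed.

Lemma exhausting_gty (b : R) :
  exhausting (fun n => b + n.+1%:R^-1) (fun n => b + n.+2%:R) /\
  \bigcup_n `[b + n.+1%:R^-1, b + n.+2%:R]%classic = [set x | b < x].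
Proof.
split.
  split.
  - by move=> m n mn; rewrite lerD2l lef_pV2 ?posrE// ler_nat.
  - by move=> m n mn; rewrite lerD2l ler_nat.
  - move=> n; rewrite lerD2l (@le_trans _ _ 1)// ?invf_le1 ?ler1n//.
apply/seteqP; split=> x /=.
  move=> [n _]; rewrite /= in_itv /= => /andP[xb _].
  by apply: lt_le_trans xb; rewrite ltrDl invr_gt0.
move=> xb; suff [n h] : exists n, b + n.+1%:R^-1 <= x <= b + n.+2%:R.
  by exists n => //=; rewrite in_itv.
apply: (@filter_ex _ \oo); near=> n; apply/andP; split.
  have : 1 / n.+1%:R < x - b by near: n; apply: lt_harmonic_scale; rewrite subr_gt0.
  by rewrite div1r; move: (n.+1%:R^-1) => h; lra.
have : x - b < n%:R by near: n; exact: nbhs_infty_gtr.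
by rewrite -natr1 -natr1; lra.
Unshelve. all: by end_near. Qed.

(** The offset is half the length divided by n + 1, so the two ends never cross. *)
Lemma exhausting_oo (a b : R) : a < b ->
  exhausting (fun n => a + (b - a) / 2 / n.+1%:R) (fun n => b - (b - a) / 2 / n.+1%:R) /\
  \bigcup_n `[a + (b - a) / 2 / n.+1%:R, b - (b - a) / 2 / n.+1%:R]%classic =
    [set x | a < x < b].
Proof.
move=> ab; have k0 : 0 < (b - a) / 2 by lra.
have le1 n : (b - a) / 2 / n.+1%:R <= (b - a) / 2.
  by rewrite -[leRHS]mulr1 ler_pM2l// invf_le1 ?ler1n.
have le2 m n : (m <= n)%N -> (b - a) / 2 / n.+1%:R <= (b - a) / 2 / m.+1%:R.
  by move=> mn; rewrite ler_pM2l// lef_pV2 ?posrE// ler_nat.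
split.
  split.
  - by move=> m n /le2; move: (_ / n.+1%:R) (_ / m.+1%:R) => u v; lra.
  - by move=> m n /le2; move: (_ / n.+1%:R) (_ / m.+1%:R) => u v; lra.
  - by move=> n; have := le1 n; move: (_ / n.+1%:R) => u; lra.
apply/seteqP; split=> x /=.
  move=> [n _]; rewrite /= in_itv /= => /andP[ax xb].
  have : 0 < (b - a) / 2 / n.+1%:R by rewrite divr_gt0.
  by move: ax xb; move: (_ / n.+1%:R) => u; lra.
move=> /andP[ax xb].
suff [n h] : exists n, a + (b - a) / 2 / n.+1%:R <= x <= b - (b - a) / 2 / n.+1%:R.
  by exists n => //=; rewrite in_itv.
apply: (@filter_ex _ \oo); near=> n.
have : (b - a) / 2 / n.+1%:R < x - a by near: n; apply: lt_harmonic_scale; rewrite subr_gt0.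
have : (b - a) / 2 / n.+1%:R < b - x by near: n; apply: lt_harmonic_scale; rewrite subr_gt0.
by move: (_ / n.+1%:R) => u; lra.
Unshelve. all: by end_near. Qed.

Lemma exhausting_T :
  exhausting (fun n => - n%:R) (fun n => n%:R) /\
  \bigcup_n `[- n%:R : R, n%:R]%classic = setT.
Proof.
split.
  split.
  - by move=> m n mn; rewrite lerN2 ler_nat.
  - by move=> m n mn; rewrite ler_nat.
  - by move=> n; rewrite (@le_trans _ _ 0)// oppr_le0.
apply/seteqP; split=> x //= _; suff [n h] : exists n, - n%:R <= x <= n%:R.
  by exists n => //=; rewrite in_itv.
apply: (@filter_ex _ \oo); near=> n; rewrite -ler_norml.
by near: n; exact: nbhs_infty_ger.
Unshelve. all: by end_near. Qed.

End Exhaustion.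

(** * Truncated integrals *)

Section TruncatedIntegrals.
Variable R : realType.
Local Notation mu := (@lebesgue_measure R).
Implicit Types (f u : R -> R) (x y e N : R).

Lemma continuous_measurableR f : continuous f -> measurable_fun setT f.
Proof. exact: continuous_measurable_fun. Qed.

(** This weight dominates, up to a constant, any product of two functions of size 1 / (1 + |y|),
    which is how all later integrability over the line is obtained. The bounded primitive is
    [atan]. *)
Lemma integrable_oneDsqrV : mu.-integrable setT (EFin \o (fun y : R => (1 + y ^+ 2)^-1)).
Proof.
have pos y : 0 < 1 + y ^+ 2 by rewrite ltr_pwDl// sqr_ge0.
have cw y : {for y, continuous (fun y : R => (1 + y ^+ 2)^-1)}.
  apply: continuous1V; first exact: lt0r_neq0.
  by apply: continuous1D; [exact: continuous1_cst|apply: continuous1X; exact: continuous1_id].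
have [ex <-] := exhausting_T R.
apply: (integrable_bounded_primitive (G := fun y => (1 + y ^+ 2)^-1) (F := @atan R)
  (M := pi) ex) => [|y _|y _|y _].
- by apply: measurable_funS (continuous_measurableR cw).
- exact: cw.

- by rewrite ger0_norm// invr_ge0 ltW.
- have := atan_gtNpi2 y; have := atan_ltpi2 y; have := pi_gt0 R; rewrite ler_norml; lra.
Qed.

Lemma measurable_away x e : measurable (away x e).
Proof.
have c y : {for y, continuous (fun y => `|x - y|)}.
  apply: (@continuous1_comp _ (fun z : R => `|z|) (fun y => x - y)).
    exact: norm_continuous.
  by apply: continuous1B; [exact: continuous1_cst|exact: continuous1_id].
have -> : away x e = (fun y => `|x - y|) @^-1` [set z | e < z] by [].
by apply: open_measurable; apply: open_comp; [move=> y _; exact: c|exact: open_gt].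
Qed.

Lemma integrable_setU (A B : set R) f : measurable A -> measurable B ->
  [disjoint A & B] -> mu.-integrable A (EFin \o f) -> mu.-integrable B (EFin \o f) ->
  mu.-integrable (A `|` B) (EFin \o f).
Proof.
move=> mA mB /disj_setPS AB /integrable_mkcond -/(_ mA) iA /integrable_mkcond -/(_ mB) iB.
apply/integrable_mkcond; first exact: measurableU.
apply: eq_integrable (integrableD _ iA iB) => // y _ /=.
rewrite !patchE in_setU; case: (boolP (y \in A)) => yA; case: (boolP (y \in B)) => yB //=.
- by have := AB y (conj (set_mem yA) (set_mem yB)).
- by rewrite adde0.
- by rewrite add0e.
- by rewrite adde0.
Qed.

Definition annulus x e N : set R := [set y | e < `|x - y| <= N].

Lemma annulusE x e N : 0 <= e -> annulus x e N = `[x - N, x - e[ `|` `]x + e, x + N].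
Proof.
move=> e0; apply/seteqP; split=> y; rewrite /annulus /= !in_itv /=.
  have [xy|xy] := leP 0 (x - y).
    by rewrite ger0_norm// => ?; left; lra.
  by rewrite ltr0_norm// => ?; right; lra.
by move=> [h|h]; [rewrite ger0_norm; lra|rewrite ler0_norm; lra].
Qed.

Lemma Rintegral_annulus f x e N : 0 < e -> e <= N ->
  (forall y, y != x -> {for y, continuous f}) ->
  mu.-integrable (annulus x e N) (EFin \o f) /\
  \int[mu]_(y in annulus x e N) f y = \int[mu]_(r in `[e, N]) (f (x - r) + f (x + r)).
Proof.
move=> e0 eN cf.
have cl y : x - N <= y <= x - e -> {for y, continuous f}.
  by move=> h; apply: cf; apply/eqP; lra.
have cr y : x + e <= y <= x + N -> {for y, continuous f}.
  by move=> h; apply: cf; apply/eqP; lra.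
have il : mu.-integrable `[x - N, x - e[ (EFin \o f).
  apply: integrableS (integrable_segment cl) => //; apply: subset_itvl; by rewrite bnd_simp.
have ir : mu.-integrable `]x + e, x + N] (EFin \o f).
  apply: integrableS (integrable_segment cr) => //; apply: subset_itvr; by rewrite bnd_simp.
have dj : [disjoint `[x - N, x - e[%classic & `]x + e, x + N]%classic].
  by apply/disj_setPS => y [/=]; rewrite !in_itv /=; lra.
rewrite annulusE ?ltW//; have iU := integrable_setU _ _ dj il ir; split; first exact: iU.
rewrite Rintegral_setU// ?Rintegral_itv_bndo_bndc// ?Rintegral_itv_obnd_cbnd//; last exact: iU.
rewrite (Rintegral_segment_subl eN cl) (Rintegral_segment_addl eN cr) -RintegralD//.
- apply: integrable_segment => r /andP[er rN].
  apply: (continuous1_comp (f := f)); first by apply: cl; lra.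
  by apply: continuous1B; [exact: continuous1_cst|exact: continuous1_id].
- apply: integrable_segment => r /andP[er rN].
  apply: (continuous1_comp (f := f)); first by apply: cr; lra.
  by apply: continuous1D; [exact: continuous1_cst|exact: continuous1_id].
Qed.

Lemma annulus_bigcup x e : \bigcup_n annulus x e n%:R = away x e.
Proof.
apply/seteqP; split=> y; first by move=> [n _] /andP[].
move=> h; suff [n hn] : exists n, `|x - y| <= n%:R.
  by exists n => //; rewrite /annulus /= hn andbT.
by apply: (@filter_ex _ \oo); exact: nbhs_infty_ger.
Qed.

Lemma measurable_annulus x e N : measurable (annulus x e N).
Proof.
have -> : annulus x e N = away x e `&` ~` (away x N).
  apply/seteqP; split=> y; rewrite /annulus /away /=.
    by move=> /andP[-> yN]; split => //; apply/negP; rewrite -leNgt.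
  by move=> [-> /negP]; rewrite -leNgt.
by apply: measurableI; [|apply: measurableC]; exact: measurable_away.
Qed.

(** Folding the two sides of x together gives an integral in the radius alone, the form in which the
    kernel can be recognised as a radial derivative. *)
Lemma cvg_truncated_integral f x e : 0 < e ->
  (forall y, y != x -> {for y, continuous f}) ->
  mu.-integrable (away x e) (EFin \o f) ->
  \int[mu]_(r in `[e, n%:R]) (f (x - r) + f (x + r)) @[n --> \oo] -->
  truncated_integral f x e.
Proof.
move=> e0 cf fi; rewrite /truncated_integral -annulus_bigcup.
have := @cvg_Rintegral_bigcup R (fun n => annulus x e n%:R) f
  (fun n => measurable_annulus x e n%:R).
rewrite annulus_bigcup => /(_ _ fi) h.
apply: cvg_trans (h _); last first.
  move=> m n mn; apply/subsetPset => y /andP[ey ym]; rewrite /annulus /= ey (le_trans ym)//.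
  by rewrite ler_nat.
apply: near_eq_cvg; near=> n.
have en : e <= n%:R by near: n; exact: nbhs_infty_ger.
by have [_ ->] := Rintegral_annulus e0 en cf.
Unshelve. all: by end_near. Qed.

Lemma truncated_integral_split f x e N : 0 < e -> e <= N ->
  (forall y, y != x -> {for y, continuous f}) ->
  mu.-integrable (away x e) (EFin \o f) ->
  truncated_integral f x e = \int[mu]_(r in `[e, N]) (f (x - r) + f (x + r)) +
    truncated_integral f x N.
Proof.
move=> e0 eN cf fi; have [_ <-] := Rintegral_annulus e0 eN cf.
have -> : truncated_integral f x e = \int[mu]_(y in annulus x e N `|` away x N) f y.
  congr (\int[mu]_(y in _) _); apply/seteqP; split=> y; rewrite /annulus /away /=.
    by move=> ey; have [yN|yN] := leP `|x - y| N; [left; rewrite ey|right].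
  by move=> [/andP[]//|]; exact: le_lt_trans.
rewrite Rintegral_setU//.
- exact: measurable_annulus.
- exact: measurable_away.
- apply: integrableS fi => //; first exact: measurable_away.
    by apply: measurableU; [exact: measurable_annulus|exact: measurable_away].
  by move=> y [/andP[]//|]; exact: le_lt_trans.
- by apply/disj_setPS => y [/andP[_ h]]; rewrite /away /= ltNge h.
Qed.

(** The truncation is moved from the domain of integration into the kernel, so that the truncated
    transform is an integral over a domain independent of x, as Fubini requires. *)
Definition trunc_inv (e z : R) : R := if e < `|z| then z^-1 else 0.

Lemma measurable_inv : measurable_fun setT (@GRing.inv R).
Proof.
have -> : setT = [set z : R | z != 0] `|` [set 0].
  by apply/seteqP; split=> z // _ /=; have [->|] := eqVneq z 0; [right|left].
have oD : open [set z : R | z != 0] by exact: open_neq.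
apply/measurable_funU; [exact: open_measurable|exact: measurable_set1|split].
  apply: open_continuous_measurable_fun => // z; rewrite inE /= => z0.
  by apply: (continuous1V (f := fun z => z)) => //; exact: continuous1_id.
exact: measurable_fun_set1.
Qed.

Lemma measurable_trunc_inv e : measurable_fun setT (trunc_inv e).
Proof.
have mE : measurable [set z : R | e < `|z|].
  have -> : [set z : R | e < `|z|] = away 0 e.
    by apply/seteqP; split=> z; rewrite /away /= sub0r normrN.
  exact: measurable_away.
have -> : trunc_inv e = (@GRing.inv R) \_ [set z | e < `|z|].
  by apply/funext => z; rewrite /trunc_inv patchE mem_setE.
by apply: (measurable_restrictT _ mE).1; exact: measurable_funTS measurable_inv.
Qed.

(** For |x - y| > e one has 1 + |y| <= (1 + |x|) + |x - y|, and 1 + |x| is at most (1 + |x|) / e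
    times |x - y|. *)
Lemma trunc_inv_le e x y : 0 < e ->
  `|trunc_inv e (x - y)| <= (1 + (1 + `|x|) / e) / (1 + `|y|).
Proof.
move=> e0; have y0 : 0 < 1 + `|y| by rewrite ltr_pwDl.
have k0 : 0 < 1 + (1 + `|x|) / e by rewrite ltr_pwDl// divr_ge0// ?ltW// ltr_pwDl.
rewrite /trunc_inv; case: ifPn => [h|_]; last by rewrite normr0 divr_ge0// ltW.
have d0 : 0 < `|x - y| by exact: lt_trans h.
rewrite normfV ler_pdivlMr// mulrC ler_pdivrMr//.
have h1 : 1 + `|x| <= (1 + `|x|) / e * `|x - y|.
  rewrite mulrAC ler_pdivlMr// ler_pM2l; last by rewrite ltr_pwDl.
  exact: ltW.
by have := lerB_dist y x; rewrite distrC mulrDl mul1r; lra.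
Qed.

Lemma inv_norm_sqr_le y : (1 + `|y|)^-1 ^+ 2 <= (1 + y ^+ 2)^-1.
Proof.
have y0 : 0 < 1 + `|y| by rewrite ltr_pwDl.
rewrite exprVn lef_pV2 ?posrE ?exprn_gt0//; last by rewrite ltr_pwDl// sqr_ge0.
by rewrite sqrrD expr1n mul1r real_normK ?num_real//; have := normr_ge0 y; lra.
Qed.

Lemma truncated_kernelE u x e :
  ((fun y => u y / (x - y)) \_ (away x e)) = fun y => u y * trunc_inv e (x - y).
Proof.
apply/funext => y; rewrite patchE /trunc_inv; have [h|h] := boolP (e < `|x - y|).
  by rewrite mem_set.
by rewrite memNset ?mulr0//; apply/negP.
Qed.

Lemma kernel_decay u x e C : 0 < e -> (forall y, (1 + `|y|) * `|u y| <= C) ->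
  forall y, `|u y * trunc_inv e (x - y)| <= C * (1 + (1 + `|x|) / e) * (1 + y ^+ 2)^-1.
Proof.
move=> e0 uC y; have y0 : 0 < 1 + `|y| by rewrite ltr_pwDl.
have k0 : 0 < 1 + (1 + `|x|) / e by rewrite ltr_pwDl// divr_ge0// ?ltW// ltr_pwDl.
have C0 : 0 <= C by apply: le_trans (uC 0); rewrite mulr_ge0// ltW// ltr_pwDl.
rewrite normrM; apply: (@le_trans _ _ (C / (1 + `|y|) * ((1 + (1 + `|x|) / e) / (1 + `|y|)))).
  apply: ler_pM => //; last exact: trunc_inv_le.
  by rewrite ler_pdivlMr// mulrC.
apply: (@le_trans _ _ (C * (1 + (1 + `|x|) / e) * (1 + `|y|)^-1 ^+ 2)).
  by rewrite expr2 le_eqVlt; apply/orP; left; apply/eqP; ring.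
by rewrite ler_wpM2l ?inv_norm_sqr_le// mulr_ge0// ltW.
Qed.

Lemma integrable_kernel u x e C : 0 < e -> measurable_fun setT u ->
  (forall y, (1 + `|y|) * `|u y| <= C) ->
  mu.-integrable (away x e) (EFin \o (fun y => u y / (x - y))).
Proof.
move=> e0 mu_ uC; apply/integrable_mkcond; first exact: measurable_away.
rewrite restrict_EFin truncated_kernelE.
pose K := C * (1 + (1 + `|x|) / e).
have iK : mu.-integrable setT (EFin \o (fun y : R => K * (1 + y ^+ 2)^-1)).
  by apply: (integrableZl _ K integrable_oneDsqrV).
apply: le_integrable iK => //.
- apply/measurable_EFinP/measurable_funM => //.
  apply: measurableT_comp; first exact: measurable_trunc_inv.
  by apply: continuous_measurableR => y; apply: continuous1B;
    [exact: continuous1_cst|exact: continuous1_id].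
- move=> y _ /=; rewrite lee_fin.
  apply: (le_trans (kernel_decay x e0 uC y)).
  exact: ler_norm.

Qed.
End TruncatedIntegrals.

(** * Hilbert transforms *)

Section HilbertTransforms.
Variable R : realType.
Local Notation mu := (@lebesgue_measure R).
Implicit Types (u v : R -> R) (a b x y e : R).

Definition hkernel u x : R -> R := fun y => u y / (x - y).

(* [v] is the Hilbert transform of [u], with uniformly bounded truncations. *)
Definition hilbert_pair u v :=
  [/\ continuous u /\ continuous v,
      exists C : R, forall y, (1 + `|y|) * `|u y| <= C,
      forall y, `|v y| <= 1,
      forall x e, 0 < e -> `|truncated_integral (hkernel u x) x e| <= pi &
      forall x, truncated_integral (hkernel u x) x e @[e --> 0^'+] --> pi * v x].

Lemma continuous_rescale a b : continuous (@rescale R a b).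
Proof. by move=> y; exact: is_derive1_continuous (is_derive_rescale a b y). Qed.

(** Obtained by inverting the affine map; it carries decay in the rescaled variable over to decay in
    y. *)
Lemma rescale_growth a b : a < b -> forall y,
  1 + `|y| <= (1 + (b - a) / 2 + `|a + b| / 2) * (1 + `|rescale a b y|).
Proof.
move=> ab y; have d0 : b - a != 0 by rewrite subr_eq0 gt_eqF.
have e : y = (b - a) / 2 * rescale a b y + (a + b) / 2 by rewrite /rescale; field.
move: (rescale a b y) e => z e; have := ler_normD ((b - a) / 2 * z) ((a + b) / 2).
rewrite -e !normrM [ `|b - a| ]gtr0_norm ?subr_gt0// [ `|2^-1| ]gtr0_norm// => h.
apply: le_trans (lerD (lexx 1) h) _.
have h1 : 0 <= (b - a) / 2 by lra.
have h2 := normr_ge0 (a + b); have h3 := normr_ge0 z.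
have h4 : 0 <= `|a + b| * `|z| by rewrite mulr_ge0.
by rewrite mulrDr !mulrDl !mul1r mulr1; lra.
Qed.

Lemma continuous_kernel u x y : continuous u -> y != x -> {for y, continuous (hkernel u x)}.
Proof.
move=> cu yx; apply: continuous1M; first exact: cu.
apply: (continuous1V (f := fun y => x - y)); first by rewrite subr_eq0 eq_sym.
by apply: continuous1B; [exact: continuous1_cst|exact: continuous1_id].
Qed.

(** The last hypothesis supplies the decay of f on the real line, which [cauchy_pair] does not
    contain and which makes the truncated kernels integrable. *)
Lemma cauchy_hilbert_pair (f g : R -> R -> R) a b : a < b -> cauchy_pair f g ->
  (forall x, `|x| * `|f x 0| <= 2) ->
  hilbert_pair (fun y => f (rescale a b y) 0) (fun y => g (rescale a b y) 0).
Proof.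
move=> ab fg fd; have [[cf cg] [f1 g1] _ _] := fg.
set u := fun y : R => f _ 0; set v := fun y : R => g _ 0.
have cu : continuous u.
  by move=> y; apply: cf => //; [exact: continuous_rescale|exact: continuous1_cst].
have cv : continuous v.
  by move=> y; apply: cg => //; [exact: continuous_rescale|exact: continuous1_cst].
have [C uC] : exists C : R, forall y, (1 + `|y|) * `|u y| <= C.
  (* The factor 3 is 1 + 2: |f| <= 1 and |z| |f| <= 2 at the rescaled point z. *)
  exists ((1 + (b - a) / 2 + `|a + b| / 2) * 3) => y.
  apply: le_trans (ler_wpM2r (normr_ge0 _) (rescale_growth ab y)) _.
  rewrite -mulrA ler_wpM2l//.
    by rewrite addr_ge0// ?divr_ge0// addr_ge0// divr_ge0// subr_ge0 ltW.
  by rewrite mulrDl mul1r; have := fd (rescale a b y); have := f1 (rescale a b y) 0; rewrite /u; lra.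
have al0 : 0 < 2 / (b - a) by rewrite divr_gt0// subr_gt0.
(* The folded kernel is (u(x - r) - u(x + r)) / r, minus the radial derivative of the arc integral;
   integrated from e to n it gives the arc of radius e minus the arc of radius n, and the latter
   tends to 0. *)
have trE x e : 0 < e -> truncated_integral (hkernel u x) x e =
    semicircle g (rescale a b x) (2 / (b - a)) 0 e.
  move=> e0; have ki := integrable_kernel x e0 (continuous_measurableR cu) uC.
  have h1 := cvg_truncated_integral e0 (fun y yx => continuous_kernel cu yx) ki.
  apply: (cvg_unique _ h1); first exact: norm_hausdorff.
  have h2 : semicircle g (rescale a b x) (2 / (b - a)) 0 e -
     semicircle g (rescale a b x) (2 / (b - a)) 0 n%:R @[n --> \oo] -->
     semicircle g (rescale a b x) (2 / (b - a)) 0 e - 0.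
    by apply: cvgB; [exact: cvg_cst|exact: cvg_semicircle_y fg al0].
  rewrite subr0 in h2; apply: cvg_trans h2; apply: near_eq_cvg; near=> n.
  have en : e <= n%:R by near: n; exact: nbhs_infty_ger.
  rewrite -opprB -(semicircle_diff _ fg al0 e0 en) -mulN1r -RintegralZl//; last first.
    apply: integrable_segment => r /andP[er _]; have r0 : r != 0 by rewrite gt_eqF// (lt_le_trans e0).
    have ca (c : R) : {for r, continuous (fun r : R => rescale a b x + c * r)}.
      apply: continuous1D; first exact: continuous1_cst.
      by apply: continuous1M; [exact: continuous1_cst|exact: continuous1_id].
    apply: continuous1M; last by apply: continuous1V => //; exact: continuous1_id.
    apply: continuous1B; first by apply: cf => //; exact: continuous1_cst.
    have := ca (- (2 / (b - a))); rewrite (_ : (fun _ => _) = (fun r : R => rescale a b x - 2 / (b - a) * r)).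
      by move=> c; apply: cf => //; exact: continuous1_cst.
    by apply/funext => z; rewrite mulNr.
  apply: eq_Rintegral => r; rewrite inE /= in_itv /= => /andP[er _].
  have r0 : r != 0 by rewrite gt_eqF// (lt_le_trans e0).
  have e1 : rescale a b (x + r) = rescale a b x + 2 / (b - a) * r by rewrite /rescale; ring.
  have e2 : rescale a b (x - r) = rescale a b x - 2 / (b - a) * r by rewrite /rescale; ring.
  have e3 : x - (x - r) = r by ring.
  have e4 : x - (x + r) = - r by ring.
  by rewrite /hkernel /u e1 e2 e3 e4 invrN; ring.
split => //.
- by exists C.
- by move=> y; exact: g1.
- by move=> x e e0; rewrite trE//; exact: (semicircle_le _ _ fg).
- move=> x; have h3 := @cvg_semicircle_0 R f g (rescale a b x) (2 / (b - a)) fg.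
  apply: cvg_trans h3.
  by apply: near_eq_cvg; near=> e; rewrite trE//; near: e; exact: nbhs_right_gt.
Unshelve. all: by end_near. Qed.

Lemma hilbert_pair_is_pv u v x : hilbert_pair u v -> is_pv (fun y => u y / (x - y)) x (pi * v x).
Proof.
move=> [[cu _] [C uC] _ _ h]; split; last exact: h.
by move=> e e0; exact: integrable_kernel (continuous_measurableR cu) uC.
Qed.

Lemma hilbert_pair_T k a b : a < b ->
  hilbert_pair (fun y => Ttilde k.+1 (rescale a b y)) (fun y => - W k (rescale a b y)).
Proof.
move=> ab; have := cauchy_hilbert_pair ab (jou_pow_cauchy_pair R k).
rewrite (_ : (fun y => _) = fun y => Ttilde k.+1 (rescale a b y)); last first.
  by apply/funext => y; case: (jou_pow_real k (rescale a b y)).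
rewrite (_ : (fun y => (jou_pow k.+1 _ _).2) = fun y => - W k (rescale a b y)); last first.
  by apply/funext => y; case: (jou_pow_real k (rescale a b y)).
apply => x; have [+ _] := jou_pow_decay k x (lexx 0).
by rewrite normr0 addr0.
Qed.

Lemma hilbert_pair_W k a b : a < b ->
  hilbert_pair (fun y => W k (rescale a b y)) (fun y => Ttilde k.+1 (rescale a b y)).
Proof.
move=> ab; have := cauchy_hilbert_pair ab (jou_pow_cauchy_pairI R k).
rewrite (_ : (fun y => - _) = fun y => W k (rescale a b y)); last first.
  by apply/funext => y; case: (jou_pow_real k (rescale a b y)) => _ ->; rewrite opprK.
rewrite (_ : (fun y => (jou_pow k.+1 _ _).1) = fun y => Ttilde k.+1 (rescale a b y)); last first.
  by apply/funext => y; case: (jou_pow_real k (rescale a b y)).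
apply => x; have [_ +] := jou_pow_decay k x (lexx 0).
by rewrite normr0 addr0 normrN.
Qed.

Lemma hilbert_at_Srow a b n (j : 'I_(2 * n + 3)) x : a < b ->
  hilbert_at (fun t => Srow a b n t 0 j) x ((Sstar a b n x *m Hmx R n) 0 j).
Proof.
move=> ab; rewrite SstarH_col.
have [j0|j0] := boolP (j == 0%N :> nat).
  by left; split => //; apply/funext => t; rewrite SrowE j0 !Ttilde0.
have pi0 : (pi : R) != 0 by exact: lt0r_neq0 (pi_gt0 R).
have [j1|j1] := boolP (loc j == 0).
  have -> : (fun t => Srow a b n t 0 j) = fun t => W (blk j) (rescale a b t).
    by apply/funext => t; rewrite SrowE (negbTE j0) j1.
  right; exists (pi * Ttilde (blk j).+1 (rescale a b x)); last by rewrite mulKf.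
  exact: hilbert_pair_is_pv (hilbert_pair_W _ ab).
have -> : (fun t => Srow a b n t 0 j) = fun t => Ttilde (blk j).+1 (rescale a b t).
  by apply/funext => t; rewrite SrowE (negbTE j0) (negbTE j1).
right; exists (pi * - W (blk j) (rescale a b x)); last by rewrite mulKf.
exact: hilbert_pair_is_pv (hilbert_pair_T _ ab).
Qed.

End HilbertTransforms.

(** * The half Laplacian on Schwartz functions *)

Section FubiniDominated.
Variable R : realType.
Local Notation mu := (@lebesgue_measure R).

Definition cauchy_weight (y : R) : R := (1 + y ^+ 2)^-1.
Local Notation w := cauchy_weight.

Let w_ge0 (y : R) : 0 <= w y.
Proof. by rewrite invr_ge0 addr_ge0// sqr_ge0. Qed.

Lemma integrable_decay (f : R -> R) (K : R) : measurable_fun setT f ->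
  (forall y, `|f y| <= K * w y) -> mu.-integrable setT (EFin \o f).
Proof.
move=> mf fK.
have iK : mu.-integrable setT (EFin \o (fun y : R => K * w y)).
  exact: (integrableZl _ K (integrable_oneDsqrV R)).
apply: le_integrable iK => //; first exact/measurable_EFinP.
by move=> y _ /=; rewrite lee_fin; apply: le_trans (fK y) _; exact: ler_norm.
Qed.

Lemma measurable_w : measurable_fun setT w.
Proof.
by apply/measurable_EFinP; exact: measurable_int (integrable_oneDsqrV R).
Qed.

Lemma integrable_w2 (K : R) : 0 <= K ->
  (mu \x mu)%E.-integrable setT (EFin \o (fun z : R * R => K * w z.1 * w z.2)).
Proof.
move=> K0.
have mw2 : measurable_fun setT (fun z : R * R => K * w z.1 * w z.2).
  apply: measurable_funM; last exact: measurableT_comp measurable_w measurable_snd.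
  by apply: measurable_funM => //; exact: measurableT_comp measurable_w measurable_fst.
apply/integrable12ltyP; first exact/measurable_EFinP.
pose W := \int[mu]_y w y.
have WE : (\int[mu]_y (w y)%:E = W%:E)%E.
  by rewrite /W /Rintegral fineK//; exact: integrable_fin_num (integrable_oneDsqrV R).
have E x : (\int[mu]_y `|(K * w x * w y)%:E| = (K * W * w x)%:E)%E.
  rewrite -[in RHS]mulrA [W * _]mulrC mulrA EFinM -WE -ge0_integralZl//.
  - by apply: eq_integral => y _; rewrite gee0_abs ?EFinM// lee_fin !mulr_ge0.
  - by apply/measurable_EFinP; exact: measurable_w.
  - by move=> y _; rewrite lee_fin.
  - by rewrite lee_fin mulr_ge0.
rewrite /=; under eq_integral do rewrite E.
have : mu.-integrable setT (EFin \o (fun x => K * W * w x)).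
  exact: (integrableZl _ (K * W) (integrable_oneDsqrV R)).
by move=> /integrable_lty; apply.
Qed.

Lemma Rintegral_fubini_dominated (k : R -> R -> R) (K : R) :
  measurable_fun setT (fun z : R * R => k z.1 z.2) ->
  (forall x y, `|k x y| <= K * w x * w y) ->
  [/\ measurable_fun setT (fun x => \int[mu]_y k x y),
      measurable_fun setT (fun y => \int[mu]_x k x y) &
      \int[mu]_x \int[mu]_y k x y = \int[mu]_y \int[mu]_x k x y].
Proof.
move=> mk kK.
have K0 : 0 <= K.
  by have := le_trans (normr_ge0 _) (kK 0 0); rewrite /cauchy_weight expr0n addr0 invr1 !mulr1.
have ik : (mu \x mu)%E.-integrable setT (EFin \o (fun z : R * R => k z.1 z.2)).
  apply: le_integrable (integrable_w2 K0) => //; first exact/measurable_EFinP.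
  by move=> [x y] _ /=; rewrite lee_fin; apply: le_trans (kK x y) _; exact: ler_norm.
have mk1 x : measurable_fun setT (k x).
  exact: measurable_fun_pair2 mk.
have mk2 y : measurable_fun setT (k ^~ y).
  exact: measurable_fun_pair1 mk.
have i1 x : mu.-integrable setT (EFin \o k x).
  by apply: (integrable_decay (K := K * w x)).
have i2 y : mu.-integrable setT (EFin \o k ^~ y).
  by apply: (integrable_decay (K := K * w y)) => // x; rewrite mulrAC.
have e1 : fubini_F mu (EFin \o (fun z : R * R => k z.1 z.2)) =
    EFin \o (fun x => \int[mu]_y k x y).
  by apply/funext => x; rewrite /fubini_F /= /Rintegral fineK//; exact: integrable_fin_num (i1 x).
have e2 : fubini_G mu (EFin \o (fun z : R * R => k z.1 z.2)) =
    EFin \o (fun y => \int[mu]_x k x y).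
  by apply/funext => y; rewrite /fubini_G /= /Rintegral fineK//; exact: integrable_fin_num (i2 y).
split.
- by apply/measurable_EFinP; rewrite -e1; exact: (measurable_fubini_F ik).
- by apply/measurable_EFinP; rewrite -e2; exact: (measurable_fubini_G ik).
- have h : (\int[mu]_x (EFin \o (fun x => (\int[mu]_y k x y)%R)) x =
            \int[mu]_y (EFin \o (fun y => (\int[mu]_x k x y)%R)) y)%E.
    by rewrite -e1 -e2; exact: etrans (integral12_prod_meas1 ik) (esym (integral21_prod_meas1 ik)).
  exact: (congr1 fine h).
Qed.

End FubiniDominated.

(** * Truncated Hilbert transforms of smooth decaying functions *)

Section SmoothKernels.
Variable R : realType.
Local Notation mu := (@lebesgue_measure R).
Local Notation w := (@cauchy_weight R).
Implicit Types (x y z r e M C a : R).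

Lemma mean_value (f df : R -> R) x y : x <= y -> (forall z, is_derive z 1 f (df z)) ->
  exists2 c, x <= c <= y & f y - f x = df c * (y - x).
Proof.
move=> xy dF; have [|c cxy ->] := @MVT_segment R f df x y xy (fun z _ => dF z).
  by apply: within_segment_continuous => z _; exact: is_derive1_continuous (dF z).
by exists c => //; move: cxy; rewrite in_itv.
Qed.

Lemma lipschitz_of_derive (f df : R -> R) C x y : (forall z, is_derive z 1 f (df z)) ->
  (forall z, `|df z| <= C) -> `|f y - f x| <= C * `|y - x|.
Proof.
move=> dF dC; wlog xy : x y / x <= y.
  move=> h; have [xy|/ltW yx] := leP x y; first exact: h.
  by rewrite distrC (distrC y); exact: h.
by have [c _ ->] := mean_value xy dF; rewrite normrM ler_wpM2r.
Qed.

Lemma kernel_sym (u : R -> R) x r : r != 0 ->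
  hkernel u x (x - r) + hkernel u x (x + r) = (u (x - r) - u (x + r)) / r.
Proof.
move=> r0; have e3 : x - (x - r) = r by ring.
have e4 : x - (x + r) = - r by ring.
by rewrite /hkernel e3 e4 invrN; ring.
Qed.

Lemma truncated_kernel_integral (u : R -> R) x e :
  truncated_integral (hkernel u x) x e = \int[mu]_y (u y * trunc_inv e (x - y)).
Proof. by rewrite /truncated_integral Rintegral_mkcond truncated_kernelE. Qed.

Lemma decay_sqr_le C a y : (1 + `|y|) ^+ 2 * `|a| <= C -> `|a| <= C * w y.
Proof.
move=> aC; have y0 : 0 < 1 + `|y| by rewrite ltr_pwDl.
have C0 : 0 <= C by apply: le_trans aC; rewrite mulr_ge0// sqr_ge0.
apply: (@le_trans _ _ (C * (1 + `|y|)^-1 ^+ 2)).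
  by rewrite exprVn ler_pdivlMr ?exprn_gt0// mulrC.
by rewrite ler_wpM2l// inv_norm_sqr_le.
Qed.

Lemma decay_sqr_lin C a y : (1 + `|y|) ^+ 2 * `|a| <= C -> (1 + `|y|) * `|a| <= C.
Proof.
move=> aC; have y0 := normr_ge0 y; apply: le_trans aC.
by rewrite expr2 -mulrA ler_peMl ?mulr_ge0// ?lerDl// addr_ge0.
Qed.

Lemma trunc_inv_le_inv e z : 0 < e -> `|trunc_inv e z| <= e^-1.
Proof.
move=> e0; rewrite /trunc_inv; case: ifPn => [ez|_]; last by rewrite normr0 invr_ge0 ltW.
have z0 : 0 < `|z| by exact: lt_trans ez.
by rewrite normfV lef_pV2 ?posrE// ltW.
Qed.

Lemma measurable_kernel_trunc (u : R -> R) x e : measurable_fun setT u ->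
  measurable_fun setT (fun y => u y * trunc_inv e (x - y)).
Proof.
move=> mu_; apply: measurable_funM => //.
apply: measurableT_comp; first exact: measurable_trunc_inv.
by apply: continuous_measurableR => y; apply: continuous1B;
  [exact: continuous1_cst|exact: continuous1_id].
Qed.

Section Kernel.
Variables (psi dpsi : R -> R) (C1 C2 : R).
Hypotheses (dp : forall z, is_derive z 1 psi (dpsi z))
  (pC1 : forall y, (1 + `|y|) ^+ 2 * `|psi y| <= C1) (pC2 : forall y, `|dpsi y| <= C2).

Let cpsi : continuous psi.
Proof. by move=> y; exact: is_derive1_continuous (dp y). Qed.

Lemma integrable_smooth_kernel x e : 0 < e ->
  mu.-integrable (away x e) (EFin \o hkernel psi x).
Proof.
move=> e0; apply: integrable_kernel e0 (continuous_measurableR cpsi) _ => y.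
exact: decay_sqr_lin (pC1 y).
Qed.

Let diffq x r := (psi (x - r) - psi (x + r)) / r.

Let diffq_le x r : `|diffq x r| <= 2 * C2.
Proof.
have C20 : 0 <= C2 by apply: le_trans (pC2 0).
have [->|r0] := eqVneq r 0; first by rewrite /diffq invr0 mulr0 normr0 mulr_ge0.
rewrite normrM normfV ler_pdivrMr ?normr_gt0//.
apply: le_trans (lipschitz_of_derive _ _ dp pC2) _.
have -> : x - r - (x + r) = - (2 * r) by ring.
by rewrite normrN normrM gtr0_norm// mulrA (mulrC C2).
Qed.

Lemma truncated_smooth_split x e : 0 < e -> e <= 1 -> truncated_integral (hkernel psi x) x e =
  \int[mu]_(r in `[e, 1]) diffq x r + truncated_integral (hkernel psi x) x 1.
Proof.
move=> e0 e1; rewrite (truncated_integral_split e0 e1 (fun y h => continuous_kernel cpsi h)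
  (integrable_smooth_kernel x e0)).
congr (_ + _); apply: eq_Rintegral => r; rewrite inE /= in_itv /= => /andP[er _].
by rewrite kernel_sym// gt_eqF// (lt_le_trans e0).
Qed.

Let continuous_diffq x r : r != 0 -> {for r, continuous (diffq x)}.
Proof.
move=> r0; apply: continuous1M; last by apply: continuous1V => //; exact: continuous1_id.
apply: continuous1B; apply: (continuous1_comp (f := psi)); try exact: cpsi.
  by apply: continuous1B; [exact: continuous1_cst|exact: continuous1_id].
by apply: continuous1D; [exact: continuous1_cst|exact: continuous1_id].
Qed.

(** Split at radius 1. Inside, folding cancels the singularity and leaves a symmetric difference
    quotient, at most 2 C2 by the Lipschitz bound; outside, the kernel is at most 1 and the decay of
    [psi] suffices. The bound depends neither on x nor on e. *)
Lemma truncated_smooth_le x e : 0 < e -> e <= 1 ->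
  `|truncated_integral (hkernel psi x) x e| <= 2 * C2 + C1 * \int[mu]_y w y.
Proof.
move=> e0 e1; have C20 : 0 <= C2 by apply: le_trans (pC2 0).
rewrite truncated_smooth_split//; apply: le_trans (ler_normD _ _) _; apply: lerD.
  apply: (@le_trans _ _ (2 * C2 * (1 - e))).
    apply: Rintegral_segment_le => //.
    apply: integrable_segment => r /andP[er _]; apply: continuous_diffq.
    by rewrite gt_eqF// (lt_le_trans e0).
  by rewrite -[leRHS]mulr1 ler_wpM2l ?mulr_ge0//; lra.
rewrite truncated_kernel_integral.
have b y : `|psi y * trunc_inv 1 (x - y)| <= C1 * w y.
  rewrite normrM -[leRHS]mulr1; apply: ler_pM => //; first exact: decay_sqr_le (pC1 y).
  by rewrite -[leRHS]invr1 trunc_inv_le_inv.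
have ik := integrable_decay (measurable_kernel_trunc x 1 (continuous_measurableR cpsi)) b.
apply: le_trans (le_normr_Rintegral measurableT ik) _.
have iw : mu.-integrable setT (EFin \o (fun y => C1 * w y)).
  exact: (integrableZl _ C1 (integrable_oneDsqrV R)).
rewrite -RintegralZl//; last exact: integrable_oneDsqrV.
by apply: le_Rintegral => //; exact: integrable_norm ik.
Qed.

(** The singular part converges to an ordinary integral over ]0, 1] of the bounded difference
    quotient. The limit is tested along sequences, where dominated convergence applies with the
    constant 2 C2. *)
Lemma cvg_truncated_smooth x :
  exists l : R, truncated_integral (hkernel psi x) x e @[e --> 0^'+] --> l.
Proof.
pose l := \int[mu]_(r in `]0, 1]) diffq x r.
exists (l + truncated_integral (hkernel psi x) x 1).
suff h : \int[mu]_(r in `[e, 1]) diffq x r @[e --> 0^'+] --> l.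
  have h2 : \int[mu]_(r in `[e, 1]) diffq x r + truncated_integral (hkernel psi x) x 1
      @[e --> 0^'+] --> l + truncated_integral (hkernel psi x) x 1.
    by apply: cvgD => //; exact: cvg_cst.
  apply: cvg_trans h2; apply: near_eq_cvg; near=> e; rewrite (@truncated_smooth_split x e)//.
  by near: e; exact: nbhs_right_le.
have mq : measurable_fun setT (diffq x).
  apply: measurable_funM; last exact: measurable_inv.
  apply: measurable_funB; apply: measurableT_comp (continuous_measurableR cpsi) _;
    apply: continuous_measurableR => y.
    by apply: continuous1B; [exact: continuous1_cst|exact: continuous1_id].
  by apply: continuous1D; [exact: continuous1_cst|exact: continuous1_id].
apply/cvg_at_rightP => s [s0 s_cvg].
have e n : \int[mu]_(r in `[s n, 1]) diffq x r =
    \int[mu]_(r in `]0, 1]) (diffq x \_ `[s n, 1]) r.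
  rewrite -Rintegral_mkcondr; congr (\int[mu]_(r in _) _); apply/seteqP; split=> r /=.
    by rewrite !in_itv /= => /andP[sr r1]; rewrite sr r1 (lt_le_trans (s0 n)).
  by case.
under eq_fun do rewrite e.
apply: (proj2 (@Rintegral_dominated_cvg R `]0, 1]%classic (fun n => diffq x \_ `[s n, 1])
  (diffq x) (cst (2 * C2)) _ _ _ _ _)) => //.
- by move=> n; apply/measurable_restrict => //; apply: measurable_funTS.
- move=> r; rewrite /= in_itv /= => /andP[r0 r1]; apply: cvg_near_cst; near=> n.
  rewrite patchE mem_set//= in_itv /= r1 andbT ltW//; near: n.
  by move: s_cvg => /cvgr_lt; apply.
- have i1 : mu.-integrable `[0, 1] (EFin \o cst (2 * C2)).
    by apply: integrable_segment => r _; exact: continuous1_cst.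
  by apply: integrableS i1 => //; apply: subset_itvr; rewrite bnd_simp.
- move=> n r _; rewrite patchE; case: ifP => _; first exact: diffq_le.
  by rewrite normr0; apply: le_trans (diffq_le x 0).
Unshelve. all: by end_near. Qed.

End Kernel.

End SmoothKernels.

(** * Schwartz functions: the half Laplacian as the Hilbert transform of the derivative *)

Section SchwartzFunctions.
Variable R : realType.
Local Notation mu := (@lebesgue_measure R).
Local Notation w := (@cauchy_weight R).
Implicit Types (x y z r e M C a : R).
Variables (phi : R -> R).
Hypothesis hphi : schwartz phi.

Lemma is_derive_schwartz k x :
  is_derive x 1 (derive1n k phi) (derive1n k.+1 phi x).
Proof. by apply: DeriveDef; [case: hphi => h _; exact: h|rewrite derive1nS derive1E]. Qed.

Lemma continuous_schwartz k : continuous (derive1n k phi).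
Proof. by move=> x; exact: is_derive1_continuous (is_derive_schwartz k x). Qed.

Lemma schwartz_le m k : exists C : R, forall x, (1 + `|x|) ^+ m * `|derive1n k phi x| <= C.
Proof.
(* The extra power j makes the induction on m close: one factor 1 + |x| splits into the cases j and
   j + 1. *)
suff h j : exists C : R, forall x, (1 + `|x|) ^+ m * (`|x| ^+ j * `|derive1n k phi x|) <= C.
  by have [C hC] := h 0%N; exists C => x; have := hC x; rewrite expr0 mul1r.
elim: m j => [|m IH] j.
  by have [_ /(_ j k)[C hC]] := hphi; exists C => x; rewrite expr0 mul1r.
have [C1 h1] := IH j; have [C2 h2] := IH j.+1; exists (C1 + C2) => x.
have := h1 x; have := h2 x; rewrite !exprS; move: (_ ^+ m) (_ ^+ j) (derive1n k phi x) => A B D.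
move=> H2 H1; apply: le_trans (lerD H1 H2).
by rewrite le_eqVlt; apply/orP; left; apply/eqP; ring.
Qed.

Lemma trunc_invN e z : trunc_inv e (- z) = - trunc_inv e z.
Proof. by rewrite /trunc_inv normrN invrN; case: ifP => // _; rewrite oppr0. Qed.

Local Notation phi1 := (derive1n 1 phi).
Let P e x := truncated_integral (hkernel phi1 x) x e.

Lemma measurable_schwartz k : measurable_fun setT (derive1n k phi).
Proof. apply: continuous_measurableR. exact: continuous_schwartz. Qed.

(** Writing x = y + (x - y), x times the truncated transform of phi' is the truncated transform of y
    phi'(y) plus the integral of phi' over |x - y| > e; both are bounded uniformly. This decay is
    what makes the product with a function of size 1/|x| dominated by an integrable weight. *)
Lemma truncated_schwartz_decay : exists C : R, forall x e, 0 < e -> e <= 1 -> (1 + `|x|) * `|P e x| <= C.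
Proof.
have [C1 h1] := schwartz_le 2 1; have [C2 h2] := schwartz_le 0 2.
have [C3 h3] := schwartz_le 3 1; have [C4 h4] := schwartz_le 1 2.
have [C5 h5] := schwartz_le 0 1.
have h2' x : `|derive1n 2 phi x| <= C2 by have := h2 x; rewrite expr0 mul1r.
have h5' x : `|phi1 x| <= C5 by have := h5 x; rewrite expr0 mul1r.
(* One power of 1 + |y| is spent on the factor y, so the quadratic decay of [psi] comes from the
   cubic bound C3, and that of its derivative from C5 and C4. *)
pose psi y := y * phi1 y; pose dpsi y := 1 * phi1 y + y * derive1n 2 phi y.
have dp z : is_derive z 1 psi (dpsi z).
  exact: is_derive1M (is_derive1_id z) (is_derive_schwartz 1 z).
have p1 y : (1 + `|y|) ^+ 2 * `|psi y| <= C3.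
  apply: le_trans (h3 y); rewrite (exprSr _ 2) -mulrA normrM ler_wpM2l ?sqr_ge0//.
  by rewrite ler_wpM2r// lerDr.
have p2 y : `|dpsi y| <= C5 + C4.
  apply: le_trans (ler_normD _ _) _; rewrite mul1r normrM; apply: lerD => //.
  apply: le_trans (h4 y); rewrite expr1 ler_wpM2r// lerDr//.
have cpsi : continuous psi by move=> y; exact: is_derive1_continuous (dp y).
pose W := \int[mu]_y w y.
exists ((2 * C2 + C1 * W) + ((2 * (C5 + C4) + C3 * W) + C1 * W)) => x e e0 e1.
rewrite mulrDl mul1r -normrM; apply: lerD.
  exact: (truncated_smooth_le (is_derive_schwartz 1) h1 h2' x e0 e1).
have i1 : mu.-integrable setT (EFin \o (fun y => psi y * trunc_inv e (x - y))).
  apply: (integrable_decay (K := C3 * e^-1)).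
    exact: measurable_kernel_trunc (continuous_measurableR cpsi).
  move=> y; rewrite normrM mulrAC; apply: ler_pM => //; first exact: decay_sqr_le (p1 y).
  exact: trunc_inv_le_inv.
have b2 y : `|phi1 y * ((x - y) * trunc_inv e (x - y))| <= C1 * w y.
  rewrite normrM -[leRHS]mulr1; apply: ler_pM => //; first exact: decay_sqr_le (h1 y).
  rewrite /trunc_inv; case: ifPn => h; last by rewrite mulr0 normr0.
  by rewrite mulfV ?normr1// -normr_gt0 (lt_trans e0).
have i2 : mu.-integrable setT (EFin \o (fun y => phi1 y * ((x - y) * trunc_inv e (x - y)))).
  apply: (integrable_decay _ b2).
  apply: measurable_funM; first exact: measurable_schwartz.
  apply: (measurable_kernel_trunc (u := fun y => x - y)).
  by apply: continuous_measurableR => y; apply: continuous1B;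
    [exact: continuous1_cst|exact: continuous1_id].
have -> : x * P e x = truncated_integral (hkernel psi x) x e +
    \int[mu]_y (phi1 y * ((x - y) * trunc_inv e (x - y))).
  rewrite /P !truncated_kernel_integral -RintegralZl//; last first.
    apply: (integrable_decay (K := C1 * e^-1)).
      exact: measurable_kernel_trunc (measurable_schwartz 1).
    move=> y; rewrite normrM mulrAC; apply: ler_pM => //; first exact: decay_sqr_le (h1 y).
    exact: trunc_inv_le_inv.
  by rewrite -RintegralD//; apply: eq_Rintegral => y _; rewrite /psi; ring.
apply: le_trans (ler_normD _ _) _; apply: lerD.
  exact: (truncated_smooth_le dp p1 p2 x e0 e1).
apply: le_trans (le_normr_Rintegral measurableT i2) _.
have iw : mu.-integrable setT (EFin \o (fun y => C1 * w y)).
  exact: (integrableZl _ C1 (integrable_oneDsqrV R)).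
rewrite /W -RintegralZl//; last exact: integrable_oneDsqrV.
by apply: le_Rintegral => //; exact: integrable_norm i2.
Qed.

(* Integration by parts in the radial variable; the subtracted term is the
   boundary contribution and tends to 0 with [e]. *)
Lemma half_laplacian_truncation x e : 0 < e ->
  truncated_integral (fun y => (phi x - phi y) / `|x - y| ^+ 2) x e =
  P e x - (phi (x - e) + phi (x + e) - 2 * phi x) / e.
Proof.
move=> e0; pose S r := (phi (x - r) + phi (x + r) - 2 * phi x) / r.
have [M hM] := schwartz_le 0 0.
have M1 y : `|phi y| <= M by have := hM y; rewrite expr0 mul1r derive1n0.
have cphi y : {for y, continuous phi} by exact: (@continuous_schwartz 0%N y).
have dphi y : is_derive y 1 phi (phi1 y) by exact: is_derive_schwartz 0%N y.
pose q y := (phi x - phi y) / `|x - y| ^+ 2.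
have cxy y : {for y, continuous (fun y => x - y)}.
  by apply: continuous1B; [exact: continuous1_cst|exact: continuous1_id].
have caddl y : {for y, continuous (fun y => x + y)}.
  by apply: continuous1D; [exact: continuous1_cst|exact: continuous1_id].
have cq y : y != x -> {for y, continuous q}.
  move=> yx; have yx0 : `|x - y| ^+ 2 != 0.
    by rewrite expf_neq0// normr_eq0 subr_eq0 eq_sym.
  apply: continuous1M; first by apply: continuous1B => //; exact: continuous1_cst.
  apply: continuous1V => //; apply: continuous1X.
  by apply: (continuous1_comp (f := fun z : R => `|z|)) => //; exact: norm_continuous.
have iq : mu.-integrable (away x e) (EFin \o q).
  apply/integrable_mkcond; first exact: measurable_away.
  rewrite restrict_EFin.
  have -> : q \_ (away x e) = fun y => (phi x - phi y) * trunc_inv e (x - y) * trunc_inv e (x - y).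
    apply/funext => y; rewrite patchE /trunc_inv; have [h|h] := boolP (e < `|x - y|).
      by rewrite mem_set// /q real_normK ?num_real// expr2 invfM mulrA.
    by rewrite memNset ?mulr0//; apply/negP.
  apply: (integrable_decay (K := 2 * M * (1 + (1 + `|x|) / e) ^+ 2)).
    apply: measurable_kernel_trunc; apply: measurable_kernel_trunc.
    by apply: measurable_funB => //; exact: measurable_schwartz 0%N.
  move=> y; have k0 : 0 < 1 + (1 + `|x|) / e.
    by rewrite ltr_pwDl// divr_ge0// ?ltW// ltr_pwDl.
  rewrite -mulrA normrM -mulrA; apply: ler_pM => //.
    by have := ler_normB (phi x) (phi y); have := M1 x; have := M1 y; lra.
  rewrite normrM; have h := trunc_inv_le x y e0.
  apply: (@le_trans _ _ (((1 + (1 + `|x|) / e) / (1 + `|y|)) ^+ 2)).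
    by rewrite expr2; apply: ler_pM.
  by rewrite exprMn ler_wpM2l ?sqr_ge0// inv_norm_sqr_le.
have [C1 h1] := schwartz_le 2 1.
have ik : mu.-integrable (away x e) (EFin \o hkernel phi1 x).
  exact: (integrable_smooth_kernel (is_derive_schwartz 1) h1 x e0).
have hq := cvg_truncated_integral e0 cq iq.
have hk := cvg_truncated_integral e0 (fun y h => continuous_kernel (@continuous_schwartz 1) h) ik.
(* The boundary term at infinity is at most 4 M / n because [phi] is bounded by M. *)
have hS : S n%:R @[n --> \oo] --> 0.
  apply/cvgr0Pnorm_le => d d0; near=> n.
  have n0 : (0 : R) < n%:R by near: n; exact: nbhs_infty_gtr.
  have nd : 4 * M / d < n%:R by near: n; exact: nbhs_infty_gtr.
  rewrite normrM normfV (gtr0_norm n0) ler_pdivrMr//.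
  move: nd; rewrite ltr_pdivrMr// => nd.
  apply: le_trans (ler_normB _ _) _; apply: le_trans (lerD (ler_normD _ _) (lexx _)) _.
  rewrite normrM gtr0_norm//.
  by have := M1 (x - n%:R); have := M1 (x + n%:R); have := M1 x; lra.
apply: (cvg_unique _ hq); first exact: norm_hausdorff.
have hR : \int[mu]_(r in `[e, n%:R]) (hkernel phi1 x (x - r) + hkernel phi1 x (x + r)) +
    (S n%:R - S e) @[n --> \oo] --> P e x + (0 - S e).
  by apply: cvgD; [exact: hk|apply: cvgB; [exact: hS|exact: cvg_cst]].
rewrite -[_ / e]/(S e) -[- S e]sub0r; apply: cvg_trans hR; apply: near_eq_cvg; near=> n.
have en : e <= n%:R by near: n; exact: nbhs_infty_ger.
have neq0 r : e <= r <= n%:R -> r != 0.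
  by move=> /andP[er _]; rewrite gt_eqF// (lt_le_trans e0).
(* The derivative of S, and also the folded integrand of the half Laplacian minus the folded Hilbert
   kernel of phi'. *)
pose S' r := (phi1 (x + r) - phi1 (x - r)) / r + (2 * phi x - phi (x - r) - phi (x + r)) / r ^+ 2.
have cS' r : e <= r <= n%:R -> {for r, continuous S'}.
  move=> /neq0 r0; have cl (f : R -> R) : continuous f -> {for r, continuous (fun r => f (x - r))}.
    by move=> cf; apply: (@continuous1_comp _ f (fun r => x - r)) => //; exact: cf.
  have cr (f : R -> R) : continuous f -> {for r, continuous (fun r => f (x + r))}.
    by move=> cf; apply: (@continuous1_comp _ f (fun r => x + r)) => //; exact: cf.
  apply: continuous1D; apply: continuous1M.
  - by apply: continuous1B; [exact: (cr _ (@continuous_schwartz 1))|exact: (cl _ (@continuous_schwartz 1))].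
  - by apply: continuous1V => //; exact: continuous1_id.
  - apply: continuous1B; last exact: (cr _ cphi).
    by apply: continuous1B; [exact: continuous1_cst|exact: (cl _ cphi)].
  - by apply: continuous1V; [rewrite expf_neq0|apply: continuous1X; exact: continuous1_id].
have dS r : e <= r <= n%:R -> is_derive r 1 S (S' r).
  move=> /neq0 r0.
  have d1 := is_derive1_comp_fun (g := fun r => x - r) (dphi (x - r)) (is_derive1B (is_derive1_cst x r) (is_derive1_id r)).
  have d2 := is_derive1_comp_fun (g := fun r => x + r) (dphi (x + r)) (is_derive1D (is_derive1_cst x r) (is_derive1_id r)).
  apply: is_derive1_ext (is_derive1M (is_derive1B (is_derive1D d1 d2)
    (is_derive1_cst (2 * phi x) r)) (is_derive1V (is_derive1_id r) r0)) _ _ => //.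
  by rewrite /S'; field.
rewrite -(Rintegral_FTC2 en cS' dS) -RintegralD//.
- apply: eq_Rintegral => r; rewrite inE /= in_itv /= => ern; have r0 := neq0 r ern.
  have e3 : x - (x - r) = r by ring.
  have e4 : x - (x + r) = - r by ring.
  by rewrite (@kernel_sym _ phi1 x r r0) /q /S' e3 e4 normrN real_normK ?num_real//; field.
- apply: integrable_segment => r /neq0 r0.
  have ck y : y != x -> {for y, continuous (hkernel phi1 x)}.
    exact: (continuous_kernel (@continuous_schwartz 1)).
  apply: continuous1D; apply: (continuous1_comp (f := hkernel phi1 x)) => //; apply: ck.
    by rewrite -subr_eq0 addrAC subrr sub0r oppr_eq0.
  by rewrite -subr_eq0 addrAC subrr add0r.
- exact: integrable_segment.
Unshelve. all: by end_near. Qed.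

Lemma half_laplacian_schwartzE x l : P e x @[e --> 0^'+] --> l ->
  half_laplacian_schwartz phi x = pi^-1 * l.
Proof.
move=> hl; congr (_ * _); apply/cvg_lim => //.
have [C2 h2] := schwartz_le 0 2.
have h2' y : `|derive1n 2 phi y| <= C2 by have := h2 y; rewrite expr0 mul1r.
have C20 : 0 <= C2 by apply: le_trans (h2' 0).
have dphi y : is_derive y 1 phi (phi1 y) by exact: is_derive_schwartz 0%N y.
pose S e := (phi (x - e) + phi (x + e) - 2 * phi x) / e.
(* The mean value theorem on each side of x turns S e into phi'(c) - phi'(d) with |c - d| <= 2 e,
   and the bound on the second derivative finishes. *)
have Sb e : 0 < e -> `|S e| <= 2 * C2 * e.
  move=> e0; have xe : x <= x + e by rewrite lerDl ltW.
  have ex : x - e <= x by rewrite gerBl ltW.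
  have [c hc ec] := mean_value xe dphi; have [d hd ed] := mean_value ex dphi.
  have -> : S e = phi1 c - phi1 d.
    have ec' : phi (x + e) = phi x + phi1 c * e by move: ec; rewrite addrAC subrr add0r => <-; ring.
    have ed' : phi (x - e) = phi x - phi1 d * e.
      have -> : phi1 d * e = phi1 d * (x - (x - e)) by congr (_ * _); ring.
      by rewrite -ed; ring.
    by rewrite /S ec' ed'; field; exact: lt0r_neq0.
  apply: le_trans (lipschitz_of_derive _ _ (is_derive_schwartz 1) h2') _.
  rewrite [2 * C2]mulrC -mulrA ler_wpM2l//; rewrite ler_norml; lra.
have hS : S e @[e --> 0^'+] --> 0.
  apply/cvgr0Pnorm_le => d d0; near=> e.
  have e0 : 0 < e by near: e; exact: nbhs_right_gt.
  apply: le_trans (Sb e e0) _.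
  have ed : e <= d / (2 * C2 + 1).
    by near: e; apply: nbhs_right_le; rewrite divr_gt0//; lra.
  move: ed; rewrite ler_pdivlMr; last by lra.
  lra.
have hR : P e x - S e @[e --> 0^'+] --> l - 0 by apply: cvgB.
rewrite subr0 in hR; apply: cvg_trans hR; apply: near_eq_cvg; near=> e.
by rewrite half_laplacian_truncation//; near: e; exact: nbhs_right_gt.
Unshelve. all: by end_near. Qed.

End SchwartzFunctions.

(** * Pairing with the half Laplacian of a test function *)

Section HalfLaplacianPairing.
Variable R : realType.
Local Notation mu := (@lebesgue_measure R).
Local Notation w := (@cauchy_weight R).
Implicit Types (x y e : R).
Variables (phi u v : R -> R).
Hypotheses (hphi : schwartz phi) (huv : hilbert_pair u v).
Local Notation phi1 := (derive1n 1 phi).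

Let P e x := truncated_integral (hkernel phi1 x) x e.
Let Q e y := truncated_integral (hkernel u y) y e.

Let continuous_u : continuous u. Proof. by case: huv => -[]. Qed.
Let mphi1 : measurable_fun setT phi1. Proof. exact: measurable_schwartz. Qed.

Lemma truncated_hilbert_antisym e : 0 < e ->
  [/\ measurable_fun setT (fun x => u x * P e x),
      measurable_fun setT (fun y => phi1 y * Q e y) &
      \int[mu]_x (u x * P e x) = - \int[mu]_y (phi1 y * Q e y)].
Proof.
move=> e0; have [_ [Cu uC] _ _ _] := huv.
have [C1 h1] := schwartz_le hphi 2 1; have [C3 h3] := schwartz_le hphi 3 1.
have mu_ := continuous_measurableR continuous_u.
pose k x y := u x * (phi1 y * trunc_inv e (x - y)).
have Cu0 : 0 <= Cu by apply: le_trans (uC 0); rewrite mulr_ge0// addr_ge0.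
(* The decay of the kernel in x costs a factor linear in |y|; the cubic decay of phi' absorbs it and
   still leaves the weight in y, hence C3. K may depend on e, since Fubini is applied with e
   fixed. *)
pose K := Cu * (1 + e^-1) * C3.
have mk : measurable_fun setT (fun z : R * R => k z.1 z.2).
  apply: measurable_funM; first exact: measurableT_comp mu_ measurable_fst.
  apply: measurable_funM; first exact: measurableT_comp mphi1 measurable_snd.
  apply: measurableT_comp (measurable_trunc_inv e) _.
  by apply: measurable_funB; [exact: measurable_fst|exact: measurable_snd].
have kK x y : `|k x y| <= K * w x * w y.
  (* Oddness of the kernel exchanges the roles of the variables, so that [kernel_decay] applies to x
     with y as centre; it is also the source of the minus sign in the conclusion. *)
  have -> : k x y = - (phi1 y * (u x * trunc_inv e (y - x))).
    by rewrite /k -opprB trunc_invN; ring.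
  rewrite normrN normrM; have hk := kernel_decay y e0 uC x.
  apply: le_trans (ler_wpM2l (normr_ge0 _) hk) _.
  have -> : `|phi1 y| * (Cu * (1 + (1 + `|y|) / e) * (1 + x ^+ 2)^-1) =
    Cu * w x * (`|phi1 y| * (1 + (1 + `|y|) / e)) by rewrite /cauchy_weight; ring.
  have -> : K * w x * w y = Cu * w x * (C3 * w y * (1 + e^-1)) by rewrite /K; ring.
  have w0 : 0 <= w x by rewrite invr_ge0 addr_ge0// sqr_ge0.
  apply: ler_wpM2l; first by rewrite mulr_ge0.
  apply: (@le_trans _ _ ((1 + `|y|) * `|phi1 y| * (1 + e^-1))).
    rewrite [X in _ <= X * _]mulrC -mulrA ler_wpM2l// mulrDr mulr1 lerD2r lerDl//.
  have ie : 0 <= 1 + e^-1 by rewrite addr_ge0// invr_ge0 ltW.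
  apply: ler_wpM2r => //.
  have := @decay_sqr_le R C3 ((1 + `|y|) * phi1 y) y.
  rewrite normrM [ `|1 + `|y| |]ger0_norm ?addr_ge0//; apply.
  by rewrite mulrA -exprSr; exact: h3.
have [m1 m2 h] := Rintegral_fubini_dominated mk kK.
have e1 : (fun x => \int[mu]_y k x y) = fun x => u x * P e x.
  apply/funext => x; rewrite /P truncated_kernel_integral -RintegralZl//.
  apply: (integrable_decay (K := C1 * e^-1)); first exact: measurable_kernel_trunc.
  move=> y; rewrite normrM mulrAC; apply: ler_pM => //; first exact: decay_sqr_le (h1 y).
  exact: trunc_inv_le_inv.
have e2 : (fun y => \int[mu]_x k x y) = fun y => - (phi1 y * Q e y).
  apply/funext => y; rewrite /Q truncated_kernel_integral -mulNr -RintegralZl//.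
    by apply: eq_Rintegral => x _; rewrite /k -opprB trunc_invN; ring.
  apply: (integrable_decay (K := Cu * (1 + (1 + `|y|) / e))).
    exact: measurable_kernel_trunc.
  exact: kernel_decay e0 uC.
move: m1 m2 h; rewrite e1 e2 => m1 m2 h; split => //.
- by have := measurable_funM (measurable_cst (-1 : R)) m2;
    congr (measurable_fun _ _); apply/funext => y /=; rewrite mulN1r opprK.
- transitivity (\int[mu]_y (-1 * (phi1 y * Q e y))).
    by rewrite -[LHS]/(\int[mu]_x (fun x => u x * P e x) x) h; apply: eq_Rintegral => y _; rewrite mulN1r.
  rewrite RintegralZl ?mulN1r//.
  have [_ _ _ Qpi _] := huv.
  apply: (integrable_decay (K := C1 * pi)).
    by have := measurable_funM (measurable_cst (-1 : R)) m2;
      congr (measurable_fun _ _); apply/funext => y /=; rewrite mulN1r opprK.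
  move=> y; rewrite normrM mulrAC; apply: ler_pM => //; first exact: decay_sqr_le (h1 y).
  exact: Qpi.
Qed.

Lemma half_laplacian_pairing :
  \int[mu]_x (u x * half_laplacian_schwartz phi x) = - \int[mu]_x (v x * phi1 x).
Proof.
have [_ [Cu uC] v1 Qpi Qv] := huv.
have [C1 h1] := schwartz_le hphi 2 1; have [C2 h2] := schwartz_le hphi 0 2.
have h2' x : `|derive1n 2 phi x| <= C2 by have := h2 x; rewrite expr0 mul1r.
have [C hC] := truncated_schwartz_decay hphi.
have pi0 : (pi : R) != 0 by exact: lt0r_neq0 (pi_gt0 R).
have cvP x := cvg_truncated_smooth (is_derive_schwartz hphi 1) h1 h2' x.
have [P0 hP0] := choice cvP.
(* These radii are at most 1, as the decay of the truncated transforms of phi' requires. *)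
pose en n : R := n.+1%:R^-1.
have en0 n : 0 < en n by rewrite invr_gt0.
have en1 n : en n <= 1 by rewrite invf_le1 ?ler1n.
have en_cvg : en n @[n --> \oo] --> 0 by exact: cvg_harmonic.
have Pn x : P (en n) x @[n --> \oo] --> P0 x.
  by move/cvg_at_rightP : (hP0 x); apply.
have Qn y : Q (en n) y @[n --> \oo] --> pi * v y.
  by move/cvg_at_rightP : (Qv y); apply.
have Cu0 : 0 <= Cu by apply: le_trans (uC 0); rewrite mulr_ge0// addr_ge0.
have iw (K : R) : mu.-integrable setT (EFin \o (fun y => K * w y)).
  exact: (integrableZl _ K (integrable_oneDsqrV R)).
have [iuP l1] : mu.-integrable setT (EFin \o (fun x => u x * P0 x)) /\
    \int[mu]_x (u x * P (en n) x) @[n --> \oo] --> \int[mu]_x (u x * P0 x).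
  (* Both factors are of size 1 / (1 + |x|), uniformly in n, so their product is dominated by the
     weight. *)
  apply: (@Rintegral_dominated_cvg R setT (fun n x => u x * P (en n) x) _ (fun y => Cu * C * w y)) => //.
  - by move=> n; case: (truncated_hilbert_antisym (en0 n)).
  - by move=> x _; apply: cvgM; [exact: cvg_cst|exact: Pn].
  - move=> n x _; have x0 : 0 < 1 + `|x| by rewrite ltr_pwDl.
    rewrite normrM; apply: (@le_trans _ _ (Cu / (1 + `|x|) * (C / (1 + `|x|)))).
      by apply: ler_pM => //; rewrite ler_pdivlMr// mulrC//; exact: hC.
    rewrite mulrACA -expr2 ler_wpM2l ?inv_norm_sqr_le// mulr_ge0//.
    by apply: le_trans (hC 0 1 _ _) => //; rewrite mulr_ge0// addr_ge0.
have [ivp l2] : mu.-integrable setT (EFin \o (fun y => phi1 y * (pi * v y))) /\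
    \int[mu]_y (phi1 y * Q (en n) y) @[n --> \oo] --> \int[mu]_y (phi1 y * (pi * v y)).
  apply: (@Rintegral_dominated_cvg R setT (fun n y => phi1 y * Q (en n) y) _ (fun y => C1 * pi * w y)) => //.
  - by move=> n; case: (truncated_hilbert_antisym (en0 n)).
  - by move=> y _; apply: cvgM; [exact: cvg_cst|exact: Qn].
  - move=> n y _; rewrite normrM mulrAC; apply: ler_pM => //; first exact: decay_sqr_le (h1 y).
    exact: Qpi.
have e1 : \int[mu]_x (u x * P0 x) = - \int[mu]_y (phi1 y * (pi * v y)).
  apply: (cvg_unique _ l1); first exact: norm_hausdorff.
  apply: cvg_trans (cvgN l2); apply: near_eq_cvg; apply: nearW => n.
  by case: (truncated_hilbert_antisym (en0 n)).
transitivity (\int[mu]_x (pi^-1 * (u x * P0 x))).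
  by apply: eq_Rintegral => x _; rewrite (half_laplacian_schwartzE hphi (hP0 x)) mulrCA.
rewrite RintegralZl// e1 mulrN; congr (- _).
rewrite -RintegralZl//; apply: eq_Rintegral => y _.
by rewrite mulrCA mulKf// mulrC.
Qed.

End HalfLaplacianPairing.

(** * Integration by parts across the end points *)

Section Pieces.
Variable R : realType.
Local Notation mu := (@lebesgue_measure R).
Implicit Types (a b x y : R) (f : R -> R).

Lemma measurable_lt a : measurable [set x : R | x < a].
Proof. by apply: open_measurable; exact: open_lt. Qed.

Lemma measurable_gt a : measurable [set x : R | a < x].
Proof. by apply: open_measurable; exact: open_gt. Qed.

Lemma set_ooE a b : [set x : R | a < x < b] = [set x | a < x] `&` [set x | x < b].
Proof. by apply/seteqP; split=> x /=; [move/andP|move=> [-> ->]]. Qed.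

Lemma open_oo a b : open [set x : R | a < x < b].
Proof. by rewrite set_ooE; apply: openI; [exact: open_gt|exact: open_lt]. Qed.

Lemma measurable_oo a b : measurable [set x : R | a < x < b].
Proof. by apply: open_measurable; exact: open_oo. Qed.

Lemma integrable_set1 a f : mu.-integrable [set a] (EFin \o f).
Proof.
have : mu.-integrable `[a, a] (EFin \o cst (f a)).
  by apply: integrable_segment => x _; exact: continuous1_cst.
by rewrite set_itv1; apply: eq_integrable => // x; rewrite inE => ->.
Qed.

Lemma setT_pieces a b : a < b -> [set: R] =
  [set x | x < a] `|` ([set x | a < x < b] `|` ([set x | b < x] `|` ([set a] `|` [set b]))).
Proof.
move=> ab; apply/seteqP; split=> x //= _.
have [xa|ax|->] := ltgtP x a; [by left| |by right; right; right; left].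
have [xb|bx|->] := ltgtP x b; last by right; right; right; right.
  by right; left.
by right; right; left.
Qed.

Section TwoPoints.
Variables (a b : R).
Hypothesis ab : a < b.

Let d4 : [disjoint [set a] & [set b]].
Proof. by apply/disj_setPS => x [/= -> /eqP]; rewrite lt_eqF. Qed.

Let d3 : [disjoint [set x | b < x] & [set a] `|` [set b]].
Proof. by apply/disj_setPS => x [/= bx [xa|xb]]; move: bx ab; rewrite ?xa ?xb ?ltxx//; lra. Qed.

Let d2 : [disjoint [set x | a < x < b] & [set x | b < x] `|` ([set a] `|` [set b])].
Proof. by apply/disj_setPS => x [/= ax [bx|[xa|xb]]]; lra. Qed.

Let d1 : [disjoint [set x | x < a] &
  [set x | a < x < b] `|` ([set x | b < x] `|` ([set a] `|` [set b]))].
Proof. by apply/disj_setPS => x [/= ax [bx|[bx|[xa|xb]]]]; move: ab; lra. Qed.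

Let m4 : measurable ([set a] `|` [set b]). Proof. exact: measurableU. Qed.

Let m3 : measurable ([set x : R | b < x] `|` ([set a] `|` [set b])).
Proof. by apply: measurableU => //; exact: measurable_gt. Qed.

Let m2 : measurable ([set x : R | a < x < b] `|` ([set x : R | b < x] `|` ([set a] `|` [set b]))).
Proof. by apply: measurableU => //; exact: measurable_oo. Qed.

Lemma integrable_pieces f :
  mu.-integrable [set x | x < a] (EFin \o f) ->
  mu.-integrable [set x | a < x < b] (EFin \o f) ->
  mu.-integrable [set x | b < x] (EFin \o f) -> mu.-integrable setT (EFin \o f).
Proof.
move=> i1 i2 i3; rewrite (setT_pieces ab).
apply: integrable_setU => //; first exact: measurable_lt.
apply: integrable_setU => //; first exact: measurable_oo.
apply: integrable_setU => //; first exact: measurable_gt.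
by apply: integrable_setU => //; exact: integrable_set1.
Qed.

Lemma Rintegral_pieces f : mu.-integrable setT (EFin \o f) ->
  \int[mu]_x f x = \int[mu]_(x in [set x | x < a]) f x +
    \int[mu]_(x in [set x | a < x < b]) f x + \int[mu]_(x in [set x | b < x]) f x.
Proof.
move=> fi; have sub A : measurable A -> mu.-integrable A (EFin \o f).
  by move=> mA; apply: integrableS fi.
rewrite (setT_pieces ab) Rintegral_setU//; [|exact: measurable_lt|].
  rewrite Rintegral_setU//; [|exact: measurable_oo|exact: sub].
  rewrite Rintegral_setU//; [|exact: measurable_gt|exact: sub].
  rewrite Rintegral_setU//; last exact: sub.
  by rewrite !Rintegral_set1 !addr0 addrA.
by apply: sub; apply: measurableU => //; exact: measurable_lt.
Qed.

End TwoPoints.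

Lemma continuous_measurable_open (D : set R) f : open D ->
  (forall x, D x -> {for x, continuous f}) -> measurable_fun D f.
Proof.
by move=> oD cf; apply: open_continuous_measurable_fun => // x; rewrite inE; exact: cf.
Qed.

Lemma decay_cvg0 f (C c0 : R) (s : nat -> R) : (forall x, (1 + `|x|) * `|f x| <= C) ->
  (forall n, n%:R - c0 <= `|s n|) -> f (s n) @[n --> \oo] --> 0.
Proof.
move=> fC sc; apply/cvgr0Pnorm_le => e e0; near=> n.
have C0 : 0 <= C by apply: le_trans (fC 0); rewrite mulr_ge0// addr_ge0.
have h : C / e + c0 < n%:R by near: n; exact: nbhs_infty_gtr.
have h1 : C / e < 1 + `|s n| by have := sc n; lra.
have s0 : 0 < 1 + `|s n| by rewrite ltr_pwDl.
apply: (@le_trans _ _ (C / (1 + `|s n|))).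
  by rewrite ler_pdivlMr// mulrC; exact: fC.
by rewrite ler_pdivrMr// mulrC -ler_pdivrMr// ltW.
Unshelve. all: by end_near. Qed.

(* The three boundary contributions of [v * phi] telescope. *)
Lemma integration_by_parts_two_points (phi v g : R -> R) a b : a < b -> schwartz phi ->
  continuous v -> (forall x, `|v x| <= 1) ->
  (forall x, x != a -> x != b -> is_derive x 1 v (g x)) ->
  (forall x, x != a -> x != b -> {for x, continuous g}) ->
  mu.-integrable setT (EFin \o g) ->
  mu.-integrable setT (fun x => (g x * phi x)%:E) /\
  \int[mu]_x (g x * phi x) = - \int[mu]_x (v x * derive1n 1 phi x).
Proof.
move=> ab hphi cv v1 dv cg ig.
have [C hC] := schwartz_le hphi 1 0; have [C1 h1] := schwartz_le hphi 2 1.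
have dphi y : is_derive y 1 phi (derive1n 1 phi y) by exact: (is_derive_schwartz hphi 0%N y).
have cphi : continuous phi by move=> y; exact: is_derive1_continuous (dphi y).
have cphi1 : continuous (derive1n 1 phi) by exact: continuous_schwartz.
have mgp : measurable_fun setT (fun x => g x * phi x).
  apply: measurable_funM; last exact: continuous_measurableR.
  by apply/measurable_EFinP; exact: measurable_int ig.
have phiC x : `|phi x| <= C.
  have := hC x; rewrite expr1 derive1n0; apply: le_trans; by rewrite ler_peMl// lerDl.
have igp : mu.-integrable setT (EFin \o (fun x => g x * phi x)).
  have ig' : mu.-integrable setT (EFin \o (fun x => C * `|g x|)).
    exact: (integrableZl _ C (integrable_norm ig)).
  apply: le_integrable ig' => //; first exact/measurable_EFinP.
  move=> x _ /=; rewrite lee_fin normrM mulrC.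
  by apply: le_trans (ler_norm _); rewrite ler_wpM2r.
have ivp : mu.-integrable setT (EFin \o (fun x => v x * derive1n 1 phi x)).
  apply: (integrable_decay (K := C1)).
    by apply: measurable_funM; exact: continuous_measurableR.
  move=> y; rewrite normrM -[leRHS]mul1r; apply: ler_pM => //; exact: decay_sqr_le (h1 y).
split; first exact: igp.
pose h x := g x * phi x + v x * derive1n 1 phi x.
have ih : mu.-integrable setT (EFin \o h).
  by have := integrableD measurableT igp ivp; apply: eq_integrable.
(* The claim becomes that h, the derivative of v phi away from a and b, has integral 0. *)
apply/eqP; rewrite -addr_eq0 -RintegralD//; apply/eqP.
rewrite -[LHS]/(\int[mu]_x h x) (Rintegral_pieces ab ih).
pose F x := v x * phi x.
have cF : continuous F by move=> x; apply: cvgM; [exact: cv|exact: cphi].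
have dF x : x != a -> x != b -> is_derive x 1 F (h x).
  by move=> xa xb; exact: is_derive1M (dv x xa xb) (dphi x).
have ch x : x != a -> x != b -> {for x, continuous h}.
  move=> xa xb; apply: continuous1D; apply: continuous1M; try exact: cg.
  - exact: cphi.
  - exact: cv.
  - exact: cphi1.
have FC x : (1 + `|x|) * `|F x| <= C.
  have := hC x; rewrite expr1 derive1n0; apply: le_trans; rewrite normrM.
  apply: ler_wpM2l; first by rewrite addr_ge0.
  by rewrite -[leRHS]mul1r ler_wpM2r.
have sub A : measurable A -> mu.-integrable A (EFin \o h).
  by move=> mA; apply: integrableS ih.
have cvF (s : nat -> R) l : s n @[n --> \oo] --> l -> F (s n) @[n --> \oo] --> F l.
  by move=> sl; apply: (cvg_comp _ _ sl); exact: cF.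
have harm k : k / n.+1%:R @[n --> \oo] --> (0 : R) := @cvg_harmonic_scale R k.
have I1 : \int[mu]_(x in [set x | x < a]) h x = F a - 0.
  have [ex D1] := exhausting_lty a; rewrite -D1.
  apply: (Rintegral_FTC2_exhaustion (F := F) ex).
  - by rewrite D1 => x /= xa; apply: ch; apply/eqP; move: ab; lra.
  - by rewrite D1 => x /= xa; apply: dF; apply/eqP; move: ab; lra.
  - by rewrite D1; apply: sub; exact: measurable_lt.
  - apply: (decay_cvg0 (c0 := `|a|) FC) => n.
    have e2 : (n.+2%:R : R) = n%:R + 2 by rewrite -addn2 natrD.
    by have := lerB_dist n.+2%:R a; rewrite distrC [ `|n.+2%:R| ]ger0_norm// e2; lra.
  - apply: cvF; rewrite -[X in _ --> X]subr0; apply: cvgB; first exact: cvg_cst.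
    exact: cvg_harmonic.
have I3 : \int[mu]_(x in [set x | b < x]) h x = 0 - F b.
  have [ex D3] := exhausting_gty b; rewrite -D3.
  apply: (Rintegral_FTC2_exhaustion (F := F) ex).
  - by rewrite D3 => x /= xa; apply: ch; apply/eqP; move: ab; lra.
  - by rewrite D3 => x /= xa; apply: dF; apply/eqP; move: ab; lra.
  - by rewrite D3; apply: sub; exact: measurable_gt.
  - apply: cvF; rewrite -[X in _ --> X]addr0; apply: cvgD; first exact: cvg_cst.
    exact: cvg_harmonic.
  - apply: (decay_cvg0 (c0 := `|b|) FC) => n.
    have e2 : (n.+2%:R : R) = n%:R + 2 by rewrite -addn2 natrD.
    by have := lerB_normD n.+2%:R b; rewrite [ `|n.+2%:R| ]ger0_norm// [_ + b]addrC e2; lra.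
have I2 : \int[mu]_(x in [set x | a < x < b]) h x = F b - F a.
  have [ex D2] := exhausting_oo ab; rewrite -D2.
  apply: (Rintegral_FTC2_exhaustion (F := F) ex).
  - by rewrite D2 => x /= xa; apply: ch; apply/eqP; move: ab; lra.
  - by rewrite D2 => x /= xa; apply: dF; apply/eqP; move: ab; lra.
  - by rewrite D2; apply: sub; exact: measurable_oo.
  - apply: cvF; rewrite -[X in _ --> X]addr0; apply: cvgD; first exact: cvg_cst.
    exact: harm.
  - apply: cvF; rewrite -[X in _ --> X]subr0; apply: cvgB; first exact: cvg_cst.
    exact: harm.
by rewrite I1 I2 I3; ring.
Qed.

Lemma Lfun2_decay (u : R -> R) C : measurable_fun setT u ->
  (forall y, (1 + `|y|) * `|u y| <= C) -> u \in Lfun mu 2%:E.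
Proof.
move=> mu_ uC; rewrite inE; apply/andP; split; rewrite inE//=.
rewrite /finite_norm unlock; apply: poweR_lty.
have i2 : mu.-integrable setT (EFin \o (fun y => u y ^+ 2)).
  apply: (integrable_decay (K := C ^+ 2)); first exact: measurable_funX.
  move=> y; apply: decay_sqr_le.
  by rewrite normrX -exprMn ler_pXn2r// nnegrE ?mulr_ge0// ?addr_ge0// (le_trans _ (uC y))// mulr_ge0// addr_ge0.
move: i2 => /integrableP[_]; apply: le_lt_trans.
rewrite le_eqVlt; apply/orP; left; apply/eqP; apply: eq_integral => y _.
by rewrite /= powR_mulrn// normrX.
Qed.

(** Because v is continuous at a and b, its distributional derivative carries no point mass there,
    so the pointwise derivative g represents it once g is integrable. *)
Lemma hilbert_pair_half_laplacian (u v g : R -> R) a b : a < b -> hilbert_pair u v ->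
  (forall x, x != a -> x != b -> is_derive x 1 v (g x)) ->
  (forall x, x != a -> x != b -> {for x, continuous g}) ->
  mu.-integrable setT (EFin \o g) -> half_laplacian u g.
Proof.
move=> ab huv dv cg ig; right; have [[cu cv] [C uC] v1 _ _] := huv; split.
  exact: Lfun2_decay (continuous_measurableR cu) uC.
move=> phi hphi; have [i1 e1] := integration_by_parts_two_points ab hphi cv v1 dv cg ig.
by split=> //; rewrite (half_laplacian_pairing hphi huv) e1.
Qed.

End Pieces.

(** * Continuity and integrability of the densities *)

Section Densities.
Variable R : realType.
Local Notation mu := (@lebesgue_measure R).
Implicit Types (a b x y : R) (k : nat).

Lemma near_continuous1 (f g : R -> R) x : (\near x, f x = g x) ->
  {for x, continuous f} -> {for x, continuous g}.
Proof.
move=> fg cf; have e := nbhs_singleton fg; rewrite /prop_for /continuous_at -e.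
by apply: cvg_trans cf; apply: near_eq_cvg.
Qed.

Lemma continuous1_horner (p : {poly R}) x : {for x, continuous (fun y => p.[y])}.
Proof. exact: continuous_horner. Qed.

Lemma continuous_V k x : x != 1 -> x != -1 -> {for x, continuous (V k)}.
Proof.
move=> x1 xN1; have := norm_eq1 x1 xN1; rewrite neq_lt => /orP[xl|xg].
  apply: (@near_continuous1 (fun y => (Num.sqrt (1 - y ^+ 2))^-1 * (chebT R k).[y])).
    by near=> y; rewrite /V ifT//; near: y; exact: near_norm_lt1.
  apply: continuous1M; last exact: continuous1_horner.
  apply: continuous1V.
    by rewrite gt_eqF// sqrtr_gt0 subr_gt0 -real_normK ?num_real// expr_lt1.
  apply: continuous1_sqrt; apply: continuous1B; first exact: continuous1_cst.
  by apply: continuous1X; exact: continuous1_id.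
apply: (@near_continuous1 (fun=> 0)); last exact: continuous1_cst.
by near=> y; rewrite /V ltNge ifF//; apply/negbF/ltW; near: y; exact: near_norm_gt1.
Unshelve. all: by end_near. Qed.

Lemma continuous_Utilde k x : x != 1 -> x != -1 -> {for x, continuous (Utilde2 k.+2)}.
Proof.
move=> x1 xN1; have := norm_eq1 x1 xN1; rewrite neq_lt => /orP[xl|xg].
  apply: (@near_continuous1 (fun y => (chebU R k).[y])); last exact: continuous1_horner.
  by near=> y; rewrite Utilde_in//; apply/ltW; near: y; exact: near_norm_lt1.
(* Outside [-1, 1] the power in the closed form is [Ttilde k.+1], whose continuity follows from its
   differentiability; the sign is again frozen at x. *)
apply: (@near_continuous1 (fun y => - (Num.sg x * Ttilde k.+1 y / Num.sqrt (y ^+ 2 - 1)))).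
  near=> y; have y1 : 1 < `|y| by near: y; exact: near_norm_gt1.
  have sy : Num.sg y = Num.sg x.
    by near: y; apply: near_sg; rewrite -normr_gt0 (lt_trans _ xg).
  by rewrite Utilde_out// sy /Ttilde leNgt y1 /= sy.
have [s0 _] := sqrt_sqr_sub1 xg.
apply: continuous1N; apply: continuous1M.
  apply: continuous1M; first exact: continuous1_cst.
  exact: is_derive1_continuous (is_derive_Ttilde k x1 xN1).
apply: continuous1V; first exact: lt0r_neq0.
apply: continuous1_sqrt; apply: continuous1B; last exact: continuous1_cst.
by apply: continuous1X; exact: continuous1_id.
Unshelve. all: by end_near. Qed.

Lemma Ttilde_le1 k x : `|Ttilde k x| <= 1.
Proof.
case: k => [|k]; first by rewrite Ttilde0 normr1.
by have [<- _] := jou_pow_real k x; case: (jou_pow_bound k.+1 x 0).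
Qed.

Lemma rescale_sides a b x : a < b -> [/\ x < a -> rescale a b x < -1,
  b < x -> 1 < rescale a b x & a < x < b -> -1 < rescale a b x < 1].
Proof.
move=> ab; have d0 : 0 < b - a by rewrite subr_gt0.
have -> : rescale a b x = (2 * x - (a + b)) / (b - a).
  by rewrite /rescale; field; exact: lt0r_neq0.
split; rewrite ?ltr_pdivrMr// ?ltr_pdivlMr//; lra.
Qed.

Section Columns.
Variables (a b : R) (k : nat).
Hypothesis ab : a < b.
Let al := 2 * k.+1%:R / (b - a).
Let r := @rescale R a b.

Let al0 : 0 < al. Proof. by rewrite divr_gt0 ?subr_gt0// mulr_gt0. Qed.

Definition density_U x := al * Utilde2 k.+2 (r x).
Definition density_V x := al * V k.+1 (r x).

Lemma continuous_density x : x != a -> x != b ->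
  {for x, continuous density_U} /\ {for x, continuous density_V}.
Proof.
move=> xa xb; have [r1 rN1] := rescale_neq ab xa xb.
split; apply: continuous1M; try exact: continuous1_cst.
  by apply: (@continuous1_comp _ (Utilde2 k.+2) r); [exact: continuous_Utilde|exact: continuous_rescale].
by apply: (@continuous1_comp _ (V k.+1) r); [exact: continuous_V|exact: continuous_rescale].
Qed.

Lemma is_derive_density x : x != a -> x != b ->
  is_derive x 1 (fun y => Ttilde k.+1 (r y)) (density_U x) /\
  is_derive x 1 (fun y => - W k (r y)) (density_V x).
Proof.
move=> xa xb; have [r1 rN1] := rescale_neq ab xa xb; have dr := is_derive_rescale a b x.
split.
  apply: is_derive1_ext (is_derive1_comp_fun (is_derive_Ttilde k r1 rN1) dr) _ _ => //.
  by rewrite /density_U /al /r; ring.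
apply: is_derive1_ext (is_derive1N (is_derive1_comp_fun (is_derive_W k r1 rN1) dr)) _ _ => //.
by rewrite /density_V /al /r; ring.
Qed.

(* Off [a, b] the density of [Utilde] has constant sign: it is the derivative of
   a bounded monotone function. *)
Let integrable_U_outside (D : set R) (s : R) (c d : nat -> R) :
  exhausting c d -> \bigcup_n `[c n, d n]%classic = D -> open D -> `|s| = 1 ->
  (forall x, D x -> x != a /\ x != b) ->
  (forall x, D x -> `|density_U x| = s * density_U x) ->
  mu.-integrable D (EFin \o density_U).
Proof.
move=> ex DE oD s1 nD sD; rewrite -DE.
apply: (integrable_bounded_primitive (G := fun x => s * density_U x)
  (F := fun x => s * Ttilde k.+1 (r x)) (M := 1) ex); rewrite DE.
- apply: continuous_measurable_open => // x Dx; have [xa xb] := nD x Dx.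
  by case: (continuous_density xa xb).
- move=> x Dx; have [xa xb] := nD x Dx; apply: continuous1M; first exact: continuous1_cst.
  by case: (continuous_density xa xb).
- move=> x Dx; have [xa xb] := nD x Dx; apply: is_derive1Zl.
  by case: (is_derive_density xa xb).
- by move=> x Dx; rewrite sD.
- by move=> x _; rewrite normrM s1 mul1r Ttilde_le1.
Qed.

(** At r x the function rho equals sg(r x) (|r x| - s) with s <= |r x|, so only powers of the sign
    remain once nonnegative factors are removed from [Utilde_out]. *)
Let density_U_sign x : 1 < `|r x| -> `|density_U x| =
  - (Num.sg (r x) * (Num.sg (r x)) ^+ k.+1) * density_U x.
Proof.
move=> r1; have [s0 s2] := sqrt_sqr_sub1 r1.
rewrite /density_U Utilde_out//; set s := Num.sqrt _ in s0 s2 *; set g := Num.sg _.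
have g2 : g ^+ 2 = 1 by rewrite sqr_sg -normr_gt0 (lt_trans _ r1).
have e : r x - g * s = g * (`|r x| - s) by rewrite mulrBr /g -numEsg.
have h0 : 0 <= `|r x| - s.
  rewrite subr_ge0 -(@ler_pXn2r _ 2)// ?nnegrE ?(ltW s0)//.
  by rewrite s2 real_normK ?num_real//; lra.
have gk : (g * g ^+ k.+1) ^+ 2 = 1 by rewrite exprMn g2 -exprM mulnC exprM g2 expr1n mul1r.
rewrite e exprMn mulrA; have B0 : 0 <= (`|r x| - s) ^+ k.+1 by rewrite exprn_ge0.
move: gk B0; set A := g * g ^+ k.+1; set B := _ ^+ k.+1 => gk B0.
have A1 : `|A| = 1 by apply/eqP; rewrite -(@eqrXn2 _ 2)// real_normK ?num_real// gk expr1n.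
rewrite normrM (gtr0_norm al0) normrN 2!normrM normfV (gtr0_norm s0) A1 mul1r (ger0_norm B0).
transitivity (al * (A ^+ 2 * B / s)); first by rewrite gk mul1r.
by ring.
Qed.

Lemma integrable_density_U : mu.-integrable setT (EFin \o density_U).
Proof.
apply: (integrable_pieces ab).
- have [ex DE] := exhausting_lty a.
  (* The sign given by [density_U_sign] when sg(r x) = -1; on the right of b it is -1 for every
     k. *)
  apply: (integrable_U_outside (s := - (-1 * (-1) ^+ k.+1)) ex DE).
  + exact: open_lt.
  + by rewrite normrN normrM normrX normrN1 expr1n mulr1.
  + by move=> x /= xa; split; apply/eqP; move: ab; lra.
  + move=> x /= xa; have [/(_ xa) rx _ _] := rescale_sides x ab.
    rewrite density_U_sign; last by rewrite ltr0_norm /r; lra.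
    by rewrite ltr0_sg // /r; lra.
- have i1 : mu.-integrable `[a, b] (EFin \o (fun x => al * (chebU R k).[r x])).
    apply: integrable_segment => x _; apply: continuous1M; first exact: continuous1_cst.
    apply: (@continuous1_comp _ (fun y => (chebU R k).[y]) r); first exact: continuous1_horner.
    exact: continuous_rescale.
  have i2 : mu.-integrable [set x | a < x < b] (EFin \o (fun x => al * (chebU R k).[r x])).
    apply: integrableS i1 => //; first exact: measurable_oo.
    by move=> x /= /andP[ax xb]; rewrite in_itv /= !ltW.
  apply: eq_integrable i2; first exact: measurable_oo.
  move=> x; rewrite inE /= => axb; rewrite /density_U Utilde_in//.
  by have [_ _ /(_ axb)] := rescale_sides x ab; rewrite ler_norml /r; lra.
- have [ex DE] := exhausting_gty b.
  apply: (integrable_U_outside (s := -1) ex DE).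
  + exact: open_gt.
  + by rewrite normrN1.
  + by move=> x /= xb; split; apply/eqP; move: ab; lra.
  + move=> x /= xb; have [_ /(_ xb) rx _] := rescale_sides x ab.
    rewrite density_U_sign; last by rewrite gtr0_norm /r; lra.
    by rewrite gtr0_sg ?expr1n ?mulr1// /r; lra.
Qed.

(** The density vanishes outside [a, b]. Inside, |T| <= 1 leaves the inverse square root, the
    derivative of the bounded function [asin]; the slope of [rescale] turns the factor 2 (k+1) / (b
    - a) into k + 1. *)
Lemma integrable_density_V : mu.-integrable setT (EFin \o density_V).
Proof.
have out (D : set R) : measurable D -> (forall x, D x -> 1 < `|r x|) ->
    mu.-integrable D (EFin \o density_V).
  move=> mD h; apply: (eq_integrable _ (EFin \o cst 0)) => //.
    move=> x; rewrite inE => /h rx; rewrite /= /density_V /V ltNge (ltW rx) /=.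
    by rewrite mulr0.
  exact: integrable0.
apply: (integrable_pieces ab).
- apply: out; first exact: measurable_lt.
  move=> x /= xa; have [/(_ xa) rx _ _] := rescale_sides x ab.
  by rewrite ltr0_norm /r; lra.
- have [ex DE] := exhausting_oo ab; rewrite -DE.
  pose G x := al * (Num.sqrt (1 - r x ^+ 2))^-1.
  have rin x : a < x < b -> -1 < r x < 1 by have [_ _] := rescale_sides x ab.
  have s0 x : a < x < b -> 0 < 1 - r x ^+ 2.
    move=> /rin h; rewrite subr_gt0 -real_normK ?num_real// expr_lt1//.
    by rewrite ltr_norml.
  apply: (integrable_bounded_primitive (G := G) (F := fun x => k.+1%:R * asin (r x))
    (M := k.+1%:R * pi) ex); rewrite DE.
  + apply: continuous_measurable_open; first exact: open_oo.
    move=> x /= axb; have xa : x != a by apply/eqP; lra.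
    have xb : x != b by apply/eqP; lra.
    by case: (continuous_density xa xb).
  + move=> x /= axb; apply: continuous1M; first exact: continuous1_cst.
    apply: continuous1V; first by rewrite gt_eqF// sqrtr_gt0 s0.
    apply: continuous1_sqrt; apply: continuous1B; first exact: continuous1_cst.
    by apply: continuous1X; exact: continuous_rescale.
  + move=> x /= axb; have da := is_derive1_asin (rin x axb).
    apply: is_derive1_ext (is_derive1Zl k.+1%:R (is_derive1_comp_fun da (is_derive_rescale a b x))) _ _ => //.
    by rewrite /G /al; ring.
  + move=> x /= axb; have h := rin x axb; have n1 : `|r x| < 1 by rewrite ltr_norml.
    rewrite /density_V /V n1 normrM (gtr0_norm al0) normrM normfV.
    rewrite (ger0_norm (sqrtr_ge0 _)) /G ler_pM2l// -[leRHS]mulr1 ler_wpM2l ?invr_ge0 ?sqrtr_ge0//.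
    by have := Ttilde_le1 k.+1 (r x); rewrite /Ttilde (ltW n1).
  + move=> x /= axb; have /andP[h1 h2] := rin x axb; rewrite normrM ger0_norm// ler_wpM2l//.
    have h : -1 <= r x <= 1 by rewrite !ltW.
    have := asin_geNpi2 h; have := asin_lepi2 h; have := pi_gt0 R; rewrite ler_norml; lra.
- apply: out; first exact: measurable_gt.
  move=> x /= xb; have [_ /(_ xb) rx _] := rescale_sides x ab.
  by rewrite gtr0_norm /r; lra.
Qed.

Lemma half_laplacian_W : half_laplacian (fun y => W k (r y)) density_U.
Proof.
apply: (hilbert_pair_half_laplacian ab (hilbert_pair_W k ab)) => [x xa xb|x xa xb|].
- by case: (is_derive_density xa xb).
- by case: (continuous_density xa xb).
- exact: integrable_density_U.
Qed.

Lemma half_laplacian_Ttilde : half_laplacian (fun y => Ttilde k.+1 (r y)) density_V.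
Proof.
apply: (hilbert_pair_half_laplacian ab (hilbert_pair_T k ab)) => [x xa xb|x xa xb|].
- by case: (is_derive_density xa xb).
- by case: (continuous_density xa xb).
- exact: integrable_density_V.
Qed.

End Columns.
End Densities.

(** * Assembly of the columns *)

Lemma half_laplacian_Srow (R : realType) (a b : R) n (j : 'I_(2 * n + 3)) : a < b ->
  exists2 g : R -> R, half_laplacian (fun t => Srow a b n t 0 j) g &
    forall x : R, x != a -> x != b ->
      {for x, continuous g} /\ g x = (Sstar a b n x *m Amx a b n) 0 j.
Proof.
move=> ab; have [j0|j0] := boolP (j == 0%N :> nat).
  exists (cst 0); first by left; split=> //; apply/funext => t; rewrite SrowE j0 !Ttilde0.
  move=> x _ _; split; first exact: continuous1_cst.
  by rewrite SstarA_col j0.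
have [j1|j1] := boolP (loc j == 0).
  have -> : (fun t => Srow a b n t 0 j) = fun t => W (blk j) (rescale a b t).
    by apply/funext => t; rewrite SrowE (negbTE j0) j1.
  exists (density_U a b (blk j)); first exact: half_laplacian_W.
  move=> x xa xb; split; first by case: (continuous_density (blk j) ab xa xb).
  by rewrite SstarA_col (negbTE j0) j1.
have -> : (fun t => Srow a b n t 0 j) = fun t => Ttilde (blk j).+1 (rescale a b t).
  by apply/funext => t; rewrite SrowE (negbTE j0) (negbTE j1).
exists (density_V a b (blk j)); first exact: half_laplacian_Ttilde.
move=> x xa xb; split; first by case: (continuous_density (blk j) ab xa xb).
by rewrite SstarA_col (negbTE j0) (negbTE j1).
Qed.

Theorem proposition4p1 (R : realType) (a b : R) (hab : a < b) (n : nat) :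
  [/\ (forall x : R, Srow a b n x = Sstar a b n x *m Emx R n),
      (forall (j : 'I_(2 * n + 3)) (x : R),
         hilbert_at (fun t => Srow a b n t 0 j) x
           ((Sstar a b n x *m Hmx R n) 0 j)),
      (forall (j : 'I_(2 * n + 3)) (x : R), x != a -> x != b ->
         is_derive x (1 : R) (fun t => Srow a b n t 0 j)
           ((Sstar a b n x *m Dmx a b n) 0 j)) &
      (forall j : 'I_(2 * n + 3), exists2 g : R -> R,
         half_laplacian (fun t => Srow a b n t 0 j) g &
         forall x : R, x != a -> x != b ->
           {for x, continuous g} /\
           g x = (Sstar a b n x *m Amx a b n) 0 j)].
Proof.
split.
- by move=> x; apply/rowP => j; rewrite SstarE_col.
- by move=> j x; exact: hilbert_at_Srow.
- by move=> j x xa xb; exact: is_derive_Srow.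
- by move=> j; exact: half_laplacian_Srow.
Qed.
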